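(* Let $b\in\mathbb R$, $b\neq0$, $a\ge0$. For $m\in\mathbb N$ let $G_m:\mathbb R\to\mathbb R$, $G_m\in L^1(\mathbb R)$, be such that $G_m\to G$ in $L^1(\mathbb R)$ as $m\to\infty$, and let $F:\mathbb R\times\mathbb R\to\mathbb R$ satisfy Assumption (A) of the context with constants $k,l>0$ and function $h$. Consider the problems $$-\frac{d^4u_m}{dx^4}+b\frac{du_m}{dx}+au_m+\int_{-\infty}^{\infty}G_m(x-y)F(u_m(y),y)\,dy=0,\quad x\in\mathbb R,\ m\in\mathbb N, \qquad (P_m)$$ and the limiting problem $$-\frac{d^4u}{dx^4}+b\frac{du}{dx}+au+\int_{-\infty}^{\infty}G(x-y)F(u(y),y)\,dy=0,\quad x\in\mathbb R. \qquad (P)$$ I) If $a>0$, assume that $2\sqrt{\pi}\,N_{a,b,m}\,l\le 1-\varepsilon$ for all $m\in\mathbb N$ with some fixed $0<\varepsilon<1$. Then each problem $(P_m)$ has a unique solution $u_m\in H^4(\mathbb R)$, and the limiting problem (P) has a unique solution $u\in H^4(\mathbb R)$. II) If $a=0$, assume that $xG_m(x)\in L^1(\mathbb R)$ for all $m\in\mathbb N$, $xG_m(x)\to xG(x)$ in $L^1(\mathbb R)$ as $m\to\infty$, $\int_{-\infty}^\infty G_m(x)\,dx=0$ for all $m\in\mathbb N$, and $2\sqrt{\pi}\,N_{0,b,m}\,l\le1-\varepsilon$ for all $m\in\mathbb N$ with some fixed $0<\varepsilon<1$. Then each problem $(P_m)$ with $a=0$ has a unique solution $u_m\in H^4(\mathbb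 R)$, and the limiting problem (P) with $a=0$ has a unique solution $u\in H^4(\mathbb R)$. In both cases I) and II), $u_m\to u$ in $H^4(\mathbb R)$ as $m\to\infty$. Moreover, in both cases, the unique solution $u_m$ of $(P_m)$ is not identically zero provided that $\operatorname{supp}\widehat{F(0,\cdot)}\cap\operatorname{supp}\widehat{G_m}$ is a set of nonzero Lebesgue measure on the real line; likewise, the unique solution $u$ of (P) does not vanish identically on $\mathbb R$ if $\operatorname{supp}\widehat{F(0,\cdot)}\cap\operatorname{supp}\widehat{G}$ is a set of nonzero Lebesgue measure on the real line.
   Context: All functions in physical space are real valued. $H^4(\mathbb R)$ is the Sobolev space with norm $\|u\|_{H^4(\mathbb R)}^2=\|u\|_{L^2(\mathbb R)}^2+\left\|\frac{d^4u}{dx^4}\right\|_{L^2(\mathbb R)}^2$. Assumption (A): $F:\mathbb R\times\mathbb R\to\mathbb R$ satisfies the Carathéodory condition ($F(u,x)$ is measurable in $x$ for every $u$ and continuous in $u$ for almost every $x$), and there are constants $k>0$, $l>0$ and a nonnegative function $h\in L^2(\mathbb R)$ such that $|F(u,x)|\le k|u|+h(x)$ for all $u,x\in\mathbb R$, and $|F(u_1,x)-F(u_2,x)|\le l|u_1-u_2|$ for all $u_1,u_2,x\in\mathbb R$. Fourier transform: $\widehat G(p)=\frac1{\sqrt{2\pi}}\int_{-\infty}^\infty G(x)e^{-ipx}\,dx$, $p\in\mathbb R$ (extended to $L^2(\mathbb R)$ as usual). $\widehat{F(0,\cdot)}$ is the Fourier transform of the $L^2$ function $x\mapsto F(0,x)$.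 The support of a Fourier transform is understood here as the set where it is nonzero (up to Lebesgue null sets). For $a\ge0$, $b\in\mathbb R$, $b\neq0$, $m\in\mathbb N$: $$N_{a,b,m}:=\max\left\{\left\|\frac{\widehat{G_m}(p)}{p^4-a-ibp}\right\|_{L^\infty(\mathbb R)},\ \left\|\frac{p^4\widehat{G_m}(p)}{p^4-a-ibp}\right\|_{L^\infty(\mathbb R)}\right\}.$$ *)

(* Defs.v *)
(* MathComp-Analysis, over an arbitrary [R : realType]. *)
From HB Require Import structures.
From mathcomp Require Import all_boot all_order all_algebra.
From mathcomp Require Import all_classical all_reals all_analysis.
From mathcomp Require Import complex.

Set Implicit Arguments.
Unset Strict Implicit.
Unset Printing Implicit Defensive.
Import Order.TTheory GRing.Theory Num.Theory.
Import numFieldNormedType.Exports.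

Local Open Scope classical_set_scope.
Local Open Scope complex_scope.
Local Open Scope ring_scope.

(* The library's Lebesgue measure lives on the Borel sigma-algebra; a function
   is Lebesgue measurable iff it coincides almost everywhere with a Borel one.
   [ae_closure A] turns a class of Borel functions into the corresponding class
   of Lebesgue measurable functions. Integrals and Lnorms below are insensitive
   to modification on null sets, even by non-Borel functions. *)
Definition ae_closure (R : realType) (A : set (R -> R)) : set (R -> R) :=
  [set f | exists2 g, A g & {ae @lebesgue_measure R, forall x, f x = g x}].

Definition Lmeasurable (R : realType) : set (R -> R) :=
  ae_closure [set g | measurable_fun [set: R] g].

Definition Lp (R : realType) (p : \bar R) : set (R -> R) :=
  ae_closure [set g | g \in Lfun (@lebesgue_measure R) p].

Definition normLp (R : realType) (p : \bar R) (f : R -> R) : \bar R :=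
  ('N[@lebesgue_measure R]_p[EFin \o f])%E.

Definition L1loc (R : realType) : set (R -> R) :=
  ae_closure [set g | locally_integrable [set: R] g].

Definition cvg_Lp (R : realType) (p : \bar R) (f_ : nat -> R -> R) (f : R -> R)
    : Prop :=
  Lp p f /\
  normLp p (fun x => f_ m x - f x) @[m --> \oo] --> 0%E.

Definition test_function (R : realType) : set (R -> R) :=
  [set phi | (forall n x, derivable (derive1n n phi) x 1) /\
             compact (closure [set x | phi x != 0])].

Definition weak_derivative (R : realType) (n : nat) (u v : R -> R) : Prop :=
  [/\ L1loc u, L1loc v & forall phi, test_function phi ->
    \int[@lebesgue_measure R]_x (u x * derive1n n phi x) =
    (-1) ^+ n * \int[@lebesgue_measure R]_x (v x * phi x)].

(* A chosen representative of the n-th weak derivative, which is unique up to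
   a null set; the zero function when there is none. *)
Definition wderiv (R : realType) (n : nat) (u : R -> R) : R -> R :=
  xget (cst 0) [set v | weak_derivative n u v].

(* Elements of H^4 are represented by functions, to be compared a.e. *)
Definition H4 (R : realType) : set (R -> R) :=
  [set u | Lp 2%:E u /\ forall n, (n <= 4)%N ->
             exists2 v, Lp 2%:E v & weak_derivative n u v].

Definition H4norm (R : realType) (u : R -> R) : \bar R :=
  ((normLp 2%:E u ^+ 2 + normLp 2%:E (wderiv 4 u) ^+ 2) `^ (2^-1))%E.

Definition cmod (R : realType) (z : R[i]) : R := Normc.normc z.

(* exp(i t) *)
Definition expi (R : realType) (t : R) : R[i] := cos t +i* sin t.

Definition Cintegral (R : realType) (f : R -> R[i]) : R[i] :=
  (\int[@lebesgue_measure R]_x complex.Re (f x)) +i*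
  (\int[@lebesgue_measure R]_x complex.Im (f x)).

(* Fourier transform of an integrable function. *)
Definition fourier (R : realType) (f : R -> R) (p : R) : R[i] :=
  ((Num.sqrt (2 * pi))^-1)%:C * Cintegral (fun x => (f x)%:C * expi (- (p * x))).

(* [g] is (a representative of) the Fourier transform of [f], extended to L^2:
   the L^2 limit of the transforms of the truncations of [f] to [-n, n]. *)
Definition is_fourierL2 (R : realType) (f : R -> R) (g : R -> R[i]) : Prop :=
  [/\ Lp 2%:E (fun p => complex.Re (g p)), Lp 2%:E (fun p => complex.Im (g p)) &
    normLp 2%:E (fun p =>
        cmod (fourier (fun x => f x * \1_(`[- n%:R, n%:R]) x) p - g p))
      @[n --> \oo] --> 0%E].

(* Caratheodory condition, sublinear growth (constants k, h) and Lipschitz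
   continuity (constant l); the first argument of F is the unknown. *)
Definition assumptionA (R : realType) (F : R -> R -> R) (k l : R) (h : R -> R)
    : Prop :=
  [/\ (forall u, Lmeasurable (F u)) /\
      {ae @lebesgue_measure R, forall x, continuous (fun u => F u x)},
      0 < k /\ 0 < l,
      Lp 2%:E h /\ (forall x, 0 <= h x),
      forall u x, `|F u x| <= k * `|u| + h x &
      forall u1 u2 x, `|F u1 x - F u2 x| <= l * `|u1 - u2| ].

(* p^4 - a - i b p *)
Definition symb (R : realType) (a b p : R) : R[i] :=
  (p ^+ 4 - a) -i* (b * p).

(* The constant N_{a,b,m}, for [Gm] the kernel G_m; it may be +oo. *)
Definition Nab (R : realType) (a b : R) (Gm : R -> R) : \bar R :=
  maxe
    (normLp +oo%E (fun p => cmod (fourier Gm p / symb a b p)))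
    (normLp +oo%E (fun p => cmod ((p ^+ 4)%:C * fourier Gm p / symb a b p))).

Definition is_solution (R : realType) (a b : R) (K : R -> R) (F : R -> R -> R)
    (u : R -> R) : Prop :=
  H4 u /\
  {ae @lebesgue_measure R, forall x,
    - wderiv 4 u x + b * wderiv 1 u x + a * u x
      + \int[@lebesgue_measure R]_y (K (x - y) * F (u y) y) = 0}.

Definition has_unique_solution (R : realType) (a b : R) (K : R -> R)
    (F : R -> R -> R) : Prop :=
  exists2 u, is_solution a b K F u &
    forall v, is_solution a b K F v ->
      {ae @lebesgue_measure R, forall x, v x = u x}.

(* supp of f0 meets supp of f1 in a set of nonzero Lebesgue measure, where supp
   is the set of points at which a function does not vanish. *)
Definition supports_meet (R : realType) (f0 f1 : R -> R[i]) : Prop :=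
  ~ (@lebesgue_measure R).-negligible
      ([set p | f0 p != 0] `&` [set p | f1 p != 0]).

Definition not_identically_zero (R : realType) (u : R -> R) : Prop :=
  ~ {ae @lebesgue_measure R, forall x, u x = 0}.

(* Main.v *)
Require Import Defs.
From HB Require Import structures.
From mathcomp Require Import all_boot all_order all_algebra.
From mathcomp Require Import all_classical all_reals all_analysis.
From mathcomp Require Import measurable_realfun ess_sup_inf ring lra zify.
From mathcomp Require Import complex.
Set Implicit Arguments.
Unset Strict Implicit.
Unset Printing Implicit Defensive.
Import Order.TTheory GRing.Theory Num.Theory.
Import numFieldNormedType.Exports.
Local Open Scope classical_set_scope.
Local Open Scope ring_scope.

(** The equation is solved on the transform side by a contraction in [L^2].

    All functions are real, so the Fourier transform is replaced by the Hartley
    transform, with kernel [cos t + sin t]: it is real, symmetric and its own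
    inverse on [L^2] ([T], [T_adjoint], [TK]). The last fact comes from a
    regularised Parseval identity, in which Abel summation turns the kernel into
    the Poisson kernel ([hart_decay_parseval], [hart_bessel],
    [hart_parseval_test]). On the transform side a weak derivative becomes
    [w |-> - p w(-p)] ([weak_derivative_multiplier] and, for the converse,
    [weak_derivative_hartley]), and convolution by an integrable kernel becomes
    [convT] ([conv_hartley]). Both mix only the frequencies [p] and [-p].

    Hence [u] solves the problem with kernel [K] exactly when the values of its
    transform at [p] and [-p] solve a two by two linear system whose right-hand
    side comes from [K] and from [y |-> F (u y) y] ([equation_hartley]). The
    determinant [den p] is the squared modulus of [p^4 - a - i b p], which is
    positive off the origin because [b] is not zero, and both the system and
    [convT] are scaled rotations. The squared length of the solution is therefore
    [2 pi |K^(p)|^2 / den p] times that of the source ([weighted_sol_sqr]), and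
    the bound [C] on [|K^(p)| / |p^4 - a - i b p|] and on its product with [p^4]
    controls [u] and its fourth derivative. As [F] is Lipschitz, the solution
    map is Lipschitz in [L^2] with constant [sqrt (2 pi) C l < 1], and Banach's
    theorem gives existence and uniqueness ([hartley_solution_exists],
    [hartley_solution_unique]). The nonlinear term has a Borel representative by
    [nemytskii_L2].

    Convergence of the kernels in [L^1] gives pointwise convergence of their
    transforms, so the limit kernel inherits the bound [C]
    ([symbol_bounded_cvg]). For a fixed source the solutions converge in [L^2],
    with and without the weight [p^4], by dominated convergence
    ([weighted_sol_cvg]); the contraction absorbs the change of the source
    ([hartley_solution_stable]), which gives convergence in [H^4].

    Finally, if [u = 0] is a solution, its system has zero right-hand side, so
    the squared moduli of the transforms of [K] and of [F 0] have product zero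
    almost everywhere ([zero_solution_hartley], [fourierL2_hartley]). *)

(** * Integration on the real line *)

#[global] Instance ae_lebesgue_filter {R : realType} :
  Filter (almost_everywhere (@lebesgue_measure R)).
Proof. exact: ae_filter_ringOfSetsType. Qed.

Section measure_tools.
Context {R : realType}.
Local Notation mu := (@lebesgue_measure R).
Implicit Types f g h : R -> R.

Import HBNNSimple.

(** The integral of a nonnegative function is a supremum over the simple
    functions below it, and such a simple function can be set to zero on a null
    set without changing its integral. Measurability is not assumed because the
    integrands of the problem are only almost everywhere equal to Borel ones. *)
Lemma integral_ae (f g : R -> \bar R) :
  {ae mu, forall x, f x = g x} -> (\int[mu]_x f x = \int[mu]_x g x)%E.
Proof.
suff le u v : {ae mu, forall x, u x = v x} -> (forall x, (0 <= u x)%E) ->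
    (forall x, (0 <= v x)%E) -> (\int[mu]_x u x <= \int[mu]_x v x)%E.
  move=> fg; rewrite integralE [RHS]integralE; congr (_ - _)%E; apply/eqP;
    rewrite eq_le; apply/andP; split; apply: le => //;
    by apply: filterS fg => x fgx; rewrite ?funeposE ?funenegE fgx.
move=> [N [mN N0 uvN]] u0 v0.
rewrite !ge0_integralTE//; apply: ge_ereal_sup => _ /= [s su <-].
pose s' := mul_nnsfun s (indic_nnsfun R (measurableC mN)).
have -> : sintegral mu s = sintegral mu s'.
  rewrite -!integralT_nnsfun; apply: ge0_ae_eq_integral => //.
  - exact/measurable_EFinP.
  - exact/measurable_EFinP.
  - by move=> x _; rewrite lee_fin.
  - by move=> x _; rewrite lee_fin.
  exists N; split => // x /=; apply: contra_notP => Nx _.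
  rewrite /=; congr (_%:E); change (s x = s x * \1_(~` N) x).
  by rewrite indicE mem_set// mulr1.
apply: ereal_sup_ubound; exists s' => // x.
change ((s x * \1_(~` N) x)%:E <= v x)%E; rewrite indicE.
case: (boolP (x \in ~` N)) => [|_]; last by rewrite mulr0 v0.
rewrite inE => Nx; rewrite mulr1; apply: (le_trans (su x)).
by rewrite le_eqVlt; apply/orP; left; apply/eqP; apply: contrapT => /uvN.
Qed.

Lemma Rintegral_ae f g :
  {ae mu, forall x, f x = g x} -> \int[mu]_x f x = \int[mu]_x g x.
Proof.
move=> fg; congr fine; apply: integral_ae.
by apply: filterS fg => x ->.
Qed.

(** Translations and reflections preserve Lebesgue measure; what follows from
    this alone is stated once for both. *)
Section preserving.
Variables (phi : R -> R).
Hypothesis mphi : @measurable_fun _ _ (measurableTypeR R) (measurableTypeR R)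
  setT phi.
Hypothesis phiE : forall A : set (measurableTypeR R),
  measurable A -> mu (phi @^-1` A) = mu A.

Lemma ge0_integral_preserving (f : R -> \bar R) :
  measurable_fun [set: R] f -> (forall x, 0 <= f x)%E ->
  (\int[mu]_x f (phi x) = \int[mu]_x f x)%E.
Proof.
move=> mf f0.
have := @ge0_integral_pushforward _ _ (measurableTypeR R) (measurableTypeR R)
  R phi mphi mu setT f measurableT mf.
rewrite preimage_setT => <- //.
by apply: eq_measure_integral => A mA _; exact: phiE.
Qed.

Lemma integral_preserving (f : R -> \bar R) :
  measurable_fun [set: R] f ->
  (\int[mu]_x f (phi x) = \int[mu]_x f x)%E.
Proof.
move=> mf; rewrite integralE [RHS]integralE; congr (_ - _)%E.
- rewrite -(ge0_integral_preserving (f := f^\+%E))//.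
    by apply: eq_integral => x _; rewrite !funeposE.
  exact: measurable_funepos.
- rewrite -(ge0_integral_preserving (f := f^\-%E))//.
    by apply: eq_integral => x _; rewrite !funenegE.
  exact: measurable_funeneg.
Qed.

Lemma Rintegral_preserving f : measurable_fun [set: R] f ->
  \int[mu]_x f (phi x) = \int[mu]_x f x.
Proof.
move=> mf; congr fine; rewrite -(integral_preserving (f := EFin \o f))//.
exact/measurable_EFinP.
Qed.

Lemma integrable_preserving (f : R -> \bar R) :
  mu.-integrable setT f -> mu.-integrable setT (f \o phi).
Proof.
move=> /integrableP[mf If]; apply/integrableP; split.
  exact: measurableT_comp.
rewrite (ge0_integral_preserving (f := fun x => `|f x|%E))//.
exact: measurableT_comp.
Qed.

Lemma ae_preserving (P : R -> Prop) :
  {ae mu, forall x, P x} -> {ae mu, forall x, P (phi x)}.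
Proof.
move=> [N [mN N0 PN]]; exists (phi @^-1` N); split.
- by rewrite -[X in measurable X]setTI; exact: mphi.
- by have := phiE mN; rewrite N0.
- by move=> x /= nP; exact: (PN (phi x)).
Qed.
End preserving.

Lemma measurable_shift t : measurable_fun [set: R] (fun x : R => x + t).
Proof. exact: measurable_funD. Qed.

Lemma lebesgue_measure_shift t (A : set R) : measurable A ->
  mu ((fun x => x + t) @^-1` A) = mu A.
Proof.
move=> mA; apply/esym.
pose sh : measurableTypeR R -> measurableTypeR R := fun x => x + t.
have msh : measurable_fun setT sh by exact: measurable_shift.
pose phi : {mfun _ >-> _} := HB.pack sh (isMeasurableFun.Build _ _ _ _ _ msh).
apply: (@lebesgue_measure_unique _ (pushforward mu phi)) => // _ [[a b]] _ <-.
transitivity (mu `]a - t, b - t]%classic); last first.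
  congr (mu _); apply/seteqP.
  by split => x; rewrite /= !in_itv/= ltrBlDr lerBrDr.
rewrite !lebesgue_measure_itv/= !lte_fin ltrD2r.
by case: ifP => // _; rewrite -!EFinD; congr EFin; ring.
Qed.

Lemma measurable_reflect t : measurable_fun [set: R] (fun x : R => t - x).
Proof. exact: measurable_funB. Qed.

Lemma lebesgue_measure_reflect t (A : set R) : measurable A ->
  mu ((fun x => t - x) @^-1` A) = mu A.
Proof.
move=> mA; rewrite -[RHS](lebesgue_measure_shift t mA) -[RHS]lebesgue_measureN//.
  by congr (mu _); apply/seteqP; split => x; rewrite /= addrC.
rewrite -[X in measurable X]setTI.
exact: measurable_shift.
Qed.

Definition L1 f := mu.-integrable [set: R] (EFin \o f).

Lemma L1_measurable f : L1 f -> measurable_fun [set: R] f.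
Proof. by move=> /integrableP[/measurable_EFinP]. Qed.

Lemma L1_lty f : L1 f -> (\int[mu]_x `|f x|%:E < +oo)%E.
Proof. by move=> /integrableP[]. Qed.

Lemma L1_le f g : measurable_fun [set: R] f -> L1 g ->
  (forall x, `|f x| <= g x) -> L1 f.
Proof.
move=> mf ig fg; apply: le_integrable ig => //; first exact/measurable_EFinP.
by move=> x _ /=; rewrite lee_fin (le_trans (fg x))// ler_norm.
Qed.

Lemma L1_le_ae f g : measurable_fun [set: R] f -> L1 g ->
  {ae mu, forall x, `|f x| <= g x} -> L1 f.
Proof.
move=> mf lg fg; apply/integrableP; split; first exact/measurable_EFinP.
apply: (le_lt_trans _ (L1_lty lg)); apply: ae_ge0_le_integral => //.
- by apply/measurable_EFinP; exact: measurableT_comp.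
- by apply/measurable_EFinP; apply: measurableT_comp => //; exact: L1_measurable.
- by apply: filterS fg => x fg _; rewrite lee_fin (le_trans fg)// ler_norm.
Qed.

Lemma L1_eq f g : f =1 g -> L1 f -> L1 g.
Proof. by move=> /funext ->. Qed.

Lemma L1_0 : L1 (cst 0).
Proof. exact: integrable0. Qed.

Lemma L1D f g : L1 f -> L1 g -> L1 (fun x => f x + g x).
Proof. by move=> /integrableD /[apply]; exact. Qed.

Lemma L1B f g : L1 f -> L1 g -> L1 (fun x => f x - g x).
Proof. by move=> /integrableB /[apply]; exact. Qed.

Lemma L1Z c f : L1 f -> L1 (fun x => c * f x).
Proof. by move=> /(integrableZl _ c); exact. Qed.

Lemma L1_norm f : L1 f -> L1 (fun x => `|f x|).
Proof. exact: integrable_norm. Qed.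

Lemma L1M_bounded M f g : L1 f -> measurable_fun [set: R] g ->
  (forall x, `|g x| <= M) -> L1 (fun x => f x * g x).
Proof.
move=> lf mg gM.
apply: (@L1_le _ (fun x => M * `|f x|)).
- by apply: measurable_funM => //; exact: L1_measurable.
- exact/L1Z/L1_norm.
- by move=> x; rewrite normrM mulrC ler_wpM2r.
Qed.

Lemma RintD f g : L1 f -> L1 g ->
  \int[mu]_x (f x + g x) = \int[mu]_x f x + \int[mu]_x g x.
Proof. by move=> lf lg; rewrite RintegralD. Qed.

Lemma RintB f g : L1 f -> L1 g ->
  \int[mu]_x (f x - g x) = \int[mu]_x f x - \int[mu]_x g x.
Proof. by move=> lf lg; rewrite RintegralB. Qed.

Lemma RintZ c f : L1 f -> \int[mu]_x (c * f x) = c * \int[mu]_x f x.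
Proof. by move=> lf; rewrite RintegralZl. Qed.

Lemma RintN f : L1 f -> \int[mu]_x (- f x) = - \int[mu]_x f x.
Proof.
move=> lf; rewrite -mulN1r -RintZ//.
by apply: eq_Rintegral => x _; rewrite mulN1r.
Qed.

Lemma le_Rint f g : L1 f -> L1 g -> (forall x, f x <= g x) ->
  \int[mu]_x f x <= \int[mu]_x g x.
Proof. by move=> lf lg fg; apply: le_Rintegral. Qed.

(** Replacing [g] by [max f g] changes it on a null set only. *)
Lemma le_Rint_ae f g : L1 f -> L1 g -> {ae mu, forall x, f x <= g x} ->
  \int[mu]_x f x <= \int[mu]_x g x.
Proof.
move=> lf lg fg; rewrite -[leRHS]/(\int[mu]_x g x).
have mf := L1_measurable lf; have mg := L1_measurable lg.
have lM : L1 (fun x => Num.max (f x) (g x)).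
  apply: (@L1_le _ (fun x => `|f x| + `|g x|)).
  - exact: measurable_maxr.
  - by apply: L1D; exact: L1_norm.
  - by move=> x; rewrite /Num.max; case: ifP => _; rewrite ?lerDl ?lerDr.
rewrite [leRHS](_ : _ = \int[mu]_x Num.max (f x) (g x)).
  by apply: le_Rint => // x; rewrite le_max lexx.
by apply: Rintegral_ae; apply: filterS fg => x ?; rewrite max_r.
Qed.

Lemma le_norm_Rint f : L1 f -> `|\int[mu]_x f x| <= \int[mu]_x `|f x|.
Proof. by move=> lf; apply: le_normr_Rintegral. Qed.

Lemma EFin_Rint f : L1 f -> (\int[mu]_x f x)%:E = (\int[mu]_x (f x)%:E)%E.
Proof. by move=> lf; rewrite fineK//; exact: integrable_fin_num. Qed.

Lemma Rintegral_shift t f : measurable_fun [set: R] f ->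
  \int[mu]_x f (x + t) = \int[mu]_x f x.
Proof.
apply: Rintegral_preserving; first exact: measurable_shift.
exact: lebesgue_measure_shift.
Qed.

Lemma Rintegral_reflect t f : measurable_fun [set: R] f ->
  \int[mu]_x f (t - x) = \int[mu]_x f x.
Proof.
apply: Rintegral_preserving; first exact: measurable_reflect.
exact: lebesgue_measure_reflect.
Qed.

Lemma Rintegral_opp f : measurable_fun [set: R] f ->
  \int[mu]_x f (- x) = \int[mu]_x f x.
Proof.
move=> mf; rewrite -(Rintegral_reflect 0 mf).
by apply: eq_Rintegral => x _; rewrite sub0r.
Qed.

Lemma L1_shift t f : L1 f -> L1 (fun x => f (x + t)).
Proof.
apply: integrable_preserving; first exact: measurable_shift.
exact: lebesgue_measure_shift.
Qed.

Lemma L1_reflect t f : L1 f -> L1 (fun x => f (t - x)).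
Proof.
apply: integrable_preserving; first exact: measurable_reflect.
exact: lebesgue_measure_reflect.
Qed.

Lemma L1_opp f : L1 f -> L1 (fun x => f (- x)).
Proof. by move=> /(L1_reflect 0); apply: L1_eq => x; rewrite sub0r. Qed.

Lemma ae_reflect t (P : R -> Prop) :
  {ae mu, forall x, P x} -> {ae mu, forall x, P (t - x)}.
Proof.
apply: ae_preserving; first exact: measurable_reflect.
exact: lebesgue_measure_reflect.
Qed.

Lemma ae_opp (P : R -> Prop) :
  {ae mu, forall x, P x} -> {ae mu, forall x, P (- x)}.
Proof. by move=> /(ae_reflect 0); apply: filterS => x; rewrite sub0r. Qed.

Lemma measurable_comp_opp f : measurable_fun [set: R] f ->
  measurable_fun [set: R] (fun x => f (- x)).
Proof. by move=> mf; apply: measurableT_comp. Qed.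

Lemma Rint_dominated_cvg (f_ : nat -> R -> R) f g :
  (forall n, measurable_fun [set: R] (f_ n)) -> measurable_fun [set: R] f ->
  L1 g -> {ae mu, forall x, f_ ^~ x @ \oo --> f x} ->
  {ae mu, forall x, forall n, `|f_ n x| <= g x} ->
  (\int[mu]_x f_ n x) @[n --> \oo] --> \int[mu]_x f x.
Proof.
move=> mf_ mf lg f_f f_g.
have f_f' : {ae mu, forall x, setT x -> (f_ n x)%:E @[n --> \oo] --> (f x)%:E}.
  by apply: filterS f_f => x f_f _; apply: cvg_EFin => //; exact: nearW.
have f_g' : {ae mu, forall x n, setT x -> (`|(f_ n x)%:E| <= (g x)%:E)%E}.
  by apply: filterS f_g => x f_g n _ /=; rewrite lee_fin.
have [] := @dominated_convergence _ (measurableTypeR R) R mu setT measurableT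
  (fun n x => (f_ n x)%:E) (fun x => (f x)%:E) (fun x => (g x)%:E)
  (fun n => (measurable_EFinP _ _).2 (mf_ n)) ((measurable_EFinP _ _).2 mf)
  f_f' lg f_g'.
move=> lf _; rewrite -(fineK (integrable_fin_num measurableT lf)).
by move=> /fine_cvgP[].
Qed.

Lemma L1_fatou (f_ : nat -> R -> R) f C :
  (forall n, L1 (f_ n)) -> (forall n x, 0 <= f_ n x) ->
  measurable_fun [set: R] f -> {ae mu, forall x, f_ ^~ x @ \oo --> f x} ->
  (forall n, \int[mu]_x f_ n x <= C) ->
  L1 f /\ \int[mu]_x f x <= C.
Proof.
move=> lf_ f_0 mf f_f f_C.
have mf_ n := L1_measurable (lf_ n).
have key : (\int[mu]_x `|f x|%:E <= C%:E)%E.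
  have F := @fatou _ _ R mu setT measurableT (fun n x => (f_ n x)%:E)
    (fun n => (measurable_EFinP _ _).2 (mf_ n)) (fun n x _ => f_0 n x).
  rewrite (integral_ae (g := fun x => limn_einf (fun n => (f_ n x)%:E))).
    apply: (le_trans F); rewrite limn_einf_lim.
    apply: lime_le; first exact: is_cvg_einfs.
    apply: nearW => n; apply: (@le_trans _ _ (\int[mu]_x (f_ n x)%:E)%E).
      by apply: ereal_inf_lbound; exists n => //=.
    by rewrite -EFin_Rint// lee_fin.
  apply: filterS f_f => x f_f; have fx0 : 0 <= f x.
    by apply: (cvgr_to_ge f_f); apply: nearW => n.
  have /cvg_limn_einf_sup[-> _] // : (fun n => (f_ n x)%:E) @ \oo --> (f x)%:E.
    by apply: cvg_EFin => //; exact: nearW.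
  by rewrite ger0_norm.
have lf : L1 f.
  apply/integrableP; split; first exact/measurable_EFinP.
  exact: (le_lt_trans key (ltey _)).
split => //; rewrite -lee_fin (le_trans _ key)// EFin_Rint//.
by apply: (le_trans (lee_abs _)); exact: le_abse_integral (measurable_int _ lf).
Qed.

Lemma L1M_prod f g : L1 f -> L1 g ->
  (mu \x mu)%E.-integrable [set: R * R] (fun z => (f z.1 * g z.2)%:E).
Proof.
move=> lf lg; have mf := L1_measurable lf; have mg := L1_measurable lg.
apply/integrable12ltyP.
  apply/measurable_EFinP/measurable_funM.
  - exact: (measurableT_comp mf measurable_fst).
  - exact: (measurableT_comp mg measurable_snd).
under eq_integral => x _.
  under eq_integral => y _ do rewrite /= normrM EFinM.
  rewrite ge0_integralZl_EFin//; last first.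
    by apply/measurable_EFinP; exact: measurableT_comp.
  over.
rewrite ge0_integralZr//.
- by apply: lte_mul_pinfty; rewrite ?integral_ge0// ?L1_lty// ge0_fin_numE ?L1_lty// integral_ge0.
- by apply/measurable_EFinP; exact: measurableT_comp.
- exact: integral_ge0.
Qed.

Lemma L1_conv_prod1 f g : L1 f -> L1 g ->
  (mu \x mu)%E.-integrable [set: R * R] (fun z => (f (z.1 - z.2) * g z.1)%:E).
Proof.
move=> lf lg; have mf := L1_measurable lf; have mg := L1_measurable lg.
apply/integrable12ltyP.
  apply/measurable_EFinP/measurable_funM.
  - apply: (measurableT_comp mf).
    exact: measurable_funB.
  - exact: (measurableT_comp mg measurable_fst).
under eq_integral => x _.
  under eq_integral => y _ do rewrite /= normrM EFinM.
  rewrite ge0_integralZr//; last first.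
    apply/measurable_EFinP; apply: measurableT_comp => //.
    exact: measurableT_comp (measurable_reflect x).
  rewrite (ge0_integral_preserving (measurable_reflect x)
    (lebesgue_measure_reflect x) (f := fun y => `|f y|%:E))//; last first.
    by apply/measurable_EFinP; exact: measurableT_comp.
  over.
rewrite ge0_integralZl//.
- by apply: lte_mul_pinfty; rewrite ?integral_ge0// ?L1_lty// ge0_fin_numE ?L1_lty// integral_ge0.
- by apply/measurable_EFinP; exact: measurableT_comp.
- exact: integral_ge0.
Qed.

Lemma L1_conv_prod2 f g : L1 f -> L1 g ->
  (mu \x mu)%E.-integrable [set: R * R] (fun z => (f (z.1 - z.2) * g z.2)%:E).
Proof.
move=> lf lg; have mf := L1_measurable lf; have mg := L1_measurable lg.
apply/integrable21ltyP.
  apply/measurable_EFinP/measurable_funM.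
  - apply: (measurableT_comp mf).
    exact: measurable_funB.
  - exact: (measurableT_comp mg measurable_snd).
under eq_integral => y _.
  under eq_integral => x _ do rewrite /= normrM EFinM.
  rewrite ge0_integralZr//; last first.
    apply/measurable_EFinP; apply: measurableT_comp => //.
    exact: measurableT_comp (measurable_shift (- y)).
  rewrite (ge0_integral_preserving (measurable_shift (- y))
    (lebesgue_measure_shift (- y)) (f := fun y => `|f y|%:E))//; last first.
    by apply/measurable_EFinP; exact: measurableT_comp.
  over.
rewrite ge0_integralZl//.
- by apply: lte_mul_pinfty; rewrite ?integral_ge0// ?L1_lty// ge0_fin_numE ?L1_lty// integral_ge0.
- by apply/measurable_EFinP; exact: measurableT_comp.
- exact: integral_ge0.
Qed.

Section Rfubini.
Variable F : R * R -> R.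
Hypothesis intF : (mu \x mu)%E.-integrable [set: R * R] (EFin \o F).

Lemma L1_fubini1 : L1 (fun x => \int[mu]_y F (x, y)).
Proof.
have /integrableP[m1 l1] := integrable_fubini_F intF.
have mF : measurable_fun [set: R] (fun x => \int[mu]_y F (x, y)).
  exact: (measurableT_comp _ m1).
apply/integrableP; split; first exact/measurable_EFinP.
apply: le_lt_trans l1; apply: ae_ge0_le_integral => //.
- by apply: measurableT_comp => //; exact/measurable_EFinP.
- exact: measurableT_comp.
have := ae_integrable1 intF; apply: filterS => x Fx _.
rewrite -[leRHS]/(`|\int[mu]_y (F (x, y))%:E|%E).
by rewrite -(EFin_Rint (f := fun y => F (x, y))).
Qed.

Lemma L1_fubini2 : L1 (fun y => \int[mu]_x F (x, y)).
Proof.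
have m1 := measurable_fubini_G intF.
have mF := measurable_int _ intF.
have l1 := (integrable21ltyP mu mu mF).1 intF.
have m2 : measurable_fun [set: R] (fun y => \int[mu]_x F (x, y)).
  exact: (measurableT_comp _ m1).
apply/integrableP; split; first exact/measurable_EFinP.
apply: le_lt_trans l1; apply: ae_ge0_le_integral => //.
- by apply: measurableT_comp => //; exact/measurable_EFinP.
- by move=> y _; exact: integral_ge0.
- apply: (@measurable_fun_fubini_tonelli_G _ _ _ _ _ mu (abse \o (EFin \o F))).
    exact: measurableT_comp.
  by move=> z; exact: abse_ge0.
have H := ae_integrable2 intF.
apply: (filterS _ H) => y Fy _.
rewrite -[leLHS]/(`|(\int[mu]_x F (x, y))%:E|%E).
rewrite (EFin_Rint (f := fun x => F (x, y)))//.
apply: le_abse_integral => //; exact: measurable_int Fy.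
Qed.

Lemma Rfubini :
  \int[mu]_x \int[mu]_y F (x, y) = \int[mu]_y \int[mu]_x F (x, y).
Proof.
have := Fubini intF => /= FF.
rewrite [LHS]/Rintegral [RHS]/Rintegral; congr fine.
have -> : (\int[mu]_x (\int[mu]_y F (x, y))%:E =
           \int[mu]_x \int[mu]_y (F (x, y))%:E)%E.
  apply: integral_ae; have := ae_integrable1 intF; apply: filterS => x Fx.
  by rewrite /Rintegral fineK ?integrable_fin_num.
rewrite FF; apply/esym/integral_ae.
have := ae_integrable2 intF; apply: filterS => x Fx.
by rewrite /Rintegral fineK ?integrable_fin_num.
Qed.
End Rfubini.

End measure_tools.

(** * Square integrable functions and their completeness *)

Section square_integrable.
Context {R : realType}.
Local Notation mu := (@lebesgue_measure R).
Implicit Types f g h : R -> R.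

Definition L2 f := measurable_fun [set: R] f /\ L1 (fun x => f x ^+ 2).

(** The inner product is sealed, so that two of them are compared through their
    arguments and never by unfolding integrals. *)
Fact dot_subproof :
  {d : (R -> R) -> (R -> R) -> R | forall f g, d f g = \int[mu]_x (f x * g x)}.
Proof. by exists (fun f g => \int[mu]_x (f x * g x)). Qed.

Definition dot f g := sval dot_subproof f g.

Lemma dotE f g : dot f g = \int[mu]_x (f x * g x).
Proof. exact: svalP dot_subproof f g. Qed.

Definition nrm f := Num.sqrt (dot f f).

Lemma L2_measurable f : L2 f -> measurable_fun [set: R] f.
Proof. by case. Qed.

Lemma L2_sqr f : L2 f -> L1 (fun x => f x * f x).
Proof. by case. Qed.

Lemma L1_dot f g : L2 f -> L2 g -> L1 (fun x => f x * g x).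
Proof.
move=> [mf lf] [mg lg]; apply: (@L1_le _ _ (fun x => f x ^+ 2 + g x ^+ 2)).
- exact: measurable_funM.
- exact: L1D.
- by move=> x; rewrite normrM -[f x ^+ 2]real_normK ?num_real// -[g x ^+ 2]real_normK ?num_real//;
    have := sqr_ge0 (`|f x| - `|g x|); have := normr_ge0 (f x);
    have := normr_ge0 (g x); nra.
Qed.

Lemma L2_le f g : measurable_fun [set: R] f -> L2 g ->
  (forall x, `|f x| <= `|g x|) -> L2 f.
Proof.
move=> mf [_ lg] fg; split => //; apply: L1_le lg _; first exact: measurable_funX.
by move=> x; rewrite normrX -[leRHS]real_normK ?num_real// lerXn2r// ?nnegrE.
Qed.

Lemma L2_eq f g : f =1 g -> L2 f -> L2 g.
Proof. by move=> /funext ->. Qed.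

Lemma L2_eq_ae f g : measurable_fun [set: R] f -> L2 g ->
  {ae mu, forall x, f x = g x} -> L2 f.
Proof.
move=> mf [mg lg] fg; split => //; apply: (L1_le_ae _ lg).
  exact: measurable_funX.
by apply: filterS fg => x ->; rewrite ger0_norm ?sqr_ge0.
Qed.

Lemma L2_norm f : L2 f -> L2 (fun x => `|f x|).
Proof.
move=> lf; apply: (L2_le _ lf) => [|x]; last by rewrite normr_id.
exact: measurableT_comp (L2_measurable lf).
Qed.

Lemma L2D f g : L2 f -> L2 g -> L2 (fun x => f x + g x).
Proof.
move=> lf lg; have lfg := L1_dot lf lg; case: lf lg => mf lf [mg lg]; split.
  exact: measurable_funD.
apply: (@L1_eq _ (fun x => f x ^+ 2 + 2 * (f x * g x) + g x ^+ 2)).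
  by move=> x; ring.
by apply: L1D => //; apply: L1D => //; exact: L1Z.
Qed.

Lemma L2Z c f : L2 f -> L2 (fun x => c * f x).
Proof.
move=> [mf lf]; split; first exact: measurable_funM.
by apply: (@L1_eq _ (fun x => c ^+ 2 * f x ^+ 2)) (L1Z _ lf) => x; ring.
Qed.

Lemma L2N f : L2 f -> L2 (fun x => - f x).
Proof. by move=> /(L2Z (-1)); apply: L2_eq => x; ring. Qed.

Lemma L2B f g : L2 f -> L2 g -> L2 (fun x => f x - g x).
Proof. by move=> lf /L2N; exact: L2D. Qed.

Lemma L2_0 : L2 (cst 0).
Proof.
split => //; apply: (@L1_eq _ (cst 0)) L1_0.
by move=> x /=; rewrite expr0n.
Qed.

Lemma L2M_bounded M f g : L2 f -> measurable_fun [set: R] g ->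
  (forall x, `|g x| <= M) -> L2 (fun x => f x * g x).
Proof.
move=> lf mg gM; apply: (L2_le _ (L2Z M lf)).
  by apply: measurable_funM => //; exact: L2_measurable.
move=> x; rewrite !normrM mulrC ler_wpM2r//.
by rewrite (le_trans (gM x))// ler_norm.
Qed.

Lemma L2_opp f : L2 f -> L2 (fun x => f (- x)).
Proof.
move=> [mf lf]; split; first exact: measurable_comp_opp.
exact: (L1_opp lf).
Qed.

Lemma L1_bounded_L2 M f : L1 f -> (forall x, `|f x| <= M) -> L2 f.
Proof.
move=> lf fM; have mf := L1_measurable lf; split => //.
exact: L1M_bounded lf mf fM.
Qed.

Lemma dotC f g : dot f g = dot g f.
Proof. by rewrite !dotE; apply: eq_Rintegral => x _; rewrite mulrC. Qed.

Lemma dotDl f g h : L2 f -> L2 g -> L2 h ->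
  dot (fun x => f x + g x) h = dot f h + dot g h.
Proof.
move=> lf lg lh; rewrite !dotE -RintD; [|exact: L1_dot..].
by apply: eq_Rintegral => x _; ring.
Qed.

Lemma dotZl c f h : L2 f -> L2 h -> dot (fun x => c * f x) h = c * dot f h.
Proof.
move=> lf lh; rewrite !dotE -RintZ; last exact: L1_dot.
by apply: eq_Rintegral => x _; ring.
Qed.

Lemma dotBl f g h : L2 f -> L2 g -> L2 h ->
  dot (fun x => f x - g x) h = dot f h - dot g h.
Proof.
move=> lf lg lh; rewrite !dotE -RintB; [|exact: L1_dot..].
by apply: eq_Rintegral => x _; ring.
Qed.

Lemma dotBr f g h : L2 f -> L2 g -> L2 h ->
  dot h (fun x => f x - g x) = dot h f - dot h g.
Proof. by move=> lf lg lh; rewrite dotC dotBl// !(dotC _ h). Qed.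

Lemma dot_ae f f' g g' : {ae mu, forall x, f x = f' x} ->
  {ae mu, forall x, g x = g' x} -> dot f g = dot f' g'.
Proof.
move=> ff' gg'; rewrite !dotE; apply: Rintegral_ae.
by apply: filterS2 ff' gg' => x -> ->.
Qed.

Lemma dot0r f : dot f (fun=> 0) = 0.
Proof.
rewrite dotE; transitivity (\int[mu]_x (cst 0 x : R)).
  by apply: eq_Rintegral => x _; rewrite mulr0.
by rewrite Rintegral_cst// mul0r.
Qed.

Lemma dot_ge0 f : 0 <= dot f f.
Proof. by rewrite dotE; apply: Rintegral_ge0 => x _; rewrite -expr2 sqr_ge0. Qed.

Lemma dot_opp f g : measurable_fun [set: R] f -> measurable_fun [set: R] g ->
  dot (fun x => f (- x)) (fun x => g (- x)) = dot f g.
Proof.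
move=> mf mg; rewrite !dotE; apply: (Rintegral_opp (f := fun x => f x * g x)).
exact: measurable_funM.
Qed.

Lemma nrm_ge0 f : 0 <= nrm f. Proof. exact: sqrtr_ge0. Qed.

Lemma sqr_nrm f : nrm f ^+ 2 = dot f f.
Proof. by rewrite sqr_sqrtr// dot_ge0. Qed.

Lemma nrm_le f c : 0 <= c -> (nrm f <= c) = (dot f f <= c ^+ 2).
Proof.
by move=> c0; rewrite -sqr_nrm ler_pXn2r// nnegrE// nrm_ge0.
Qed.

Lemma le_nrm f g : L2 f -> L2 g -> (forall x, `|f x| <= `|g x|) -> nrm f <= nrm g.
Proof.
move=> lf lg fg; rewrite nrm_le ?nrm_ge0// sqr_nrm !dotE.
apply: le_Rint => [||x]; [exact: L2_sqr|exact: L2_sqr|].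
rewrite -!expr2 -[leLHS]real_normK ?num_real// -[leRHS]real_normK ?num_real//.
by rewrite ler_pXn2r// ?nnegrE.
Qed.

Lemma nrm_ae f g : {ae mu, forall x, f x = g x} -> nrm f = nrm g.
Proof. by move=> fg; rewrite /nrm (dot_ae fg fg). Qed.

Lemma nrm_opp f : measurable_fun [set: R] f -> nrm (fun x => f (- x)) = nrm f.
Proof. by move=> mf; rewrite /nrm dot_opp. Qed.

Lemma nrmN f : nrm (fun x => - f x) = nrm f.
Proof.
by congr Num.sqrt; rewrite !dotE; apply: eq_Rintegral => x _; rewrite mulrNN.
Qed.

Lemma nrmZ c f : L2 f -> nrm (fun x => c * f x) = `|c| * nrm f.
Proof.
move=> lf; rewrite /nrm dotZl//; last exact: L2Z.
by rewrite dotC dotZl// mulrA -expr2 sqrtrM ?sqr_ge0// sqrtr_sqr.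
Qed.

Lemma nrmC f g : nrm (fun x => f x - g x) = nrm (fun x => g x - f x).
Proof. by rewrite -nrmN; congr nrm; apply/funext => x; rewrite opprB. Qed.

Lemma dot_eq0 f : L2 f -> dot f f = 0 -> {ae mu, forall x, f x = 0}.
Proof.
move=> [mf lf]; rewrite dotE => f0.
have : (\int[mu]_x `|(f x * f x)%:E| = 0)%E.
  transitivity (\int[mu]_x (f x * f x)%:E)%E.
    by apply: eq_integral => x _; rewrite gee0_abs// lee_fin -expr2 sqr_ge0.
  by rewrite -(EFin_Rint lf) [X in X%:E]f0.
have mff : measurable_fun [set: R] (fun x => (f x * f x)%:E).
  by apply/measurable_EFinP; exact: measurable_funM.
move/(ae_eq_integral_abs mu measurableT mff); apply: filterS => x /(_ Logic.I)[].
by move=> /eqP; rewrite mulf_eq0 orbb => /eqP.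
Qed.

Lemma nrm_eq0 f : L2 f -> nrm f = 0 -> {ae mu, forall x, f x = 0}.
Proof. by move=> lf f0; apply: dot_eq0 => //; rewrite -sqr_nrm f0 expr0n. Qed.

Lemma nrm_sub_eq0 f g : L2 f -> L2 g -> nrm (fun x => f x - g x) = 0 ->
  {ae mu, forall x, f x = g x}.
Proof.
move=> lf lg /(nrm_eq0 (L2B lf lg)); apply: filterS => x /eqP.
by rewrite subr_eq0 => /eqP.
Qed.

(** Cauchy-Schwarz, from nonnegativity of the square of [|g|^2 f - (f,g) g]. *)
Lemma cauchy_schwarz f g : L2 f -> L2 g -> `|dot f g| <= nrm f * nrm g.
Proof.
move=> lf lg; set A := dot f f; set B := dot g g; set C := dot f g.
have key t s : 0 <= t ^+ 2 * A - 2 * t * s * C + s ^+ 2 * B.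
  have := dot_ge0 (fun x => t * f x - s * g x).
  have tf := L2Z t lf; have sg := L2Z s lg; have tsg := L2B tf sg.
  rewrite dotBl// !dotBr// !dotZl//.
  rewrite !(dotC _ (fun x => _ * _)) !dotZl// (dotC g f) -/A -/B -/C.
  by congr (0 <= _); ring.
rewrite -(ler_pXn2r (n := 2))// ?nnegrE ?mulr_ge0 ?nrm_ge0//.
rewrite exprMn !sqr_nrm -/A -/B real_normK ?num_real//.
have [B0|B0] := eqVneq B 0.
  have := dot_ae (aeW mu (fun x => erefl (f x))) (dot_eq0 lg B0).
  by rewrite -/C => ->; rewrite dot0r expr0n B0 mulr0.
have Bp : 0 < B by rewrite lt_neqAle eq_sym B0 dot_ge0.
have := key B C; rewrite (_ : _ + _ = B * (A * B - C ^+ 2)); last by ring.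
by rewrite pmulr_rge0// subr_ge0.
Qed.

Lemma nrmD f g : L2 f -> L2 g -> nrm (fun x => f x + g x) <= nrm f + nrm g.
Proof.
move=> lf lg; rewrite nrm_le ?addr_ge0 ?nrm_ge0//.
rewrite dotDl//; last exact: L2D.
rewrite !(dotC _ (fun x => _ + _)) !dotDl// (dotC g f) -!sqr_nrm.
have := cauchy_schwarz lf lg; have := ler_norm (dot f g); lra.
Qed.

Lemma nrm_triangle f g h : L2 f -> L2 g -> L2 h ->
  nrm (fun x => f x - h x) <= nrm (fun x => f x - g x) + nrm (fun x => g x - h x).
Proof.
move=> lf lg lh; have := nrmD (L2B lf lg) (L2B lg lh).
by congr (nrm _ <= _); apply/funext => x; ring.
Qed.

Lemma dot_cvg (f_ : nat -> R -> R) f (g_ : nat -> R -> R) g :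
  (forall n, L2 (f_ n)) -> L2 f -> (forall n, L2 (g_ n)) -> L2 g ->
  nrm (fun x => f_ n x - f x) @[n --> \oo] --> 0 ->
  nrm (fun x => g_ n x - g x) @[n --> \oo] --> 0 ->
  dot (f_ n) (g_ n) @[n --> \oo] --> dot f g.
Proof.
move=> lf_ lf lg_ lg f_f g_g.
have H n : `|dot f g - dot (f_ n) (g_ n)| <=
  nrm f * nrm (fun x => g_ n x - g x) +
  nrm (fun x => f_ n x - f x) * (nrm (fun x => g_ n x - g x) + nrm g).
  have lfn := L2B (lf_ n) lf; have lgn := L2B (lg_ n) lg.
  have -> : dot f g - dot (f_ n) (g_ n) = - (dot f (fun x => g_ n x - g x) +
      (dot (fun x => f_ n x - f x) (fun x => g_ n x - g x) +
       dot (fun x => f_ n x - f x) g)).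
    by rewrite !dotBl// !dotBr//; ring.
  rewrite normrN (le_trans (ler_normD _ _))// lerD ?cauchy_schwarz//.
  by rewrite mulrDr (le_trans (ler_normD _ _))// lerD ?cauchy_schwarz.
apply/cvgrPdist_le => e e0.
have : (nrm f * nrm (fun x => g_ n x - g x) +
  nrm (fun x => f_ n x - f x) * (nrm (fun x => g_ n x - g x) + nrm g))
  @[n --> \oo] --> nrm f * 0 + 0 * (0 + nrm g).
  apply: cvgD; first by apply: cvgM => //; exact: cvg_cst.
  by apply: cvgM => //; apply: cvgD => //; exact: cvg_cst.
rewrite mulr0 mul0r addr0 => /cvgr_le /(_ _ e0).
by apply: filterS => n; exact: le_trans.
Qed.

Lemma L2_unique_limit (f_ : nat -> R -> R) f g :
  (forall n, L2 (f_ n)) -> L2 f -> L2 g ->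
  nrm (fun x => f_ n x - f x) @[n --> \oo] --> 0 ->
  nrm (fun x => f_ n x - g x) @[n --> \oo] --> 0 ->
  {ae mu, forall x, f x = g x}.
Proof.
move=> lf_ lf lg f_f f_g; apply: nrm_sub_eq0 => //.
apply/eqP; rewrite eq_le nrm_ge0 andbT.
have H : nrm (fun x => f_ n x - f x) + nrm (fun x => f_ n x - g x)
  @[n --> \oo] --> (0 + 0 : R) by exact: cvgD.
rewrite addr0 in H; apply: (cvgr_to_ge H).
by apply: nearW => n /=; rewrite (nrmC (f_ n) f) nrm_triangle.
Qed.

(** The sum of [4^n |v_(n+1) - v_n|^2] has a finite integral, so it is finite
    almost everywhere; there the increments are [O(2^-n)] and [v] converges. *)
Lemma L2_complete_fast (v : nat -> R -> R) : (forall n, L2 (v n)) ->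
  (forall n, dot (fun x => v n.+1 x - v n x) (fun x => v n.+1 x - v n x)
    <= (8^-1) ^+ n) ->
  exists2 f : R -> R, measurable_fun [set: R] f &
    {ae mu, forall x, v ^~ x @ \oo --> f x}.
Proof.
move=> lv vn.
pose d n x := v n.+1 x - v n x.
have ld n : L2 (d n) by exact: L2B.
pose w n x : \bar R := (4 ^+ n * (d n x * d n x))%:E.
have lw n : L1 (fun x => 4 ^+ n * (d n x * d n x)) by exact/L1Z/L2_sqr.
have mw n : measurable_fun [set: R] (w n) by exact: measurable_int (lw n).
have w0 n x : (0 <= w n x)%E.
  by rewrite lee_fin mulr_ge0 ?exprn_ge0// -expr2 sqr_ge0.
have sumw : (\int[mu]_x (\sum_(n <oo) w n x) < +oo)%E.
  rewrite integral_nneseries//.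
  apply: (@le_lt_trans _ _ (\sum_(n <oo) (2^-1 ^+ n)%:E)%E).
    apply: lee_nneseries => [n _ _|n _]; first exact: integral_ge0.
    rewrite -(EFin_Rint (lw n)) lee_fin RintZ; last exact: L2_sqr.
    have -> : (2^-1 : R) ^+ n = 4 ^+ n * 8^-1 ^+ n.
      by rewrite -exprMn; congr (_ ^+ n); field.
    by rewrite ler_wpM2l ?exprn_ge0//; have := vn n; rewrite dotE.
  have -> : (\sum_(n <oo) (2^-1 ^+ n)%:E = (2 : R)%:E)%E.
    have E n : \sum_(0 <= k < n) (2^-1 : R) ^+ k = series (geometric 1 2^-1) n.
      by rewrite /series /geometric/=; apply: eq_bigr => i _; rewrite mul1r.
    apply/cvg_lim => //; under eq_fun do rewrite sumEFin E.
    apply: cvg_EFin; first exact: nearW.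
    have {2}-> : 2 = 1 * (1 - 2^-1)^-1 :> R by field.
    by apply: cvg_geometric_series; rewrite ger0_norm//; lra.
  exact: ltey.
have msum : measurable_fun [set: R] (fun x => (\sum_(n <oo) w n x)%E).
  exact: ge0_emeasurable_sum.
pose f x := fine (limn_esup (fun n => (v n x)%:E)).
have mf : measurable_fun [set: R] f.
  apply: measurableT_comp => //.
  apply: measurable_fun_limn_esup => n.
  by apply/measurable_EFinP; exact: L2_measurable.
exists f => //.
have isum : mu.-integrable [set: R] (fun x => (\sum_(n <oo) w n x)%E).
  apply/integrableP; split => //; under eq_integral => x _.
    rewrite gee0_abs; last exact: nneseries_ge0.
    over.
  by [].
have := integrable_ae measurableT isum; apply: filterS => x /(_ Logic.I) wfin.
have [M M0 dM] : exists2 M, 0 <= M & forall n, `|d n x| <= M * 2^-1 ^+ n.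
  pose S := fine (\sum_(n <oo) w n x)%E.
  have S0 : 0 <= S by apply: fine_ge0; exact: nneseries_ge0.
  exists (Num.sqrt S) => [|n]; first exact: sqrtr_ge0.
  have wS : 4 ^+ n * (d n x * d n x) <= S.
    rewrite -lee_fin fineK//.
    apply: (le_trans _ (nneseries_lim_ge n.+1 _)) => //.
    rewrite big_nat_recr//= leeDr//.
    by apply: sume_ge0 => i _.
  rewrite -(ler_pXn2r (n := 2))// ?nnegrE ?mulr_ge0 ?sqrtr_ge0 ?exprn_ge0//.
  rewrite exprMn sqr_sqrtr// real_normK ?num_real// -exprM mulnC exprM.
  have -> : (2^-1 : R) ^+ 2 = 4^-1 by field.
  rewrite exprVn ler_pdivlMr ?exprn_gt0//.
  by rewrite mulrC expr2.
have cvgv : cvgn (v ^~ x).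
  have -> : v ^~ x = (fun n => v 0%N x + series (d ^~ x) n).
    apply/funext => n; rewrite /series/= /d.
    by rewrite telescope_sumr// addrC subrK.
  apply: is_cvgD; first exact: is_cvg_cst.
  apply: normed_cvg; apply: (@series_le_cvg _ _ (fun n => M * 2^-1 ^+ n)).
  - by move=> n /=.
  - by move=> n; rewrite mulr_ge0// exprn_ge0.
  - exact: dM.
  - by apply: is_cvg_geometric_series; rewrite ger0_norm//; lra.
have /cvg_limn_einf_sup[_ E] : (fun n => (v n x)%:E) @ \oo --> (limn (v ^~ x))%:E.
  by apply: cvg_EFin => //; exact: nearW.
by rewrite /f E.
Qed.

(** A fast subsequence converges almost everywhere; Fatou's lemma then bounds
    the distance of every late term to the limit. *)
Theorem L2_complete (u : nat -> R -> R) : (forall n, L2 (u n)) ->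
  (forall e, 0 < e -> exists N, forall n m, (N <= n)%N -> (N <= m)%N ->
     nrm (fun x => u n x - u m x) <= e) ->
  exists2 f, L2 f & nrm (fun x => u n x - f x) @[n --> \oo] --> 0.
Proof.
move=> lu cu.
have /choice[N HN] k : exists N, forall n m, (N <= n)%N -> (N <= m)%N ->
    dot (fun x => u n x - u m x) (fun x => u n x - u m x) <= 8^-1 ^+ k.
  have [] := cu (Num.sqrt (8^-1 ^+ k)); first by rewrite sqrtr_gt0 exprn_gt0.
  move=> N HN; exists N => n m Nn Nm; have := HN n m Nn Nm.
  by rewrite nrm_le ?sqrtr_ge0// sqr_sqrtr// exprn_ge0.
(* strictly increasing, and beyond every rank [N j] with [j <= k] *)
pose s k := (\sum_(j < k.+1) N j + k)%N.
have sS k : (s k.+1 = s k + N k.+1 + 1)%N.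
  by rewrite /s [in LHS]big_ord_recr/=; lia.
have Ns k : (N k <= s k)%N.
  by rewrite /s big_ord_recr/= -addnA addnC -addnA leq_addr.
have ks k : (k <= s k)%N by rewrite /s leq_addl.
have [k|f mf uf] := L2_complete_fast (fun k => lu (s k)).
  by apply: HN; [rewrite sS -addnA (leq_trans (Ns k))// leq_addr|exact: Ns].
have key n e : 0 < e -> (forall m, (n <= m)%N -> nrm (fun x => u n x - u m x) <= e) ->
    L2 (fun x => u n x - f x) /\ nrm (fun x => u n x - f x) <= e.
  move=> e0 un; have lf : measurable_fun [set: R] (fun x => u n x - f x).
    by apply: measurable_funB => //; exact: L2_measurable.
  have [||||| l1 l2] := @L1_fatou R (fun k x => (u n x - u (s (k + n)%N) x) ^+ 2)
    (fun x => (u n x - f x) ^+ 2) (e ^+ 2).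
  - by move=> k; apply: (L2B _ _).2.
  - by move=> k x; exact: sqr_ge0.
  - exact: measurable_funX.
  - apply: filterS uf => x ufx.
    apply: cvgM; apply: cvgB; try exact: cvg_cst.
      by rewrite (cvg_shiftn _ (fun k => u (s k) x)).
    by rewrite (cvg_shiftn _ (fun k => u (s k) x)).
  - move=> k; have : (n <= s (k + n))%N by rewrite (leq_trans _ (ks _))// leq_addl.
    by move=> /un; rewrite (nrm_le _ (ltW e0)) dotE; exact.
  by split; [split|rewrite (nrm_le _ (ltW e0)) dotE; exact: l2].
have [N0 HN0] := cu 1 ltr01.
have lf : L2 f.
  have [||l _] := key N0 1 => //; first by move=> m; exact: HN0.
  by apply: L2_eq (L2B (lu N0) l) => x /=; ring.
exists f => //; apply/cvgr0Pnorm_le => e e0; have [M HM] := cu e e0.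
exists M => // n /= Mn; rewrite ger0_norm ?nrm_ge0//.
have [||_] := key n e => // m nm; apply: HM => //; exact: leq_trans nm.
Qed.
End square_integrable.

(** * Smooth functions *)

Section smooth_functions.
Context {R : realType}.
Implicit Types f g : R -> R.

(** Carrying the derivative explicitly makes closure under sums, products and
    affine substitutions a plain induction, unlike for [derive1n]. *)
Fixpoint ndiff n f : Prop := if n is n'.+1
  then exists2 g : R -> R, forall x, is_derive x (1 : R) f (g x) & ndiff n' g
  else True.

Definition smooth f := forall n, ndiff n f.

Lemma is_derive_fun f g : (forall x, is_derive x (1 : R) f (g x)) ->
  f^`()%classic = g.
Proof. by move=> fg; apply/funext => x; rewrite derive1E derive_val. Qed.

Lemma is_deriveM_fun f g (f' g' x : R) : is_derive x (1 : R) f f' ->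
  is_derive x (1 : R) g g' ->
  is_derive x (1 : R) (fun y => f y * g y) (f' * g x + f x * g').
Proof.
move=> df dg; have H := is_deriveM df dg.
apply: (is_derive_eq (f := fun y => f y * g y) H).
by rewrite /GRing.scale/=; ring.
Qed.

Lemma is_derive_comp_fun f g (f' g' x : R) : is_derive (g x) (1 : R) f f' ->
  is_derive x (1 : R) g g' -> is_derive x (1 : R) (fun y => f (g y)) (f' * g').
Proof. by move=> df dg; exact: is_derive1_comp. Qed.

Lemma is_derive_affine c d x : is_derive x (1 : R) (fun y => c * y + d) c.
Proof.
apply: is_derive_eq (is_deriveD (is_deriveZ c (is_derive_id x 1)) (is_derive_cst d x 1)) _.
by rewrite addr0 /GRing.scale/= mulr1.
Qed.

Lemma is_derive_near f g x d : (\forall y \near x, f y = g y) ->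
  is_derive x (1 : R) f d -> is_derive x (1 : R) g d.
Proof. by move=> fg; apply: near_eq_is_derive; rewrite ?oner_neq0. Qed.

Lemma ndiffS n f : ndiff n.+1 f -> ndiff n f.
Proof.
elim: n f => // n IH f [g fg /IH]; by exists g.
Qed.

Lemma ndiffD n f g : ndiff n f -> ndiff n g -> ndiff n (fun x => f x + g x).
Proof.
elim: n f g => // n IH f g [f' df nf] [g' dg ng].
by exists (fun x => f' x + g' x); [move=> x; exact: is_deriveD|exact: IH].
Qed.

Lemma ndiffM n f g : ndiff n f -> ndiff n g -> ndiff n (fun x => f x * g x).
Proof.
elim: n f g => // n IH f g nf ng.
have nf0 := ndiffS nf; have ng0 := ndiffS ng.
case: nf ng => [f' df nf] [g' dg ng].
exists (fun x => f' x * g x + f x * g' x); first by move=> x; exact: is_deriveM_fun.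
by apply: ndiffD; exact: IH.
Qed.

Lemma ndiff_cst n c : ndiff n (fun=> c).
Proof.
elim: n c => // n IH c; exists (fun=> 0); last exact: IH.
by move=> x; exact: is_derive_cst.
Qed.

Lemma ndiff_affine n f c d : ndiff n f -> ndiff n (fun x => f (c * x + d)).
Proof.
elim: n f => // n IH f [f' df nf].
exists (fun x => f' (c * x + d) * c).
  by move=> x; apply: is_derive_comp_fun => //; exact: is_derive_affine.
by apply: ndiffM; [exact: IH|exact: ndiff_cst].
Qed.

Lemma smoothP f : smooth f <->
  forall n x, derivable (derive1n n f) x (1 : R).
Proof.
split=> [sf n x|df n].
  suff [g dg] : exists g : R -> R, forall x, is_derive x (1 : R) (derive1n n f) (g x).
    exact: ex_derive.
  elim: n f {x sf} (sf n.+1) => [f [g dg _]|n IH f [g dg ng]]; first by exists g.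
  by have [h dh] := IH g ng; exists h; rewrite derive1Sn (is_derive_fun dg).
elim: n f df => // n IH f df; exists (f^`()%classic).
  by move=> x; rewrite derive1E; apply: derivableP; exact: (df 0%N).
by apply: IH => m x; rewrite -derive1Sn; exact: df.
Qed.

(** [expm 0] is the classical smooth function which is flat at the origin; the
    derivative of [expm n] is a combination of [expm n.+1] and [expm n.+2]. *)
Definition expm n (x : R) : R := if 0 < x then x^-1 ^+ n * expR (- x^-1) else 0.

(** From [t / n <= exp (t / n)], raised to the power [n]. *)
Lemma exp_ge_pow n (t : R) : 0 <= t -> t ^+ n <= n%:R ^+ n * expR t.
Proof.
case: n => [|n] t0; first by rewrite !expr0 mul1r -[leLHS]expR0 ler_expR.
have n0 : (0 : R) < n.+1%:R by rewrite ltr0n.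
have -> : expR t = expR (t / n.+1%:R) ^+ n.+1.
  by rewrite -expRM_natl mulrCA divff ?mulr1// gt_eqF.
rewrite -exprMn ler_pXn2r// ?nnegrE ?mulr_ge0 ?expR_ge0//.
rewrite -ler_pdivrMl// mulrC.
by rewrite (le_trans _ (expR_ge1Dx _))// lerDr.
Qed.

(** Makes the difference quotients of [expm n] at the origin, which are values
    of [expm n.+1], tend to zero. *)
Lemma expm_le n x : `|expm n x| <= n.+1%:R ^+ n.+1 * `|x|.
Proof.
rewrite /expm; case: ifPn => [x0|_]; last by rewrite normr0 mulr_ge0 ?exprn_ge0.
have xV : 0 < x^-1 by rewrite invr_gt0.
rewrite (gtr0_norm x0) ger0_norm; last first.
  by rewrite mulr_ge0 ?exprn_ge0 ?expR_ge0// ltW.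
have := exp_ge_pow n.+1 (ltW xV).
rewrite expRN ler_pdivrMr ?expR_gt0// => H.
rewrite mulrAC; apply: le_trans (ler_wpM2r (ltW x0) H).
by rewrite exprS mulrC mulrA divff ?mul1r// gt_eqF.
Qed.

Lemma is_derive_expm n x :
  is_derive x (1 : R) (expm n) (- n%:R * expm n.+1 x + expm n.+2 x).
Proof.
have [x0|x0|->] := ltgtP x 0.
- have -> : - n%:R * expm n.+1 x + expm n.+2 x = 0.
    by rewrite /expm ltNge (ltW x0)/= mulr0 addr0.
  apply: is_derive_near (is_derive_cst 0 x 1).
  have := lt_nbhsl x0; apply: filterS => y y0.
  by rewrite /expm ltNge (ltW y0).
- apply: (@is_derive_near (fun y => y^-1 ^+ n * expR (- y^-1))).
    have := lt_nbhsr x0; apply: filterS => y y0.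
    by rewrite /expm y0.
  have dV : is_derive x (1 : R) (fun y : R => y^-1) (- x ^- 2).
    have H := @is_deriveV R id x 1 1 (lt0r_neq0 x0) (is_derive_id x (1 : R)).
    apply: (is_derive_eq (f := fun y : R => y^-1) H).
    by rewrite /GRing.scale/= mulr1.
  have dX : is_derive x (1 : R) (fun y : R => y^-1 ^+ n) (n%:R * x^-1 ^+ n.-1 * - x ^- 2).
    have H := is_deriveX n dV.
    rewrite (_ : (fun y : R => y^-1 ^+ n) = (fun y : R => y^-1) ^+ n); last first.
      by apply/funext => y; rewrite exprfctE.
    apply: (is_derive_eq H).
    by rewrite /GRing.scale/=.
  have dE : is_derive x (1 : R) (fun y : R => expR (- y^-1)) (expR (- x^-1) * x ^- 2).
    have dN := is_deriveN dV; rewrite opprK in dN.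
    by apply: (is_derive_comp_fun (f := expR) (g := fun y => - y^-1)).
  apply: is_derive_eq (is_deriveM_fun dX dE) _.
  rewrite /expm x0; case: n {dX} => [|n]; rewrite /= ?mul0r ?oppr0 ?mul0r ?add0r.
    rewrite expr0; field; exact: lt0r_neq0.
  by rewrite !exprS; field; exact: lt0r_neq0.
have -> : - n%:R * expm n.+1 0 + expm n.+2 0 = 0.
  by rewrite /expm ltxx mulr0 addr0.
have e0 : expm n 0 = 0 by rewrite /expm ltxx.
have H : h^-1 *: (expm n (h *: (1 : R) + 0) - expm n 0) @[h --> 0^'] --> (0 : R).
  apply/cvgr0Pnorm_le => e e_gt0.
  pose C : R := n.+2%:R ^+ n.+2.
  have C0 : 0 < C by rewrite exprn_gt0// ltr0n.
  have : \forall h \near (0 : R)^', `|h| <= e / C.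
    apply: nbhs_dnbhs; apply: (@nbhs0_le _ (R : normedModType R)).
    exact: divr_gt0.
  apply: filterS => h he.
  rewrite e0 subr0 addr0 /GRing.scale/= mulr1.
  have -> : h^-1 * expm n h = expm n.+1 h.
    by rewrite /expm; case: ifP => _; rewrite ?mulr0// exprS mulrA.
  rewrite (le_trans (expm_le _ _))// -/C.
  by rewrite mulrC -ler_pdivlMr.
apply: DeriveDef; first by apply/cvg_ex; exists 0.
by apply/cvg_lim => //; exact: Rhausdorff.
Qed.

Lemma smooth_expm n : smooth (expm n).
Proof.
move=> m; elim: m n => // m IH n.
exists (fun x => - n%:R * expm n.+1 x + expm n.+2 x).
  by move=> x; exact: is_derive_expm.
apply: ndiffD => //; apply: ndiffM => //; exact: ndiff_cst.
Qed.
End smooth_functions.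

(** * Test functions and the fundamental lemma of the calculus of variations *)

Section test_functions.
Context {R : realType}.
Local Notation mu := (@lebesgue_measure R).
Implicit Types f g phi : R -> R.

Definition vanishes_beyond M f := forall x, M < `|x| -> f x = 0.

Lemma vanishes_beyond_supp M f : vanishes_beyond M f ->
  closure [set x | f x != 0] `<=` `[- M, M]%classic.
Proof.
move=> f0; rewrite (closure_id `[- M, M]%classic).1; last exact: itv_closed.
apply: closure_subset => x /= fx0.
rewrite in_itv/= -ler_norml leNgt; apply/negP => /f0 /eqP.
exact/negP.
Qed.

Lemma test_function_intro M f : smooth f -> vanishes_beyond M f ->
  test_function f.
Proof.
move=> /smoothP sf f0; split => //.
apply: (subclosed_compact _ (@segment_compact R (- M) M)).
  exact: closed_closure.
exact: vanishes_beyond_supp.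
Qed.

Lemma test_smooth f : test_function f -> smooth f.
Proof. by move=> [df _]; apply/smoothP. Qed.

Lemma test_vanishes f : test_function f ->
  exists2 M, 0 <= M & vanishes_beyond M f.
Proof.
move=> [_ cf].
have [M [_ HM]] := compact_bounded cf.
exists (Num.max (M + 1) 0); first by rewrite le_max lexx orbT.
move=> x; rewrite gt_max => /andP[Mx _]; apply: contrapT => /eqP fx0.
have cx : closure [set y | f y != 0] x by exact: subset_closure.
have := HM (M + 1); rewrite ltrDl ltr01 => /(_ isT x cx) /=.
by rewrite leNgt Mx.
Qed.

Lemma smooth_derive f : smooth f ->
  smooth (f^`()%classic) /\ forall x, is_derive x (1 : R) f (f^`()%classic x).
Proof.
move=> sf; split.
  move=> n; have [g fg ng] := sf n.+1.
  by rewrite (is_derive_fun fg).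
by move=> x; have [g fg _] := sf 1%N; rewrite (is_derive_fun fg).
Qed.

Lemma is_derive_continuous f g : (forall x, is_derive x (1 : R) f (g x)) ->
  continuous f.
Proof.
move=> fg x; apply/differentiable_continuous/derivable1_diffP.
exact: ex_derive.
Qed.

Lemma smooth_continuous f : smooth f -> continuous f.
Proof. by move=> /smooth_derive[_]; exact: is_derive_continuous. Qed.

Lemma vanishes_derive M f : vanishes_beyond M f ->
  vanishes_beyond M (f^`()%classic).
Proof.
move=> f0 x Mx; rewrite derive1E.
have : \forall y \near x, cst 0 y = f y.
  have : \forall y \near x, M < `|y|.
    have : continuous (fun y : R => `|y|) by move=> ?; exact: norm_continuous.
    by move=> /(_ x) /cvgr_gt; exact.
  by apply: filterS => y /f0 ->.
by move=> /is_derive_near /(_ (is_derive_cst 0 x 1)) [].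
Qed.

Lemma test_derive f : test_function f -> test_function (f^`()%classic).
Proof.
move=> tf; have [M _ f0] := test_vanishes tf.
apply: (@test_function_intro M); last exact: vanishes_derive.
by have [] := smooth_derive (test_smooth tf).
Qed.

Lemma test_derive1n n f : test_function f -> test_function (derive1n n f).
Proof. by move=> tf; elim: n => // n IH; rewrite derive1nS; exact: test_derive. Qed.

Lemma test_shift t f : test_function f -> test_function (fun x => f (x - t)).
Proof.
move=> tf; have [M _ f0] := test_vanishes tf.
apply: (@test_function_intro (M + `|t|)).
  move=> n; have := ndiff_affine 1 (- t) (test_smooth tf n).
  by congr (ndiff _ _); apply/funext => x; rewrite mul1r.
move=> x Mx; apply: f0; rewrite -ltrBrDr in Mx.
by rewrite (lt_le_trans Mx)// lerB_dist.
Qed.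

Lemma test_continuous f : test_function f -> continuous f.
Proof. by move=> /test_smooth; exact: smooth_continuous. Qed.

Lemma test_measurable f : test_function f -> measurable_fun [set: R] f.
Proof. by move=> /test_continuous; exact: continuous_measurable_fun. Qed.

Lemma test_bounded f : test_function f -> exists C, forall x, `|f x| <= C.
Proof.
move=> tf; have [M M0 f0] := test_vanishes tf.
have cf : {within `[- M, M], continuous (fun x => `|f x|)}.
  apply: continuous_subspaceT => x; apply: continuous_comp.
    exact: test_continuous.
  exact: norm_continuous.
have [|c _ fc] := EVT_max _ cf; first lra.
exists `|f c| => x; have [xM|/f0 ->] := leP `|x| M.
  by apply: fc; rewrite in_itv/= -ler_norml.
by rewrite normr0.
Qed.

Lemma L1_indic_itv (a b : R) b0 b1 :
  L1 (\1_[set` Interval (BSide b0 a) (BSide b1 b)] : R -> R).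
Proof. exact: integrable_indic_itv. Qed.

(** Bounded functions of bounded support are dominated by a multiple of an
    indicator; all integrability statements on test functions come from this. *)
Lemma vanishes_le_indic M C f : (forall x, `|f x| <= C) -> vanishes_beyond M f ->
  forall x, `|f x| <= C * \1_`[- M, M]%classic x.
Proof.
move=> fC f0 x; have [xM|/f0 ->] := leP `|x| M.
  by rewrite indicE mem_set ?mulr1//= in_itv/= -ler_norml.
rewrite normr0 mulr_ge0//; apply: le_trans (fC x); exact: normr_ge0.
Qed.

Lemma L1_bounded_supp M C f : measurable_fun [set: R] f ->
  (forall x, `|f x| <= C) -> vanishes_beyond M f -> L1 f.
Proof.
move=> mf fC f0; apply: (L1_le mf (L1Z C (L1_indic_itv (- M) M true false))).
exact: vanishes_le_indic.
Qed.

Lemma test_L1 f : test_function f -> L1 f.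
Proof.
move=> tf; have [M _ f0] := test_vanishes tf; have [C fC] := test_bounded tf.
exact: L1_bounded_supp (test_measurable tf) fC f0.
Qed.

Lemma test_L2 f : test_function f -> L2 f.
Proof.
move=> tf; have [C fC] := test_bounded tf.
exact: L1_bounded_L2 (test_L1 tf) fC.
Qed.

Lemma loc_integrable_itv w (a b : R) : locally_integrable [set: R] w ->
  mu.-integrable `[a, b] (EFin \o w).
Proof.
move=> [mw _ iw]; apply/integrableP; split.
  by apply: measurable_funTS; exact/measurable_EFinP.
by apply: iw => //; exact: segment_compact.
Qed.

Lemma L1M_loc_integrable w M C f : locally_integrable [set: R] w ->
  measurable_fun [set: R] f -> (forall x, `|f x| <= C) -> vanishes_beyond M f ->
  L1 (fun x => w x * f x).
Proof.
move=> lw mf fC f0; have [mw _ _] := lw.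
have li : L1 (w \_ `[- M, M]%classic).
  have := loc_integrable_itv (- M) M lw.
  by move=> /integrable_mkcond; rewrite /L1 -restrict_EFin; exact.
apply: (@L1_le _ _ (fun x => C * `|(w \_ `[- M, M]%classic) x|)).
- exact: measurable_funM.
- exact/L1Z/L1_norm.
- move=> x; rewrite normrM mulrC.
  apply: (le_trans (ler_wpM2r _ (vanishes_le_indic fC f0 x))) => //.
  rewrite -mulrA ler_wpM2l//; first exact: le_trans (fC 0).
  by rewrite patchE indicE; case: ifPn => _; rewrite ?mul1r// mul0r normr0.
Qed.

Lemma loc_integrable_test w f : locally_integrable [set: R] w ->
  test_function f -> L1 (fun x => w x * f x).
Proof.
move=> lw tf; have [M _ f0] := test_vanishes tf; have [C fC] := test_bounded tf.
exact: L1M_loc_integrable lw (test_measurable tf) fC f0.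
Qed.

Lemma L2_loc_integrable f : L2 f -> locally_integrable [set: R] f.
Proof.
move=> [mf lf]; split => //; first exact: openT.
move=> K _ cK; have mK : measurable (K : set (measurableTypeR R)).
  exact: compact_measurable.
have lK : mu.-integrable K (EFin \o (fun x => 1 + f x ^+ 2)).
  have i1 : mu.-integrable K (EFin \o cst (1 : R)).
    apply: measurable_bounded_integrable => //.
      exact: compact_finite_measure.
    exact: bounded_cst.
  have i2 : mu.-integrable K (EFin \o (fun x => f x ^+ 2)).
    exact: integrableS lf.
  by have := integrableD mK i1 i2.
case/integrableP: lK => mK' lK; apply: le_lt_trans lK.
apply: ge0_le_integral => //.
- by apply/measurable_EFinP; apply: measurableT_comp => //; exact: measurable_funTS.
- exact: measurableT_comp.
- move=> x _ /=; rewrite lee_fin [leRHS]ger0_norm ?addr_ge0 ?sqr_ge0//.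
  rewrite -[f x ^+ 2]real_normK ?num_real//; have := sqr_ge0 (`|f x| - 1).
  have := normr_ge0 (f x); nra.
Qed.

(** Integration by parts, in the form in which the boundary terms vanish. *)
Lemma Rint_derive0 M f g : (forall x, is_derive x (1 : R) f (g x)) ->
  continuous g -> vanishes_beyond M f -> \int[mu]_x g x = 0.
Proof.
move=> fg cg f0; have gE := is_derive_fun fg.
pose N := `|M| + 1.
have MN : M < N by rewrite /N (le_lt_trans (ler_norm _))// ltrDl.
have N0 : 0 < N by rewrite /N ltr_wpDl.
have g0 : vanishes_beyond M g by rewrite -gE; exact: vanishes_derive.
have -> : g = g \_ `[- N, N]%classic.
  apply/funext => x; rewrite patchE; case: ifPn => // /negP xN; apply: g0.
  rewrite ltNge; apply/negP => xM; apply: xN.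
  by rewrite inE/= in_itv/= -ler_norml (le_trans xM)// ltW.
rewrite -Rintegral_mkcond /Rintegral (@continuous_FTC2 _ g f).
- have fN : f N = 0 by apply: f0; rewrite gtr0_norm.
  have fN' : f (- N) = 0 by apply: f0; rewrite normrN gtr0_norm.
  by rewrite fN fN' subee.
- lra.
- exact: continuous_subspaceT.
- have cf := is_derive_continuous fg; split.
  + by move=> x _; exact: ex_derive.
  + by apply: cvg_at_right_filter; exact: cf.
  + by apply: cvg_at_left_filter; exact: cf.
- by move=> x _; rewrite gE.
Qed.

(** For large slopes [c] the function [bump a b c] is close to the indicator of
    the open interval. *)
Section bump.
Variables (a b c : R).
Hypothesis c0 : 0 < c.

Definition bump x := expm 0 (c * (x - a)) * expm 0 (c * (b - x)).

Lemma expm0_ge0 x : 0 <= expm 0 x :> R.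
Proof. by rewrite /expm; case: ifP => // _; rewrite expr0 mul1r expR_ge0. Qed.

Lemma expm0_le1 x : expm 0 x <= 1 :> R.
Proof.
rewrite /expm; case: ifP => // x0; rewrite expr0 mul1r -expR0 ler_expR.
by rewrite oppr_le0 invr_ge0 ltW.
Qed.

Lemma bump_ge0 x : 0 <= bump x.
Proof. by rewrite mulr_ge0// expm0_ge0. Qed.

Lemma bump_le1 x : bump x <= 1.
Proof. by rewrite mulr_ile1 ?expm0_ge0 ?expm0_le1. Qed.

Lemma bump_out x : ~~ (a < x < b) -> bump x = 0.
Proof.
rewrite negb_and -!leNgt /bump /expm => /orP[xa|bx].
  by rewrite pmulr_rgt0// subr_gt0 ltNge xa mul0r.
by rewrite [X in _ * X](_ : _ = 0) ?mulr0// pmulr_rgt0// subr_gt0 ltNge bx.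
Qed.

Lemma bump_gt0 x : a < x < b -> 0 < bump x.
Proof.
move=> /andP[ax xb].
have h1 : 0 < c * (x - a) by rewrite mulr_gt0// subr_gt0.
have h2 : 0 < c * (b - x) by rewrite mulr_gt0// subr_gt0.
rewrite /bump /expm h1 h2.
by rewrite !expr0 !mul1r mulr_gt0// expR_gt0.
Qed.

Lemma bump_vanishes : vanishes_beyond (`|a| + `|b|) bump.
Proof.
move=> x abx; apply: bump_out; apply/negP => /andP[ax xb].
have := ler_norm b; have := ler_norm (- a); rewrite normrN => ha hb.
have ha' := normr_ge0 a; have hb' := normr_ge0 b.
suff : `|x| <= `|a| + `|b| by lra.
by rewrite ler_norml; apply/andP; split; lra.
Qed.

Lemma test_bump : test_function bump.
Proof.
apply: test_function_intro bump_vanishes => n; apply: ndiffM.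
  have := ndiff_affine c (- (c * a)) (smooth_expm 0 n).
  by congr (ndiff _ _); apply/funext => x; rewrite mulrBr.
have := ndiff_affine (- c) (c * b) (smooth_expm 0 n).
by congr (ndiff _ _); apply/funext => x; congr (expm _ _); ring.
Qed.
End bump.

Lemma bump_cvg (a b x : R) :
  bump a b n.+1%:R x @[n --> \oo] --> (\1_`]a, b[%classic x : R).
Proof.
rewrite indicE; have [axb|axb] := boolP (x \in _); last first.
  apply: cvg_near_cst; apply: nearW => n; rewrite bump_out//.
  by apply: contraNN axb => axb; rewrite inE/= in_itv/=.
move: axb; rewrite inE/= in_itv/= => /andP[ax xb].
have H y : 0 < y -> expm 0 (n.+1%:R * y) @[n --> \oo] --> (1 : R).
  move=> y0.
  have -> : (fun n => expm 0 (n.+1%:R * y)) =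
            (fun n => expR (- (y^-1 * n.+1%:R^-1))).
    apply/funext => n; rewrite /expm pmulr_lgt0// ltr0n/= expr0 mul1r.
    by rewrite invfM mulrC.
  have E : expR (- (y^-1 * n.+1%:R^-1)) @[n --> \oo] --> expR (- (y^-1 * 0)).
    apply: continuous_cvg; first exact: continuous_expR.
    by apply: cvgN; apply: cvgM; [exact: cvg_cst|exact: (@cvg_harmonic R)].
  by rewrite mulr0 oppr0 expR0 in E.
have E : bump a b n.+1%:R x @[n --> \oo] --> (1 * 1 : R).
  by apply: cvgM; apply: H; rewrite subr_gt0.
by rewrite mulr1 in E.
Qed.

(** Bumps converge to the indicator of an interval, so the primitive of [w]
    vanishes; Lebesgue differentiation then gives [w = 0]. *)
Theorem fundamental_lemma w : locally_integrable [set: R] w ->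
  (forall phi, test_function phi -> \int[mu]_x (w x * phi x) = 0) ->
  {ae mu, forall x, w x = 0}.
Proof.
move=> lw w0; have [mw _ _] := lw.
have itv0 (a b : R) : \int[mu]_(x in `[a, b]) w x = 0.
  rewrite Rintegral_mkcond.
  have E : {ae mu, forall x, (w \_ `[a, b]%classic) x = w x * \1_`]a, b[%classic x}.
    exists [set a; b]; split.
    - exact: measurableU.
    - by apply: countable_lebesgue_measure0; exact: finite_set_countable.
    - move=> x /=; apply: contra_notP => /not_orP[/eqP xa /eqP xb].
      have abE : (x \in `[a, b]%classic) = (x \in `]a, b[%classic).
        by apply/idP/idP; rewrite !inE/= !in_itv/= !le_eqVlt eq_sym (negbTE xa) (negbTE xb).
      rewrite patchE indicE abE.
      by case: (boolP (x \in `]a, b[%classic)); rewrite ?mulr1 ?mulr0.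
  rewrite (Rintegral_ae E).
  have cv : \int[mu]_x (w x * bump a b n.+1%:R x) @[n --> \oo] -->
      \int[mu]_x (w x * \1_`]a, b[%classic x).
    have mb n : measurable_fun [set: R] (bump a b n.+1%:R).
      by apply: test_measurable; apply: test_bump; rewrite ltr0n.
    have ab0 : vanishes_beyond (`|a| + `|b|) (\1_`]a, b[%classic : R -> R).
      move=> x abx; rewrite indicE; case: (boolP (x \in _)) => //.
      rewrite inE/= in_itv/= => axb.
      have := bump_vanishes ltr01 abx.
      by have := bump_gt0 ltr01 axb => /[swap] ->; rewrite ltxx.
    apply: (@Rint_dominated_cvg _ _ _
      (fun x => `|w x * \1_`]a, b[%classic x|)) => //.
    - by move=> n; exact: measurable_funM.
    - exact: measurable_funM.
    - apply/L1_norm/(L1M_loc_integrable (M := `|a| + `|b|) (C := 1)) => //.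
      by move=> x; rewrite indicE; case: (_ \in _); rewrite ?normr1 ?normr0.
    - by apply: aeW => x; apply: cvgM; [exact: cvg_cst|exact: bump_cvg].
    - apply: aeW => x n; rewrite normrM [leRHS]normrM ler_wpM2l//.
      rewrite indicE; case: (boolP (x \in _)) => [_|xab].
        by rewrite [leRHS]normr1 (ger0_norm (bump_ge0 _ _ _ _)); exact: bump_le1.
      rewrite bump_out ?normr0 ?ltr0n//.
      by apply: contraNN xab => axb; rewrite inE/= in_itv.
  have cv0 : \int[mu]_x (w x * bump a b n.+1%:R x) @[n --> \oo] --> (0 : R).
    apply: cvg_near_cst; apply: nearW => n.
    by apply: w0; apply: test_bump; rewrite ltr0n.
  exact: (cvg_unique _ cv cv0).
suff H n : {ae mu, forall x, - (n%:R : R) < x -> w x = 0}.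
  have /ae_foralln : forall n, {ae mu, forall x, - (n%:R : R) < x -> w x = 0} by [].
  apply: filterS => x Hx; apply: (Hx (Num.truncn `|x|).+1).
  rewrite ltrNl (le_lt_trans (ler_norm _))// normrN.
  by have := truncnS_gt `|x|.
have := @FTC1 R w (BLeft (- n%:R)).
move=> /(_ _ lw) /=; move=> /(_ (fun y => loc_integrable_itv (- n%:R) y lw)).
apply: filterS => x Hx nx; have [|_ <-] := Hx.
  by rewrite lte_fin.
rewrite (_ : (fun _ => _) = cst 0); first by rewrite derive1_cst.
by apply/funext => y; exact: itv0.
Qed.
End test_functions.

(** * Abel means of the Hartley kernel *)

Section kernels.
Context {R : realType}.
Local Notation mu := (@lebesgue_measure R).
Implicit Types f g phi : R -> R.

(** The kernel of the Hartley transform. *)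
Definition cas (t : R) : R := cos t + sin t.

Lemma continuous_mull (c : R) : continuous (fun x : R => c * x).
Proof. by move=> x; apply: cvgM; [exact: cvg_cst|exact: cvg_id]. Qed.

Lemma continuous_cos_mul (p : R) : continuous (fun x => cos (p * x)).
Proof.
by move=> x; apply: continuous_comp; [exact: continuous_mull|exact: continuous_cos].
Qed.

Lemma continuous_sin_mul (p : R) : continuous (fun x => sin (p * x)).
Proof.
by move=> x; apply: continuous_comp; [exact: continuous_mull|exact: continuous_sin].
Qed.

Lemma continuous_cas : continuous cas.
Proof.
by move=> x; apply: cvgD; [exact: continuous_cos|exact: continuous_sin].
Qed.

Lemma continuous_cas_mul (p : R) : continuous (fun x => cas (p * x)).
Proof.
by move=> x; apply: continuous_comp; [exact: continuous_mull|exact: continuous_cas].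
Qed.

Lemma cas_le2 t : `|cas t| <= 2.
Proof.
by rewrite (le_trans (ler_normD _ _))// (_ : 2 = 1 + 1)// lerD ?cos_max ?sin_max.
Qed.

Lemma measurable_cas : measurable_fun [set: R] cas.
Proof. exact: continuous_measurable_fun continuous_cas. Qed.

Lemma measurable_cas_mul p : measurable_fun [set: R] (fun x => cas (p * x)).
Proof. exact: continuous_measurable_fun (continuous_cas_mul (p:=p)). Qed.

Lemma casM s t : cas s * cas t = cos (s - t) + sin (s + t).
Proof. by rewrite cosB sinD /cas; ring. Qed.

Lemma casN t : cas (- t) = cos t - sin t.
Proof. by rewrite /cas cosN sinN. Qed.

Lemma is_derive_cas t : is_derive t (1 : R) cas (cas (- t)).
Proof.
have H := is_deriveD (is_derive_cos t) (is_derive_sin t).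
by apply: (is_derive_eq (f := cas) H); rewrite casN addrC.
Qed.

Section decay.
Variables (e : R) (e0 : 0 < e).

(** The Abel summation factor: it makes the kernel integrable in frequency. *)
Definition decay (p : R) := expR (- (e * `|p|)).

Lemma decay_ge0 p : 0 <= decay p. Proof. exact: expR_ge0. Qed.

Lemma decay_le1 p : decay p <= 1.
Proof. by rewrite -expR0 ler_expR oppr_le0 mulr_ge0// ltW. Qed.

Lemma continuous_decay : continuous decay.
Proof.
move=> p; apply: continuous_comp; last exact: continuous_expR.
apply: cvgN; apply: cvgM; first exact: cvg_cst.
exact: norm_continuous.
Qed.

Lemma measurable_decay : measurable_fun [set: R] decay.
Proof. exact: continuous_measurable_fun continuous_decay. Qed.

Lemma decayN p : decay (- p) = decay p.
Proof. by rewrite /decay normrN. Qed.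

Definition primitive (z p : R) := expR (- (e * p)) *
  (- e^-1 + (z * sin (p * z) - e * cos (p * z)) / (e ^+ 2 + z ^+ 2)).

Lemma is_derive_primitive z (p : R) :
  is_derive p (1 : R) (primitive z) (expR (- (e * p)) * (1 + cos (p * z))).
Proof.
have D0 : e ^+ 2 + z ^+ 2 != 0.
  by rewrite gt_eqF// ltr_pwDl ?exprn_gt0// sqr_ge0.
have dlin (c : R) : is_derive p (1 : R) (fun q => c * q) c.
  have := is_derive_affine c 0 p.
  by congr (is_derive _ _ _ _); apply/funext => q; rewrite addr0.
have dz : is_derive p (1 : R) (fun q => q * z) z.
  by under eq_fun do rewrite mulrC; exact: dlin.
have dE : is_derive p (1 : R) (fun q => expR (- (e * q))) (expR (- (e * p)) * - e).
  by apply: (is_derive_comp_fun (f := expR)); exact: is_deriveN.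
have dS : is_derive p (1 : R) (fun q => sin (q * z)) (cos (p * z) * z).
  exact: (is_derive_comp_fun (f := sin)).
have dC : is_derive p (1 : R) (fun q => cos (q * z)) (- sin (p * z) * z).
  exact: (is_derive_comp_fun (f := cos)).
have dzS := is_deriveM_fun (is_derive_cst z p 1) dS.
have deC := is_deriveM_fun (is_derive_cst e p 1) dC.
have dB := is_deriveB dzS deC.
have dQ := is_deriveM_fun dB (is_derive_cst (e ^+ 2 + z ^+ 2)^-1 p 1).
have dT := is_deriveD (is_derive_cst (- e^-1) p 1) dQ.
have H := is_deriveM_fun dE dT.
apply: (is_derive_eq (f := primitive z) H).
rewrite /cst !fctE/=; field.
by rewrite D0 lt0r_neq0.
Qed.

(** The summand [1] keeps the integrand nonnegative, which the fundamental
    theorem of calculus on a half line requires; it is removed afterwards. *)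
Lemma integral_decay_cos z :
  (\int[mu]_p (decay p * (1 + cos (p * z)))%:E =
   (2 * (e^-1 + e / (e ^+ 2 + z ^+ 2)))%:E)%E.
Proof.
have cosz : continuous (fun p : R => cos (p * z)).
  by under eq_fun do rewrite mulrC; exact: continuous_cos_mul.
rewrite ge0_symfun_integralT; first last.
- by move=> p /=; rewrite decayN mulNr cosN.
- move=> p; apply: cvgM; first exact: continuous_decay.
  by apply: cvgD; [exact: cvg_cst|exact: cosz].
- move=> p; by rewrite mulr_ge0 ?decay_ge0.
rewrite -set_itvcy.
have -> : (\int[mu]_(p in `[0%R, +oo[) (decay p * (1 + cos (p * z)))%:E =
    \int[mu]_(p in `[0%R, +oo[) (expR (- (e * p)) * (1 + cos (p * z)))%:E)%E.
  apply: eq_integral => p; rewrite inE/= in_itv/= andbT => p0.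
  by rewrite /decay ger0_norm.
have dp := is_derive_primitive z.
rewrite (@ge0_continuous_FTC2y _ _ (primitive z) 0 0).
- rewrite -EFinB -EFinM; congr (_%:E); rewrite /primitive mulr0 oppr0 expR0.
  by rewrite mul0r sin0 cos0; ring.
- move=> p _; by rewrite mulr_ge0 ?expR_ge0.
- apply: continuous_subspaceT => p.
  apply: cvgM; last by apply: cvgD; [exact: cvg_cst|exact: cosz].
  apply: continuous_comp; last exact: continuous_expR.
  by apply: cvgN; exact: continuous_mull.
- apply/cvgr0Pnorm_le => d d0.
  pose C := e^-1 + (`|z| + e) / (e ^+ 2 + z ^+ 2).
  have D0 : 0 < e ^+ 2 + z ^+ 2 by rewrite ltr_pwDl ?exprn_gt0// sqr_ge0.
  have C0 : 0 < C.
    rewrite /C ltr_pwDl ?invr_gt0//; apply: divr_ge0; last exact: ltW.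
    by apply: addr_ge0 => //; exact: ltW.
  have : \forall p \near +oo, expR (- (e * p)) <= d / C.
    have : expR (- (e * p)) @[p --> +oo] --> (0 : R).
      apply: (cvg_comp (fun p => e * p) (fun y => expR (- y))); last exact: cvgr_expR.
      exact: gt0_cvgMry.
    by move=> /cvgr_le; apply; rewrite divr_gt0.
  apply: filterS => p Hp.
  rewrite /primitive normrM ger0_norm ?expR_ge0//.
  rewrite -(divfK (lt0r_neq0 C0) d) ler_pM ?expR_ge0//.
  rewrite (le_trans (ler_normD _ _))// normrN gtr0_norm ?invr_gt0//.
  rewrite lerD2l normrM (@gtr0_norm _ (_^-1)) ?invr_gt0// ler_wpM2r ?invr_ge0 ?(ltW D0)//.
  rewrite (le_trans (ler_normB _ _))// !normrM (gtr0_norm e0).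
  by rewrite lerD// ler_piMr ?sin_max ?cos_max// ltW.
- by move=> p _; exact: ex_derive.
- by apply: cvg_at_right_filter; exact: is_derive_continuous dp 0.
- by move=> p _; rewrite (is_derive_fun dp).
Qed.

Lemma integral_decay : (\int[mu]_p (decay p)%:E = (2 / e)%:E)%E.
Proof.
have := integral_decay_cos 0.
under eq_integral do rewrite mulr0 cos0 mulrC EFinM.
have md : measurable_fun [set: R] (EFin \o decay).
  by apply/measurable_EFinP; exact: measurable_decay.
have d0 p : [set: R] p -> (0 <= (EFin \o decay) p)%E by rewrite lee_fin decay_ge0.
have two0 : (0 <= (1 + 1 : R)%:E)%E by rewrite lee_fin addr_ge0.
rewrite (ge0_integralZl mu measurableT md d0 two0) => H.
have lt_y : (\int[mu]_p (decay p)%:E < +oo)%E.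
  rewrite ltey; apply/eqP => dy; move: H; rewrite dy.
  by rewrite gt0_muley// lte_fin addr_gt0.
have := integral_ge0 mu d0; rewrite -[(\int[mu]_x _)%E]/(\int[mu]_p (decay p)%:E)%E.
case: (\int[mu]_p (decay p)%:E)%E lt_y H => // r _ [H] _.
congr (_%:E); have e1 := lt0r_neq0 e0.
move: H; rewrite expr0n addr0 => H.
have -> : r = (1 + 1) * r / 2 by field.
by rewrite H; field.
Qed.

Lemma L1_decay : L1 decay.
Proof.
apply/integrableP; split; first by apply/measurable_EFinP; exact: measurable_decay.
under eq_integral do rewrite gee0_abs ?lee_fin ?decay_ge0//.
by rewrite integral_decay ltry.
Qed.

Lemma Rintegral_decay_cos z :
  \int[mu]_p (decay p * cos (p * z)) = 2 * e / (e ^+ 2 + z ^+ 2).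
Proof.
have D0 : e ^+ 2 + z ^+ 2 != 0.
  by rewrite gt_eqF// ltr_pwDl ?exprn_gt0// sqr_ge0.
have ldc : L1 (fun p => decay p * cos (p * z)).
  apply: (L1M_bounded (M := 1)) L1_decay _ _; last by move=> p; exact: cos_max.
  apply: continuous_measurable_fun.
  by under eq_fun do rewrite mulrC; exact: continuous_cos_mul.
have := RintD L1_decay ldc.
rewrite {1 2}/Rintegral integral_decay/=.
under eq_integral do rewrite -{1}(mulr1 (decay _)) -mulrDr.
rewrite integral_decay_cos/= => H.
have -> : \int[mu]_p (decay p * cos (p * z)) =
    2 * (e^-1 + e / (e ^+ 2 + z ^+ 2)) - 2 / e by rewrite H addrC addKr.
by field; rewrite D0 lt0r_neq0.
Qed.

Lemma Rintegral_decay_sin z : \int[mu]_p (decay p * sin (p * z)) = 0.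
Proof.
have sz : measurable_fun [set: R] (fun p => sin (p * z)).
  apply: continuous_measurable_fun.
  by under eq_fun do rewrite mulrC; exact: continuous_sin_mul.
have ms : measurable_fun [set: R] (fun p => decay p * sin (p * z)).
  by apply: measurable_funM => //; exact: measurable_decay.
have ls : L1 (fun p => decay p * sin (p * z)).
  by apply: (L1M_bounded (M := 1)) L1_decay _ _ => // p; exact: sin_max.
have := Rintegral_opp ms.
rewrite (_ : \int[mu]_p _ = - \int[mu]_p (decay p * sin (p * z))).
  by move=> /eqP; rewrite -subr_eq0 -opprD oppr_eq0 -mulr2n mulrn_eq0/= => /eqP.
rewrite -RintN//; apply: eq_Rintegral => p _.
by rewrite decayN mulNr sinN mulrN.
Qed.

(** The Poisson kernel of the upper half plane at height [e]. *)
Definition poisson (z : R) := e / (pi * (e ^+ 2 + z ^+ 2)).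

(** Regularised orthogonality of the Hartley kernel: as [e] tends to zero the
    right-hand side concentrates on [x = y]. This replaces the inversion
    theorem. The sine part of [casM] is odd and integrates to zero. *)
Lemma Rintegral_decay_cas x y :
  \int[mu]_p (decay p * (cas (p * x) * cas (p * y))) = 2 * pi * poisson (x - y).
Proof.
have l1 (f : R -> R) : continuous f -> (forall t, `|f t| <= 1) ->
    L1 (fun p => decay p * f p).
  move=> cf f1; apply: (L1M_bounded (M := 1)) L1_decay _ f1.
  exact: continuous_measurable_fun.
transitivity (\int[mu]_p (decay p * cos (p * (x - y)) +
    decay p * sin (p * (x + y)))).
  by apply: eq_Rintegral => p _; rewrite casM (mulrBr p) (mulrDr p); ring.
rewrite RintD; last 2 first.
- apply: l1 => [|t]; last exact: cos_max.
  by under eq_fun do rewrite mulrC; exact: continuous_cos_mul.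
- apply: l1 => [|t]; last exact: sin_max.
  by under eq_fun do rewrite mulrC; exact: continuous_sin_mul.
rewrite Rintegral_decay_cos Rintegral_decay_sin addr0 /poisson.
have D0 : e ^+ 2 + (x - y) ^+ 2 != 0.
  by rewrite gt_eqF// ltr_pwDl ?exprn_gt0// sqr_ge0.
have := lt0r_neq0 (pi_gt0 R); move: (pi : R) => P P0.
by field; rewrite D0.
Qed.
End decay.
End kernels.

(** * The Poisson kernel as an approximate identity *)

Section poisson.
Context {R : realType}.
Local Notation mu := (@lebesgue_measure R).
Implicit Types f g phi : R -> R.

Section fixed_width.
Variables (e : R) (e0 : 0 < e).

Lemma poisson_den (z : R) : 0 < pi * (e ^+ 2 + z ^+ 2).
Proof. by rewrite mulr_gt0 ?pi_gt0// ltr_pwDl ?exprn_gt0// sqr_ge0. Qed.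

Lemma poisson_ge0 z : 0 <= poisson e z.
Proof. by rewrite divr_ge0// ltW// poisson_den. Qed.

Lemma poissonN z : poisson e (- z) = poisson e z.
Proof. by rewrite /poisson sqrrN. Qed.

Lemma continuous_poisson : continuous (poisson e).
Proof.
move=> z; apply: cvgM; first exact: cvg_cst.
apply: cvgV; first by rewrite gt_eqF// poisson_den.
apply: cvgM; first exact: cvg_cst.
by apply: cvgD; [exact: cvg_cst|exact: exprn_continuous].
Qed.

Lemma measurable_poisson : measurable_fun [set: R] (poisson e).
Proof. exact: continuous_measurable_fun continuous_poisson. Qed.

(** The arctangent is a primitive of the Poisson kernel, which gives its mass. *)
Lemma is_derive_atan_scaled (z : R) :
  is_derive z (1 : R) (fun z => atan (e^-1 * z) / pi) (poisson e z).
Proof.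
have dlin : is_derive z (1 : R) (fun q => e^-1 * q) e^-1.
  have := is_derive_affine e^-1 0 z.
  by congr (is_derive _ _ _ _); apply/funext => q; rewrite addr0.
have dA := is_derive_comp_fun (is_derive1_atan (e^-1 * z)) dlin.
have H := is_deriveM_fun dA (is_derive_cst pi^-1 z 1).
apply: (is_derive_eq (f := fun z => atan (e^-1 * z) / pi) H).
have := poisson_den z; rewrite /poisson /cst.
have := lt0r_neq0 (pi_gt0 R); move: (pi : R) => P P0 D.
have D1 : e ^+ 2 + z ^+ 2 != 0 by rewrite gt_eqF// ltr_pwDl ?exprn_gt0// sqr_ge0.
have e1 := lt0r_neq0 e0.
by rewrite mulr0 addr0; field; rewrite P0 D1 e1.
Qed.

Lemma integral_poisson : (\int[mu]_z (poisson e z)%:E = 1%:E)%E.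
Proof.
rewrite ge0_symfun_integralT; first last.
- by move=> z /=; rewrite poissonN.
- exact: continuous_poisson.
- exact: poisson_ge0.
rewrite -set_itvcy.
have dp := is_derive_atan_scaled.
rewrite (@ge0_continuous_FTC2y _ _ (fun z => atan (e^-1 * z) / pi) 0 2^-1).
- by rewrite mulr0 atan0 mul0r -EFinB subr0 -EFinM divff.
- by move=> z _; exact: poisson_ge0.
- by apply: continuous_subspaceT; exact: continuous_poisson.
- have -> : (2^-1 : R) = pi / 2 / pi.
    by rewrite mulrAC divff ?mul1r// gt_eqF ?pi_gt0.
  apply: cvgM; last exact: cvg_cst.
  apply: (cvg_comp (fun z => e^-1 * z) atan); last exact: cvgy_atan.
  by apply: gt0_cvgMry; rewrite ?invr_gt0//; exact: cvg_id.
- by move=> p _; exact: ex_derive.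
- by apply: cvg_at_right_filter; exact: is_derive_continuous dp 0.
- by move=> p _; rewrite (is_derive_fun dp).
Qed.

Lemma L1_poisson : L1 (poisson e).
Proof.
apply/integrableP; split; first by apply/measurable_EFinP; exact: measurable_poisson.
under eq_integral do rewrite gee0_abs ?lee_fin ?poisson_ge0//.
by rewrite integral_poisson ltry.
Qed.

Lemma Rintegral_poisson : \int[mu]_z poisson e z = 1.
Proof. by rewrite /Rintegral integral_poisson. Qed.

Lemma poisson_bounded z : `|poisson e z| <= (pi * e)^-1.
Proof.
rewrite ger0_norm ?poisson_ge0// /poisson ler_pdivrMr ?poisson_den//.
rewrite mulrC -ler_pdivrMr ?invr_gt0 ?mulr_gt0 ?pi_gt0// invrK.
have := sqr_ge0 z; have := pi_gt0 R; move: (pi : R) => P P0; nra.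
Qed.

Lemma L1_poisson_mul f x : L1 f -> L1 (fun y => f y * poisson e (x - y)).
Proof.
move=> lf; apply: (L1M_bounded lf); last by move=> y; exact: poisson_bounded.
exact: measurableT_comp measurable_poisson (measurable_reflect x).
Qed.

Lemma Rintegral_poisson_reflect x : \int[mu]_y poisson e (x - y) = 1.
Proof. by rewrite Rintegral_reflect ?Rintegral_poisson//; exact: measurable_poisson. Qed.

Lemma poisson_mean_bounded f C x : L1 f -> (forall y, `|f y| <= C) ->
  `|\int[mu]_y (f y * poisson e (x - y))| <= C.
Proof.
move=> lf fC; apply: le_trans (le_norm_Rint (L1_poisson_mul x lf)) _.
have lp := L1_reflect x L1_poisson.
rewrite -[C]mulr1 -(Rintegral_poisson_reflect x) -RintZ//.
apply: le_Rint; [exact/L1_norm/L1_poisson_mul|exact: L1Z|].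
by move=> y; rewrite normrM (ger0_norm (poisson_ge0 _)) ler_wpM2r ?poisson_ge0.
Qed.
End fixed_width.

(** Far from the origin the kernel of height [e] is [e] times a multiple of the
    fixed kernel of height one, so its tails vanish in the mean. *)
Lemma poisson_tail (e d z : R) : 0 < e -> 0 < d -> d <= `|z| ->
  poisson e z <= e * (1 + (d ^+ 2)^-1) * poisson 1 z.
Proof.
move=> e0 d0 dz; rewrite /poisson expr1n mul1r.
have z2 : d ^+ 2 <= z ^+ 2.
  by rewrite -[z ^+ 2]real_normK ?num_real// ler_pXn2r// ?nnegrE// ltW.
have d2 : 0 < d ^+ 2 by rewrite exprn_gt0.
have zp : 0 < z ^+ 2 by exact: lt_le_trans z2.
have dv : 0 < (d ^+ 2)^-1 by rewrite invr_gt0.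
have e2 := sqr_ge0 e.
have [P0 Dz D1] : [/\ 0 < (pi : R), 0 < e ^+ 2 + z ^+ 2 & 0 < 1 + z ^+ 2].
  by split; rewrite ?pi_gt0 ?ltr_wpDl ?addr_gt0.
move: (pi : R) P0 => P P0.
rewrite -subr_ge0 (_ : _ - _ = e / P * ((1 + (d ^+ 2)^-1) / (1 + z ^+ 2) -
    (e ^+ 2 + z ^+ 2)^-1)); last first.
  by field; rewrite !lt0r_neq0.
rewrite mulr_ge0 ?divr_ge0 ?(ltW e0) ?(ltW P0)// subr_ge0.
rewrite -[(_ + z ^+ 2)^-1]mul1r ler_pdivrMr// mulrAC ler_pdivlMr// mul1r.
have h : 1 <= (d ^+ 2)^-1 * z ^+ 2 by rewrite ler_pdivlMl// mulr1.
have : 0 <= (d ^+ 2)^-1 * e ^+ 2 by rewrite mulr_ge0// ltW.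
nra.
Qed.

(** Near [x] continuity is used and away from [x] the bound on the tails. *)
Lemma poisson_cvg f C x : L1 f -> (forall y, `|f y| <= C) -> continuous f ->
  \int[mu]_y (f y * poisson n.+1%:R^-1 (x - y)) @[n --> \oo] --> f x.
Proof.
move=> lf fC cf; apply/cvgrPdist_le => eps eps0.
have C0 : 0 <= C by apply: le_trans (fC 0).
have mf := L1_measurable lf.
have eps2 : 0 < eps / 2 by rewrite divr_gt0.
have [d /= d0 fd] : exists2 d : R, 0 < d & forall y, `|x - y| < d -> `|f x - f y| <= eps / 2.
  have /cvgrPdist_le /(_ _ eps2)[d /= d0 H] := cf x.
  by exists d => // y xy; exact: H.
pose D := (1 + (d ^+ 2)^-1).
have D0 : 0 < D by rewrite ltr_wpDr// invr_ge0 exprn_ge0// ltW.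
have : \forall n \near \oo, 2 * C * (n.+1%:R^-1 * D) <= eps / 2.
  have : 2 * C * (n.+1%:R^-1 * D) @[n --> \oo] --> 2 * C * (0 * D).
    apply: cvgM; first exact: cvg_cst.
    by apply: cvgM; [exact: (@cvg_harmonic R)|exact: cvg_cst].
  by rewrite mul0r mulr0 => /cvgr_le; apply.
apply: filterS => n Hn.
have en : (0 : R) < n.+1%:R^-1 by rewrite invr_gt0 ltr0n.
set e := (n.+1%:R^-1 : R) in Hn en *.
have lp := L1_reflect x (L1_poisson en).
have lp1 := L1_reflect x (L1_poisson (ltr01 : (0 : R) < 1)).
have -> : f x - \int[mu]_y (f y * poisson e (x - y)) =
    \int[mu]_y ((f x - f y) * poisson e (x - y)).
  transitivity (\int[mu]_y (f x * poisson e (x - y) - f y * poisson e (x - y))).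
    rewrite RintB; [|exact: L1Z|exact: L1_poisson_mul].
    by rewrite RintZ// Rintegral_poisson_reflect// mulr1.
  by apply: eq_Rintegral => y _; rewrite mulrBl.
have lI : L1 (fun y => (f x - f y) * poisson e (x - y)).
  have := L1B (L1Z (f x) lp) (L1_poisson_mul en x lf).
  by apply: L1_eq => y; rewrite mulrBl.
apply: le_trans (le_norm_Rint lI) _.
have lB := L1D (L1Z (eps / 2) lp) (L1Z (2 * C * (e * D)) lp1).
apply: (@le_trans _ _ (\int[mu]_y (eps / 2 * poisson e (x - y) +
    2 * C * (e * D) * poisson 1 (x - y)))).
  apply: le_Rint => // [|y]; first exact: L1_norm.
  rewrite normrM (ger0_norm (poisson_ge0 en _)).
  have p0 := poisson_ge0 en (x - y).
  have p1 := poisson_ge0 ltr01 (x - y).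
  have [dxy|xyd] := leP d `|x - y|.
    have h0 : 0 <= eps / 2 * poisson e (x - y) by rewrite mulr_ge0// ltW.
    rewrite ler_wpDl//.
    rewrite -!mulrA [leRHS]mulrA; apply: ler_pM => //.
      rewrite (le_trans (ler_normB _ _))//.
      by have := fC x; have := fC y; lra.
    by rewrite mulrA; exact: (poisson_tail en d0 dxy).
  have h0 : 0 <= 2 * C * (e * D) * poisson 1 (x - y).
    by apply: mulr_ge0 => //; apply: mulr_ge0; apply: mulr_ge0 => //; exact: ltW.
  rewrite ler_wpDr//.
  by rewrite ler_wpM2r// fd.
rewrite RintD; [|exact: L1Z..].
rewrite (RintZ _ lp) (RintZ _ lp1) (Rintegral_poisson_reflect en).
by rewrite (Rintegral_poisson_reflect ltr01) !mulr1; lra.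
Qed.
End poisson.

(** * The Hartley transform of integrable functions *)

Section hartley.
Context {R : realType}.
Local Notation mu := (@lebesgue_measure R).
Implicit Types f g phi psi : R -> R.

Definition hc : R := (Num.sqrt (2 * pi))^-1.

Lemma hc_gt0 : 0 < hc.
Proof. by rewrite invr_gt0 sqrtr_gt0 mulr_gt0 ?pi_gt0. Qed.

Lemma sqr_hc : hc * hc = (2 * pi)^-1.
Proof. by rewrite -invfM -expr2 sqr_sqrtr// mulr_ge0// ltW// pi_gt0. Qed.

(** The Hartley transform: the even part of the Fourier transform plus [i]
    times its odd part. It maps real functions to real functions and is its own
    inverse, so that the whole argument stays over the reals. *)
Definition hart f (p : R) : R := hc * \int[mu]_x (f x * cas (p * x)).

Lemma L1_cas f p : L1 f -> L1 (fun x => f x * cas (p * x)).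
Proof.
move=> lf; apply: (L1M_bounded lf); last by move=> x; exact: cas_le2.
exact: measurable_cas_mul.
Qed.

Lemma hart_bounded f : L1 f ->
  forall p, `|hart f p| <= hc * (2 * \int[mu]_x `|f x|).
Proof.
move=> lf p; rewrite normrM (gtr0_norm hc_gt0) ler_pM2l ?hc_gt0//.
apply: le_trans (le_norm_Rint (L1_cas p lf)) _.
rewrite -RintZ; last exact: L1_norm.
apply: le_Rint => [||x]; [exact/L1_norm/L1_cas|exact/L1Z/L1_norm|].
by rewrite normrM mulrC ler_wpM2r// cas_le2.
Qed.

Lemma continuous_hart f : L1 f -> continuous (hart f).
Proof.
move=> lf p; apply: cvgM; first exact: cvg_cst.
have mf := L1_measurable lf.
pose I : set R := `](p - 1), (p + 1)[%classic.
have intf q : I q -> mu.-integrable setT (EFin \o (fun x => f x * cas (q * x))).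
  by move=> _; exact: L1_cas.
have cf : {ae mu, forall x, setT x -> {in I, continuous (fun q : R => f x * cas (q * x))}}.
  apply: aeW => x _ q _; apply: cvgM; first exact: cvg_cst.
  under eq_fun do rewrite mulrC.
  by rewrite mulrC; exact: continuous_cas_mul.
have ub q : I q -> {ae mu, forall x, setT x -> `|f x * cas (q * x)| <= 2 * `|f x|}.
  by move=> _; apply: aeW => x _; rewrite normrM mulrC ler_wpM2r// cas_le2.
have H := continuity_under_integral measurableT intf cf (L1Z 2 (L1_norm lf)) ub.
by apply: H; rewrite inE/= in_itv/= ltrBlDr ltrDl ltr01.
Qed.

Lemma measurable_hart f : L1 f -> measurable_fun [set: R] (hart f).
Proof. by move=> lf; exact: continuous_measurable_fun (continuous_hart lf). Qed.

Lemma hart_ae f g : {ae mu, forall x, f x = g x} -> hart f =1 hart g.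
Proof.
move=> fg p; congr (_ * _); apply: Rintegral_ae.
by apply: filterS fg => x ->.
Qed.

Lemma hartB f g : L1 f -> L1 g ->
  hart (fun x => f x - g x) =1 (fun p => hart f p - hart g p).
Proof.
move=> lf lg p; rewrite /hart -mulrBr -RintB; [|exact: L1_cas..].
by congr (_ * _); apply: eq_Rintegral => x _; rewrite mulrBl.
Qed.

Lemma hart_opp f : L1 f -> hart (fun x => f (- x)) =1 (fun p => hart f (- p)).
Proof.
move=> lf p; congr (_ * _).
have H := Rintegral_opp (L1_measurable (L1_cas (- p) lf)).
by rewrite -H; apply: eq_Rintegral => x _; rewrite mulrNN.
Qed.

Lemma hart_adjoint f g : L1 f -> L1 g -> dot (hart f) g = dot f (hart g).
Proof.
move=> lf lg.
have mf := L1_measurable lf; have mg := L1_measurable lg.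
have I : (mu \x mu)%E.-integrable [set: R * R]
    (EFin \o (fun z => f z.1 * g z.2 * cas (z.2 * z.1))).
  have := L1M_prod (L1Z 2 (L1_norm lf)) (L1_norm lg).
  apply: le_integrable => //.
    apply/measurable_EFinP/measurable_funM.
      apply: measurable_funM.
        exact: (measurableT_comp mf measurable_fst).
      exact: (measurableT_comp mg measurable_snd).
    apply: (measurableT_comp measurable_cas).
    exact: measurable_funM.
  move=> z _; rewrite /= lee_fin [leRHS]ger0_norm; last by rewrite !mulr_ge0.
  rewrite !normrM [leRHS](_ : _ = `|f z.1| * `|g z.2| * 2); last by ring.
  by rewrite ler_wpM2l ?cas_le2// mulr_ge0.
have := Rfubini I => /= E.
rewrite !dotE /hart.
transitivity (hc * \int[mu]_p \int[mu]_x (f x * g p * cas (p * x))).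
  rewrite -RintZ; last exact: (L1_fubini2 I).
  apply: eq_Rintegral => p _; rewrite -mulrA; congr (_ * _).
  rewrite mulrC -RintZ; last exact: L1_cas.
  by apply: eq_Rintegral => x _; ring.
rewrite -E -RintZ; last exact: (L1_fubini1 I).
apply: eq_Rintegral => x _; rewrite [RHS]mulrCA; congr (_ * _).
rewrite -RintZ; last exact: L1_cas.
by apply: eq_Rintegral => p _; rewrite (mulrC x); ring.
Qed.

(** Parseval's identity after Abel regularisation; Fubini moves the kernel to
    the frequency side, where it integrates to the Poisson kernel. *)
Lemma hart_decay_parseval e f g : 0 < e -> L1 f -> L1 g ->
  \int[mu]_p (hart f p * (hart g p * decay e p)) =
  \int[mu]_x (f x * \int[mu]_y (g y * poisson e (x - y))).
Proof.
move=> e0 lf lg.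
have lgd : L1 (fun p => hart g p * decay e p).
  have := L1M_bounded (L1_decay e0) (measurable_hart lg) (hart_bounded lg).
  by apply: L1_eq => p; rewrite mulrC.
rewrite -dotE (hart_adjoint lf lgd) dotE; apply: eq_Rintegral => x _.
congr (_ * _).
have ldc : L1 (fun p => decay e p * cas (p * x)).
  apply: (L1M_bounded (L1_decay e0)) => [|p]; last exact: cas_le2.
  by under eq_fun do rewrite mulrC; exact: measurable_cas_mul.
transitivity (hc * dot (hart g) (fun p => decay e p * cas (p * x))).
  rewrite dotE; congr (_ * _); apply: eq_Rintegral => p _.
  by rewrite (mulrC x); ring.
rewrite (hart_adjoint lg ldc) dotE -RintZ; last first.
  exact: L1M_bounded lg (measurable_hart ldc) (hart_bounded ldc).
apply: eq_Rintegral => y _; rewrite mulrCA; congr (_ * _).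
rewrite /hart mulrA sqr_hc.
transitivity ((2 * pi)^-1 * \int[mu]_p (decay e p * (cas (p * x) * cas (p * y)))).
  congr (_ * _); apply: eq_Rintegral => p _.
  by rewrite (mulrC y) mulrA.
rewrite Rintegral_decay_cas// mulrA mulVf ?mul1r//.
by rewrite gt_eqF// mulr_gt0// pi_gt0.
Qed.

(** [2 f(x) f(y) <= f(x)^2 + f(y)^2], and the Poisson kernel has mass one. *)
Lemma poisson_form_le e f : 0 < e -> L1 f -> L2 f ->
  \int[mu]_x (f x * \int[mu]_y (f y * poisson e (x - y))) <= dot f f.
Proof.
move=> e0 lf [mf lff]; have lp := L1_poisson e0.
have I1 := L1_conv_prod1 lp lff; have I2 := L1_conv_prod2 lp lff.
have Q1 : \int[mu]_x \int[mu]_y (poisson e (x - y) * f x ^+ 2) = dot f f.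
  rewrite dotE; apply: eq_Rintegral => x _.
  transitivity (\int[mu]_y (f x ^+ 2 * poisson e (x - y))).
    by apply: eq_Rintegral => y _; rewrite mulrC.
  rewrite RintZ; last exact: L1_reflect.
  by rewrite Rintegral_poisson_reflect// mulr1.
have Q2 : \int[mu]_x \int[mu]_y (poisson e (x - y) * f y ^+ 2) = dot f f.
  rewrite (Rfubini I2) dotE /=; apply: eq_Rintegral => y _.
  transitivity (\int[mu]_x (f y ^+ 2 * poisson e (x - y))).
    by apply: eq_Rintegral => x _; rewrite mulrC.
  rewrite RintZ; last exact: (L1_shift (- y)).
  rewrite (Rintegral_shift (- y) (measurable_poisson e0)).
  by rewrite Rintegral_poisson// mulr1.
have L1F1 := L1_fubini1 I1; have L1F2 := L1_fubini1 I2; rewrite /= in L1F1 L1F2.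
have mean : L1 (fun x => f x * \int[mu]_y (f y * poisson e (x - y))).
  have I0 := L1_conv_prod2 lp lf.
  have L0 := L1_fubini1 I0; rewrite /= in L0.
  apply: (L1M_bounded lf (M := (pi * e)^-1 * \int[mu]_y `|f y|)).
    have := L1_measurable L0; congr (measurable_fun _ _).
    by apply/funext => x; apply: eq_Rintegral => y _; rewrite mulrC.
  move=> x; apply: le_trans (le_norm_Rint (L1_poisson_mul e0 x lf)) _.
  rewrite -RintZ; last exact: L1_norm.
  apply: le_Rint => [||y]; [exact/L1_norm/L1_poisson_mul|exact/L1Z/L1_norm|].
  by rewrite normrM mulrC ler_wpM2r// poisson_bounded.
have -> : dot f f = \int[mu]_x (2^-1 *
    (\int[mu]_y (poisson e (x - y) * f x ^+ 2) +
     \int[mu]_y (poisson e (x - y) * f y ^+ 2))).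
  by rewrite RintZ ?RintD ?Q1 ?Q2//; [field|exact: L1D].
apply: le_Rint => [//||x]; first exact/L1Z/L1D.
rewrite -RintZ; last exact: L1_poisson_mul.
have l1 : L1 (fun y => poisson e (x - y) * f x ^+ 2).
  have := L1Z (f x ^+ 2) (L1_reflect x lp).
  by apply: L1_eq => y; rewrite mulrC.
have l2 : L1 (fun y => poisson e (x - y) * f y ^+ 2).
  by have := L1_poisson_mul e0 x lff; apply: L1_eq => y; rewrite mulrC.
rewrite -RintD// -RintZ; last exact: L1D.
apply: le_Rint => [||y]; [exact/L1Z/L1_poisson_mul|exact/L1Z/L1D|].
have p0 := poisson_ge0 e0 (x - y).
rewrite -subr_ge0 (_ : _ - _ = 2^-1 * ((f x - f y) ^+ 2 * poisson e (x - y))).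
  by rewrite mulr_ge0// mulr_ge0// sqr_ge0.
by field.
Qed.

Lemma decay_cvg p : decay n.+1%:R^-1 p @[n --> \oo] --> (1 : R).
Proof.
rewrite [X in _ --> X](_ : 1 = expR (- (0 * `|p|))); last first.
  by rewrite mul0r oppr0 expR0.
apply: continuous_cvg; first exact: continuous_expR.
by apply: cvgN; apply: cvgM; [exact: (@cvg_harmonic R)|exact: cvg_cst].
Qed.

(** Fatou on the regularised Parseval identity. *)
Lemma hart_bessel f : L1 f -> L2 f ->
  L2 (hart f) /\ dot (hart f) (hart f) <= dot f f.
Proof.
move=> lf l2f; have mh := measurable_hart lf.
have en n : (0 : R) < n.+1%:R^-1 by rewrite invr_gt0 ltr0n.
have [||||| l1 l2] := @L1_fatou R
  (fun n p => hart f p * (hart f p * decay n.+1%:R^-1 p))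
  (fun p => hart f p * hart f p) (dot f f).
- move=> n.
  have H := L1M_bounded (L1_decay (en n)) mh (hart_bounded lf).
  have := L1M_bounded H mh (hart_bounded lf).
  by apply: L1_eq => p; ring.
- by move=> n p; rewrite mulrA mulr_ge0 ?decay_ge0// -expr2 sqr_ge0.
- exact: measurable_funM.
- apply: aeW => p; apply: cvgM; first exact: cvg_cst.
  rewrite -[X in _ --> X]mulr1; apply: cvgM; first exact: cvg_cst.
  exact: decay_cvg.
- by move=> n; rewrite hart_decay_parseval//; exact: poisson_form_le.
by rewrite [dot (hart f) _]dotE; split => //; split.
Qed.

(** Both sides of the regularised identity converge: the left one by dominated
    convergence, the right one because the Poisson kernel is an approximate
    identity on bounded continuous functions. *)
Lemma hart_parseval_test phi psi : test_function phi -> test_function psi ->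
  dot (hart phi) (hart psi) = dot phi psi.
Proof.
move=> tphi tpsi.
have en n : (0 : R) < n.+1%:R^-1 by rewrite invr_gt0 ltr0n.
have lphi := test_L1 tphi; have lpsi := test_L1 tpsi.
have [hphi _] := hart_bessel lphi (test_L2 tphi).
have [hpsi _] := hart_bessel lpsi (test_L2 tpsi).
have [C psiC] := test_bounded tpsi.
have mphi := L1_measurable lphi; have mpsi := L1_measurable lpsi.
have c1 : \int[mu]_p (hart phi p * (hart psi p * decay n.+1%:R^-1 p))
    @[n --> \oo] --> dot (hart phi) (hart psi).
  rewrite dotE.
  apply: (@Rint_dominated_cvg _ _ _ (fun p => `|hart phi p * hart psi p|)).
  - move=> n; apply: measurable_funM; first exact: measurable_hart.
    by apply: measurable_funM; [exact: measurable_hart|exact: measurable_decay].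
  - by apply: measurable_funM; exact: measurable_hart.
  - exact/L1_norm/L1_dot.
  - apply: aeW => p; apply: cvgM; first exact: cvg_cst.
    rewrite -[X in _ --> X]mulr1; apply: cvgM; first exact: cvg_cst.
    exact: decay_cvg.
  - apply: aeW => p n; rewrite mulrA normrM ler_piMr//.
    by rewrite ger0_norm ?decay_ge0 ?decay_le1.
have c2 : \int[mu]_x (phi x * \int[mu]_y (psi y * poisson n.+1%:R^-1 (x - y)))
    @[n --> \oo] --> dot phi psi.
  rewrite dotE.
  apply: (@Rint_dominated_cvg _ _ _ (fun x => C * `|phi x|)).
  - move=> n; apply: measurable_funM => //.
    have := L1_measurable (L1_fubini1 (L1_conv_prod2 (L1_poisson (en n)) lpsi)).
    congr (measurable_fun _ _); apply/funext => x /=.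
    by apply: eq_Rintegral => y _; rewrite mulrC.
  - exact: measurable_funM.
  - exact/L1Z/L1_norm.
  - apply: aeW => x; apply: cvgM; first exact: cvg_cst.
    exact: poisson_cvg lpsi psiC (test_continuous tpsi).
  - apply: aeW => x n; rewrite normrM mulrC ler_wpM2r//.
    exact: poisson_mean_bounded.
have E : (fun n => \int[mu]_p (hart phi p * (hart psi p * decay n.+1%:R^-1 p))) =
    (fun n => \int[mu]_x (phi x * \int[mu]_y (psi y * poisson n.+1%:R^-1 (x - y)))).
  by apply/funext => n; exact: hart_decay_parseval.
by rewrite E in c1; exact: (cvg_unique _ c1 c2).
Qed.
End hartley.

(** * The Hartley transform on square integrable functions *)

Section hartley_L2.
Context {R : realType}.
Local Notation mu := (@lebesgue_measure R).
Implicit Types f g phi psi : R -> R.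

Definition trunc n f (x : R) : R := f x * \1_`[- n%:R, n%:R]%classic x.

Lemma measurable_indic_itv (a b : R) :
  measurable_fun [set: R] (\1_`[a, b]%classic : R -> R).
Proof. exact: measurable_indic. Qed.

Lemma indic_le1 (A : set R) x : `|\1_A x| <= 1 :> R.
Proof. by rewrite indicE; case: (_ \in _); rewrite ?normr1 ?normr0. Qed.

Lemma L2_indic (a b : R) : L2 (\1_`[a, b]%classic : R -> R).
Proof.
exact: L1_bounded_L2 (L1_indic_itv a b true false) (indic_le1 _).
Qed.

Lemma L1_trunc n f : L2 f -> L1 (trunc n f).
Proof. by move=> lf; apply: L1_dot => //; exact: L2_indic. Qed.

Lemma L2_trunc n f : L2 f -> L2 (trunc n f).
Proof.
move=> lf; apply: L2M_bounded lf _ (indic_le1 _); exact: measurable_indic_itv.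
Qed.

Lemma trunc_pointwise f x : trunc n f x @[n --> \oo] --> f x.
Proof.
apply: cvg_near_cst; exists (Num.truncn `|x|).+1 => // n /= xn.
rewrite /trunc indicE mem_set ?mulr1//= in_itv/= -ler_norml.
rewrite (le_trans (ltW (truncnS_gt `|x|)))// ler_nat//.
Qed.

Lemma trunc_cvg f : L2 f -> nrm (fun x => trunc n f x - f x) @[n --> \oo] --> 0.
Proof.
move=> [mf lf]; rewrite -(sqrtr0 R).
apply: continuous_cvg; first exact: sqrt_continuous.
under eq_fun do rewrite dotE.
rewrite (_ : 0 = \int[mu]_x (cst 0 x)); last by rewrite Rintegral_cst// mul0r.
have mt n : measurable_fun [set: R] (trunc n f).
  by apply: measurable_funM => //; exact: measurable_indic_itv.
apply: (@Rint_dominated_cvg _ _ _ (fun x => 4 * f x ^+ 2)) => //.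
- by move=> n; apply: measurable_funM; apply: measurable_funB.
- exact: L1Z.
- apply: aeW => x; rewrite /= -(mulr0 0) -(subrr (f x)).
  by apply: cvgM; apply: cvgB; try exact: cvg_cst; exact: trunc_pointwise.
- apply: aeW => x n; rewrite ger0_norm -?expr2 ?sqr_ge0// /trunc indicE.
  by case: (_ \in _); rewrite ?mulr1 ?mulr0; have := sqr_ge0 (f x); nra.
Qed.

Lemma nrm_hart_le f : L1 f -> L2 f -> nrm (hart f) <= nrm f.
Proof.
by move=> l1 l2; rewrite nrm_le ?nrm_ge0// sqr_nrm; have [] := hart_bessel l1 l2.
Qed.

Lemma nrm_hartB_le f g : L1 f -> L2 f -> L1 g -> L2 g ->
  nrm (fun p => hart f p - hart g p) <= nrm (fun x => f x - g x).
Proof.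
move=> f1 f2 g1 g2; rewrite (_ : (fun p => _) = hart (fun x => f x - g x)).
  by apply: nrm_hart_le; [exact: L1B|exact: L2B].
by apply/funext => p; rewrite hartB.
Qed.

(** Square integrable functions are compared weakly, against test functions. *)
Lemma L2_test_dual f g : L2 f -> L2 g ->
  (forall phi, test_function phi -> dot f phi = dot g phi) ->
  {ae mu, forall x, f x = g x}.
Proof.
move=> lf lg fg.
have : {ae mu, forall x, f x - g x = 0}.
  apply: fundamental_lemma; first exact/L2_loc_integrable/L2B.
  move=> phi tphi; rewrite -dotE.
  by rewrite dotBl// ?fg ?subrr//; exact: test_L2.
by apply: filterS => x /eqP; rewrite subr_eq0 => /eqP.
Qed.

Lemma dot_eq_l f f' g : {ae mu, forall x, f x = f' x} -> dot f g = dot f' g.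
Proof. by move=> ff'; apply: dot_ae => //; exact: aeW. Qed.

Lemma dot_eq_r f g g' : {ae mu, forall x, g x = g' x} -> dot f g = dot f g'.
Proof. by move=> gg'; apply: dot_ae => //; exact: aeW. Qed.

Definition L2_limit (u : nat -> R -> R) : R -> R := xget (cst 0)
  [set g | L2 g /\ nrm (fun x => u n x - g x) @[n --> \oo] --> 0].

(** The extension of the transform by density: the limit of the transforms of
    the truncations, sealed for the same reason as [dot]. *)
Fact T_subproof :
  {T : (R -> R) -> R -> R | forall f, T f = L2_limit (fun n => hart (trunc n f))}.
Proof. by exists (fun f => L2_limit (fun n => hart (trunc n f))). Qed.

Definition T f := sval T_subproof f.

Lemma TE f : T f = L2_limit (fun n => hart (trunc n f)).
Proof. exact: svalP T_subproof f. Qed.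

Lemma L2_hart_trunc n f : L2 f -> L2 (hart (trunc n f)).
Proof. by move=> lf; have [] := hart_bessel (L1_trunc n lf) (L2_trunc n lf). Qed.

Lemma T_spec f : L2 f ->
  L2 (T f) /\ nrm (fun p => hart (trunc n f) p - T f p) @[n --> \oo] --> 0.
Proof.
move=> lf.
have [e e0|g lg gf] := L2_complete (fun n => L2_hart_trunc n lf).
  have /cvgr_le /(_ (e / 2)) := trunc_cvg lf.
  rewrite divr_gt0// => /(_ isT)[N _ HN].
  exists N => n m Nn Nm.
  apply: (le_trans (nrm_hartB_le (L1_trunc n lf) (L2_trunc n lf)
    (L1_trunc m lf) (L2_trunc m lf))).
  apply: (le_trans (nrm_triangle (L2_trunc n lf) lf (L2_trunc m lf))).
  by have := HN n Nn; have := HN m Nm; rewrite /= (nrmC f); lra.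
rewrite TE; exact: (@xgetI _ (cst 0) [set g | L2 g /\
  nrm (fun p => hart (trunc n f) p - g p) @[n --> \oo] --> 0] g).
Qed.

Lemma L2_T f : L2 f -> L2 (T f). Proof. by move=> /T_spec[]. Qed.

Lemma T_eq_ae f g : {ae mu, forall x, f x = g x} -> T f = T g.
Proof.
move=> fg; rewrite !TE; congr L2_limit; apply/funext => n; apply/funext => p.
by apply: hart_ae; apply: filterS fg => x; rewrite /trunc => ->.
Qed.

Lemma T_hart f : L1 f -> L2 f -> {ae mu, forall p, T f p = hart f p}.
Proof.
move=> l1 l2; have [lT cT] := T_spec l2; have [lh _] := hart_bessel l1 l2.
apply: (L2_unique_limit (fun n => L2_hart_trunc n l2) lT lh cT).
apply: (@squeeze_cvgr _ _ _ _ (cst 0) _ _ _ 0 _ (trunc_cvg l2)); last exact: cvg_cst.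
apply: nearW => n; rewrite nrm_ge0/=.
by apply: nrm_hartB_le => //; [exact: L1_trunc|exact: L2_trunc].
Qed.

(** [hart] is symmetric on truncations, and the inner product is continuous. *)
Lemma T_adjoint f g : L2 f -> L2 g -> dot (T f) g = dot f (T g).
Proof.
move=> lf lg; have [lTf cf] := T_spec lf; have [lTg cg] := T_spec lg.
have c1 := dot_cvg (fun n => L2_hart_trunc n lf) lTf
  (fun n => L2_trunc n lg) lg cf (trunc_cvg lg).
have c2 := dot_cvg (fun n => L2_trunc n lf) lf
  (fun n => L2_hart_trunc n lg) lTg (trunc_cvg lf) cg.
have E : (fun n => dot (hart (trunc n f)) (trunc n g)) =
         (fun n => dot (trunc n f) (hart (trunc n g))).
  by apply/funext => n; apply: hart_adjoint; exact: L1_trunc.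
by rewrite E in c1; exact: (cvg_unique _ c1 c2).
Qed.

Lemma T_test phi : test_function phi ->
  {ae mu, forall p, T phi p = hart phi p}.
Proof. by move=> tphi; apply: T_hart; [exact: test_L1|exact: test_L2]. Qed.

(** Weakly this is Parseval's identity for two test functions. *)
Lemma TT_test phi : test_function phi ->
  {ae mu, forall x, T (T phi) x = phi x}.
Proof.
move=> tphi; have lphi := test_L2 tphi.
apply: L2_test_dual => //; first exact/L2_T/L2_T.
move=> psi tpsi; have lpsi := test_L2 tpsi.
have lTpsi := L2_T lpsi; have lTphi := L2_T lphi.
rewrite T_adjoint// (dot_ae (T_test tphi) (T_test tpsi)).
exact: hart_parseval_test.
Qed.

(** Weakly, both transforms move to the test function, where [TT_test] applies. *)
Theorem TK f : L2 f -> {ae mu, forall x, T (T f) x = f x}.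
Proof.
move=> lf; apply: L2_test_dual => //; first exact/L2_T/L2_T.
move=> phi tphi; have lphi := test_L2 tphi; have lTf := L2_T lf.
have lTphi := L2_T lphi; rewrite T_adjoint// T_adjoint//.
exact/dot_eq_r/TT_test.
Qed.

Lemma T_parseval f g : L2 f -> L2 g -> dot (T f) (T g) = dot f g.
Proof.
move=> lf lg; have lTg := L2_T lg; rewrite T_adjoint//.
exact/dot_eq_r/TK.
Qed.

Lemma nrm_T f : L2 f -> nrm (T f) = nrm f.
Proof. by move=> lf; rewrite /nrm T_parseval. Qed.

Lemma TD f g : L2 f -> L2 g ->
  {ae mu, forall p, T (fun x => f x + g x) p = T f p + T g p}.
Proof.
move=> lf lg; have lTf := L2_T lf; have lTg := L2_T lg; have lfg := L2D lf lg.
apply: L2_test_dual; [exact: L2_T|exact: L2D|].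
move=> phi /test_L2 lphi; have lTphi := L2_T lphi.
rewrite (T_adjoint lfg lphi) (dotDl lTf lTg lphi) (dotDl lf lg lTphi).
by rewrite (T_adjoint lf lphi) (T_adjoint lg lphi).
Qed.

Lemma TZ c f : L2 f -> {ae mu, forall p, T (fun x => c * f x) p = c * T f p}.
Proof.
move=> lf; have lTf := L2_T lf; have lcf := L2Z c lf.
apply: L2_test_dual; [exact: L2_T|exact: L2Z|].
move=> phi /test_L2 lphi; have lTphi := L2_T lphi.
rewrite (T_adjoint lcf lphi) (dotZl _ lTf lphi) (dotZl _ lf lTphi).
by rewrite (T_adjoint lf lphi).
Qed.

Lemma TB f g : L2 f -> L2 g ->
  {ae mu, forall p, T (fun x => f x - g x) p = T f p - T g p}.
Proof.
move=> lf lg; have lTf := L2_T lf; have lTg := L2_T lg; have lfg := L2B lf lg.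
apply: L2_test_dual; [exact: L2_T|exact: L2B|].
move=> phi /test_L2 lphi; have lTphi := L2_T lphi.
rewrite (T_adjoint lfg lphi) (dotBl lTf lTg lphi) (dotBl lf lg lTphi).
by rewrite (T_adjoint lf lphi) (T_adjoint lg lphi).
Qed.

Lemma nrm_TB f g : L2 f -> L2 g ->
  nrm (fun p => T f p - T g p) = nrm (fun x => f x - g x).
Proof.
move=> lf lg; rewrite -(nrm_T (L2B lf lg)); apply: nrm_ae.
by have := TB lf lg; apply: filterS => p ->.
Qed.

Lemma T_inj f g : L2 f -> L2 g -> {ae mu, forall p, T f p = T g p} ->
  {ae mu, forall x, f x = g x}.
Proof.
move=> lf lg fg; apply: filterS2 (TK lf) (TK lg) => x <- <-.
by rewrite (T_eq_ae fg).
Qed.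
End hartley_L2.

(** * Weak derivatives on the transform side *)

Section derivatives.
Context {R : realType}.
Local Notation mu := (@lebesgue_measure R).
Implicit Types f g u v w phi psi : R -> R.

(** The transform of differentiation: [hart (phi^`()) = Dp (hart phi)]. As the
    Hartley kernel is not an eigenfunction, the frequencies [p] and [-p] mix. *)
Definition Dp w (p : R) : R := - p * w (- p).

(** The adjoint of [Dp], equal to [- Dp]. *)
Definition Da w (p : R) : R := p * w (- p).

Lemma hart_derive phi p : test_function phi ->
  hart (phi^`()%classic) p = - p * hart phi (- p).
Proof.
move=> tphi; have tphi' := test_derive tphi.
have [_ dphi] := smooth_derive (test_smooth tphi).
have [M _ phi0] := test_vanishes tphi.
have dcas x : is_derive x (1 : R) (fun y => cas (p * y)) (cas (- (p * x)) * p).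
  apply: (is_derive_comp_fun (f := cas)); first exact: is_derive_cas.
  have := is_derive_affine p 0 x.
  by congr (is_derive _ _ _ _); apply/funext => y; rewrite addr0.
have l1 := L1_cas p (test_L1 tphi').
have l2 := L1_cas (- p) (test_L1 tphi).
have := @Rint_derive0 R M (fun x => phi x * cas (p * x))
  (fun x => phi^`()%classic x * cas (p * x) + phi x * (cas (- (p * x)) * p)).
move=> /(_ (fun x => is_deriveM_fun (dphi x) (dcas x))).
have cphi := test_continuous tphi; have cphi' := test_continuous tphi'.
have cc : continuous (fun x => phi^`()%classic x * cas (p * x) +
    phi x * (cas (- (p * x)) * p)).
  move=> x; apply: cvgD.
    by apply: cvgM; [exact: cphi'|exact: continuous_cas_mul].
  apply: cvgM; first exact: cphi.
  apply: cvgM; last exact: cvg_cst.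
  by under eq_fun do rewrite -mulNr; rewrite -mulNr; exact: continuous_cas_mul.
have v0 : vanishes_beyond M (fun x => phi x * cas (p * x)).
  by move=> x /phi0 ->; rewrite mul0r.
move=> /(_ cc v0) H.
have E : \int[mu]_x (phi^`()%classic x * cas (p * x)) =
    - p * \int[mu]_x (phi x * cas (- p * x)).
  rewrite -RintZ//; apply/eqP; rewrite -subr_eq0 -RintB//; last exact: L1Z.
  rewrite -[X in _ == X]H; apply/eqP; apply: eq_Rintegral => x _.
  by rewrite [- p * x]mulNr; ring.
by rewrite /hart E mulrCA.
Qed.

Lemma hart_derive1n n phi : test_function phi ->
  hart (derive1n n phi) = iter n Dp (hart phi).
Proof.
move=> tphi; elim: n => // n IH; apply/funext => p.
by rewrite derive1nS hart_derive ?IH//; exact: test_derive1n.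
Qed.

Lemma measurable_Dp w : measurable_fun [set: R] w ->
  measurable_fun [set: R] (Dp w).
Proof.
by move=> mw; apply: measurable_funM; [exact: measurable_funN|exact: measurable_comp_opp].
Qed.

Lemma measurable_iterDp n w : measurable_fun [set: R] w ->
  measurable_fun [set: R] (iter n Dp w).
Proof. by move=> mw; elim: n => //= n; exact: measurable_Dp. Qed.

(** The four iterates alternate between [w p] and [w (-p)], up to a sign. *)
Lemma norm_iterDp n w p :
  `|iter n Dp w p| = `|p| ^+ n * `|if odd n then w (- p) else w p|.
Proof.
elim: n p => [|n IH] p; first by rewrite expr0 mul1r.
rewrite iterS /Dp normrM normrN IH normrN opprK exprS mulrA /=.
by case: (odd n).
Qed.

Lemma iter4Dp w p : iter 4 Dp w p = p ^+ 4 * w p.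
Proof. by rewrite /= /Dp !opprK; ring. Qed.

Lemma expr4N (p : R) : (- p) ^+ 4 = p ^+ 4.
Proof. by rewrite -[4%N]/(2 * 2)%N !exprM sqrrN. Qed.

Lemma iterDa n w p : iter n Da w p = (-1) ^+ n * iter n Dp w p.
Proof.
elim: n p => [|n IH] p; first by rewrite expr0 mul1r.
by rewrite !iterS /Dp /Da IH exprS; ring.
Qed.

Lemma Dp_adjoint n w1 w2 : measurable_fun [set: R] w1 ->
  measurable_fun [set: R] w2 ->
  \int[mu]_p (w1 p * iter n Dp w2 p) = \int[mu]_p (iter n Da w1 p * w2 p).
Proof.
move=> mw1 mw2; elim: n w1 mw1 => // n IH w1 mw1.
have mD : measurable_fun [set: R] (iter n Dp w2) by exact: measurable_iterDp.
have mDa : measurable_fun [set: R] (Da w1).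
  by apply: measurable_funM => //; exact: measurable_comp_opp.
rewrite [in RHS]iterSr -IH// -Rintegral_opp.
  by apply: eq_Rintegral => p _; rewrite iterS /Dp /Da opprK; ring.
by apply: measurable_funM => //; exact: (measurable_iterDp n.+1).
Qed.

Lemma iterDp_adjoint n w1 w2 : measurable_fun [set: R] w1 ->
  measurable_fun [set: R] w2 ->
  L1 (fun p => iter n Dp w1 p * w2 p) ->
  dot w1 (iter n Dp w2) = (-1) ^+ n * dot (iter n Dp w1) w2.
Proof.
move=> mw1 mw2 l1; rewrite !dotE Dp_adjoint// -RintZ//.
by apply: eq_Rintegral => p _; rewrite iterDa mulrA.
Qed.

(** [|p|^n <= 1 + p^4] for [n <= 4]. *)
Lemma L2_iterDp n w : (n <= 4)%N -> L2 w -> L2 (fun p => p ^+ 4 * w p) ->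
  L2 (iter n Dp w).
Proof.
move=> n4 lw l4w.
have l0 : L2 (fun p => if odd n then w (- p) else w p).
  by case: (odd n) => //; exact: L2_opp.
have l4 : L2 (fun p => p ^+ 4 * (if odd n then w (- p) else w p)).
  case: (odd n) => //; apply: L2_eq (L2_opp l4w) => p /=.
  by rewrite -[4%N]/(2 * 2)%N !exprM sqrrN.
apply: (L2_le _ (L2D (L2_norm l0) (L2_norm l4))).
  exact: measurable_iterDp (L2_measurable lw).
move=> p; rewrite norm_iterDp [leRHS]ger0_norm ?addr_ge0// normrM normrX.
set a := `|p|; set b := `|if _ then _ else _|.
have a0 : 0 <= a by rewrite normr_ge0.
have b0 : 0 <= b by rewrite normr_ge0.
rewrite -{2}(mul1r b) -mulrDl ler_wpM2r//.
have [a1|/ltW a1] := leP a 1.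
  by apply: (@le_trans _ _ 1); [exact: exprn_ile1|rewrite lerDl exprn_ge0].
apply: (@le_trans _ _ (a ^+ 4)); last by rewrite lerDr.
exact: ler_weXn2l.
Qed.

Lemma L2_L1loc u : L2 u -> L1loc u.
Proof. by move=> lu; exists u; [exact: L2_loc_integrable|exact: aeW]. Qed.

Lemma L2_hart_test phi : test_function phi -> L2 (hart phi).
Proof. by move=> tphi; have [] := hart_bessel (test_L1 tphi) (test_L2 tphi). Qed.

Lemma dot_T_test u phi : L2 u -> test_function phi ->
  dot (T u) (hart phi) = dot u phi.
Proof.
move=> lu tphi; have lphi := test_L2 tphi; rewrite -(T_parseval lu lphi).
by apply: dot_eq_r; have := T_test tphi; apply: filterS => p ->.
Qed.

(** [Dp] moves across the inner product onto the test function, where it is the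
    transform of a classical derivative. *)
Lemma weak_derivative_multiplier n u : L2 u -> L2 (iter n Dp (T u)) ->
  weak_derivative n u (T (iter n Dp (T u))).
Proof.
move=> lu lD; have lT := L2_T lD; split; [exact: L2_L1loc|exact: L2_L1loc|].
move=> phi tphi; rewrite -!dotE.
rewrite -(dot_T_test lu (test_derive1n n tphi)) hart_derive1n//.
have lh := L2_hart_test tphi.
rewrite (iterDp_adjoint (L2_measurable (L2_T lu)) (L2_measurable lh)
  (L1_dot lD lh)).
congr (_ * _); rewrite -(dot_T_test lT tphi).
by apply: dot_eq_l; have := TK lD; apply: filterS => p ->.
Qed.

Section small_bump.
Variable d : R.
Hypothesis d0 : 0 < d.

Definition small_bump := bump (- d) d 1.

Lemma test_small_bump : test_function small_bump.
Proof. exact: test_bump. Qed.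

Lemma small_bumpN x : small_bump (- x) = small_bump x.
Proof. by rewrite /small_bump /bump mulrC; congr (expm _ _ * expm _ _); ring. Qed.

Lemma hart_small_bumpN p : hart small_bump (- p) = hart small_bump p.
Proof.
rewrite -(hart_opp (test_L1 test_small_bump)).
by congr (hart _ _); apply/funext => x; rewrite small_bumpN.
Qed.

Lemma hart_small_bump_shift t p :
  hart (fun x => small_bump (x - t)) p = cas (p * t) * hart small_bump p.
Proof.
have lb := test_L1 test_small_bump.
have c1 := L1_cas p lb; have c2 := L1_cas (- p) lb.
have mt : measurable_fun [set: R] (fun x => small_bump x * cas (p * (x + t))).
  apply: measurable_funM; first exact: L1_measurable.
  apply: measurableT_comp (measurable_cas_mul p) _; exact: measurable_shift.
have E : \int[mu]_x (small_bump (x - t) * cas (p * x)) =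
    cos (p * t) * \int[mu]_x (small_bump x * cas (p * x)) +
    sin (p * t) * \int[mu]_x (small_bump x * cas (- p * x)).
  transitivity (\int[mu]_x (small_bump x * cas (p * (x + t)))).
    rewrite -(Rintegral_shift (- t) mt).
    by apply: eq_Rintegral => x _; rewrite subrK.
  rewrite -(RintZ _ c1) -(RintZ _ c2) -RintD; [|exact: L1Z..].
  apply: eq_Rintegral => x _.
  by rewrite (mulrDr p) mulNr /cas cosN sinN cosD sinD; ring.
rewrite /hart E mulrDr mulrCA (mulrCA hc) -/(hart small_bump p).
by rewrite -/(hart small_bump (- p)) hart_small_bumpN /cas mulrDl.
Qed.

Lemma integral_small_bump_gt0 : 0 < \int[mu]_x small_bump x.
Proof.
have b0 x : 0 <= small_bump x by exact: bump_ge0.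
have lb := test_L1 test_small_bump.
rewrite lt_neqAle Rintegral_ge0 ?andbT//; apply/eqP => I0.
have mb : measurable_fun [set: R] (EFin \o small_bump).
  by apply/measurable_EFinP; exact: L1_measurable.
have : (\int[mu]_x `|(EFin \o small_bump) x| = 0)%E.
  transitivity (\int[mu]_x (small_bump x)%:E)%E.
    by apply: eq_integral => x _; rewrite gee0_abs// lee_fin.
  by rewrite -(EFin_Rint lb) -I0.
move/(ae_eq_integral_abs mu measurableT mb) => -[N [mN N0 HN]].
have sub : `]- d, d[%classic `<=` N.
  move=> x /=; rewrite in_itv/= => xd; apply: HN => /= /(_ Logic.I) [] sb0.
  have := bump_gt0 (a := - d) (b := d) ltr01 xd.
  by rewrite -[bump _ _ _ _]/(small_bump x) sb0 ltxx.
have : (mu `](- d)%R, d[%classic <= mu N)%E by apply: le_measure; rewrite ?inE.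
have dd : - d < d by rewrite (lt_trans _ d0)// oppr_lt0.
rewrite N0 lebesgue_measure_itv/= lte_fin dd -EFinB lee_fin opprK leNgt.
by rewrite addr_gt0.
Qed.

(** On the support of the bump the kernel is larger than one half. *)
Lemma hart_small_bump_gt0 (q p : R) : 0 < q ->
  (forall y, `|y| < q -> 2^-1 < cas y) -> `|p| * d < q ->
  0 < hart small_bump p.
Proof.
move=> q0 casq pd; rewrite mulr_gt0 ?hc_gt0//.
have lb := test_L1 test_small_bump.
apply: (@lt_le_trans _ _ (2^-1 * \int[mu]_x small_bump x)).
  by rewrite mulr_gt0 ?invr_gt0// integral_small_bump_gt0.
rewrite -RintZ//; apply: le_Rint => [||x]; [exact: L1Z|exact: L1_cas|].
rewrite mulrC; have [xd|xd] := boolP (- d < x < d); last first.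
  by rewrite /small_bump bump_out// !mul0r.
rewrite ler_wpM2l//; first exact: bump_ge0.
apply/ltW/casq; rewrite normrM (le_lt_trans _ pd)// ler_wpM2l//.
by rewrite ler_norml; case/andP: xd => /ltW -> /ltW ->.
Qed.
End small_bump.

Lemma cas_near0 : exists2 q : R, 0 < q & forall y, `|y| < q -> 2^-1 < cas y.
Proof.
have h : (2^-1 : R) < cas 0 by rewrite /cas cos0 sin0 addr0; lra.
have /cvgr_gt /(_ _ h) [q /= q0 H] := @continuous_cas R 0.
by exists q => // y yq; apply: H; rewrite /= sub0r normrN.
Qed.

(** Testing against translates of a bump [psi] says that the Hartley transform
    of [(D^n (T u) - T v) * hart psi] vanishes; small bumps have transforms
    without zeros near any given frequency. *)
Lemma weak_derivative_hartley n u v : L2 u -> L2 v ->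
  (forall phi, test_function phi -> \int[mu]_x (u x * derive1n n phi x) =
     (-1) ^+ n * \int[mu]_x (v x * phi x)) ->
  {ae mu, forall p, T v p = iter n Dp (T u) p}.
Proof.
move=> lu lv uv.
have lU := L2_T lu; have lV := L2_T lv.
have mU := L2_measurable lU; have mV := L2_measurable lV.
set U := T u in lU mU *; set V := T v in lV mV *.
have mDU := measurable_iterDp n mU.
pose w p := iter n Dp U p - V p.
have mw : measurable_fun [set: R] w by exact: measurable_funB.
have DUh phi : test_function phi ->
    exists2 f : R -> R, L2 f & exists2 g : R -> R, (L2 g /\ exists C, forall p, `|g p| <= C) &
      forall p, `|iter n Dp U p * hart phi p| <= `|f p * g p|.
  move=> tphi; have tn := test_derive1n n tphi.
  have hn := L2_hart_test tn; have bn := hart_bounded (test_L1 tn).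
  exists (fun p => if odd n then U (- p) else U p).
    by case: (odd n) => //; exact: L2_opp.
  exists (fun p => if odd n then hart (derive1n n phi) (- p)
                   else hart (derive1n n phi) p).
    split; first by case: (odd n) => //; exact: L2_opp.
    by exists (hc * (2 * \int[mu]_x `|derive1n n phi x|)) => p; case: (odd n).
  move=> p; rewrite normrM norm_iterDp [leRHS]normrM hart_derive1n//.
  rewrite (_ : `|if odd n then iter n Dp (hart phi) (- p) else _| =
      `|p| ^+ n * `|hart phi p|); first by rewrite [leRHS]mulrCA [leRHS]mulrA.
  case: (boolP (odd n)) => on; rewrite norm_iterDp ?on ?(negbTE on)//.
  by rewrite normrN opprK.
have l1w phi : test_function phi ->
    L1 (fun p => iter n Dp U p * hart phi p) /\ L1 (fun p => w p * hart phi p).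
  move=> tphi; have lh := L2_hart_test tphi; have mh := L2_measurable lh.
  have [f lf [g [lg _] fg]] := DUh phi tphi.
  have l1 : L1 (fun p => iter n Dp U p * hart phi p).
    apply: (L1_le _ (L1_norm (L1_dot lf lg)) fg).
    exact: measurable_funM.
  split=> //; have := L1B l1 (L1_dot lV lh).
  by apply: L1_eq => p; rewrite /w mulrBl.
have l2w phi : test_function phi -> L2 (fun p => w p * hart phi p).
  move=> tphi; have lh := L2_hart_test tphi; have mh := L2_measurable lh.
  have [f lf [g [lg [C gC]] fg]] := DUh phi tphi.
  have l1 : L2 (fun p => iter n Dp U p * hart phi p).
    apply: (L2_le _ (L2M_bounded lf (L2_measurable lg) gC) fg).
    exact: measurable_funM.
  have l2 := L2M_bounded lV mh (hart_bounded (test_L1 tphi)).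
  by have := L2B l1 l2; apply: L2_eq => p; rewrite /w mulrBl.
have w0 phi : test_function phi -> \int[mu]_p (w p * hart phi p) = 0.
  move=> tphi; have lh := L2_hart_test tphi.
  have [l1 _] := l1w phi tphi.
  transitivity (\int[mu]_p (iter n Dp U p * hart phi p - V p * hart phi p)).
    by apply: eq_Rintegral => p _; rewrite /w mulrBl.
  rewrite RintB//; last exact: L1_dot.
  rewrite -!dotE (dot_T_test lv tphi).
  have := iterDp_adjoint mU (L2_measurable lh) l1.
  rewrite -hart_derive1n// (dot_T_test lu (test_derive1n n tphi)) dotE uv// -dotE.
  have sg0 : (-1 : R) ^+ n != 0 by rewrite signr_eq0.
  by move=> /(mulfI sg0) ->; rewrite subrr.
have wb d : 0 < d -> {ae mu, forall p, w p * hart (small_bump d) p = 0}.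
  move=> d0; have tb := test_small_bump d.
  have [_ l1] := l1w _ tb; have l2 := l2w _ tb.
  have h0 : hart (fun p => w p * hart (small_bump d) p) = cst 0.
    apply/funext => t.
    change (hc * \int[mu]_p (w p * hart (small_bump d) p * cas (t * p)) = 0).
    rewrite (_ : \int[mu]_p _ = \int[mu]_p (w p * hart (fun x => small_bump d (x - t)) p)).
      by rewrite w0 ?mulr0//; exact: test_shift.
    by apply: eq_Rintegral => p _; rewrite hart_small_bump_shift (mulrC p t); ring.
  apply: nrm_eq0 => //; rewrite -(nrm_T l2) (nrm_ae (T_hart l1 l2)) h0.
  by rewrite /nrm dot0r sqrtr0.
have /ae_foralln H : forall k : nat,
    {ae mu, forall p, w p * hart (small_bump k.+1%:R^-1) p = 0}.
  by move=> k; apply: wb; rewrite invr_gt0 ltr0n.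
have [q q0 casq] := cas_near0.
apply: filterS H => p wp.
suff : w p = 0 by move=> /eqP; rewrite subr_eq0 => /eqP ->.
(* a bump narrow enough for its transform to be positive at [p] *)
pose k := Num.truncn (`|p| / q).
have kq : `|p| * k.+1%:R^-1 < q.
  by rewrite ltr_pdivrMr ?ltr0n// mulrC -ltr_pdivrMr// truncnS_gt.
have k0 : (0 : R) < k.+1%:R^-1 by rewrite invr_gt0 ltr0n.
have := wp k => /eqP; rewrite mulf_eq0 => /orP[/eqP//|/eqP h0].
by have := hart_small_bump_gt0 k0 q0 casq kq; rewrite h0 ltxx.
Qed.
End derivatives.

(** * Convolution on the transform side *)

Section convolution.
Context {R : realType}.
Local Notation mu := (@lebesgue_measure R).
Implicit Types f g u v w phi psi theta K : R -> R.

Definition conv K f x := \int[mu]_y (K (x - y) * f y).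

(** Cosine and sine transforms: the even and odd parts of the Hartley one. *)
Definition cosT K (p : R) := (hart K p + hart K (- p)) / 2.

Definition sinT K (p : R) := (hart K p - hart K (- p)) / 2.

Definition kappa : R := Num.sqrt (2 * pi).

Lemma kappa_gt0 : 0 < kappa.
Proof. by rewrite sqrtr_gt0 mulr_gt0 ?pi_gt0. Qed.

Lemma hcE : hc = kappa^-1 :> R. Proof. by []. Qed.

(** The symbol of convolution by [K] acting on Hartley transforms. *)
Definition convT K w p := kappa * (cosT K p * w p + sinT K p * w (- p)).

Lemma cosTN K p : cosT K (- p) = cosT K p.
Proof. by rewrite /cosT opprK addrC. Qed.

Lemma sinTN K p : sinT K (- p) = - sinT K p.
Proof. by rewrite /sinT opprK -opprB mulNr. Qed.

Section kernel.
Variables (K : R -> R) (lK : L1 K).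

Let C := hc * (2 * \int[mu]_x `|K x|).

Lemma cosT_bounded p : `|cosT K p| <= C.
Proof.
rewrite /cosT normrM normfV (ger0_norm (ler0n R 2)) ler_pdivrMr//.
rewrite (le_trans (ler_normD _ _))//.
have := hart_bounded lK p; have := hart_bounded lK (- p); rewrite -/C; lra.
Qed.

Lemma sinT_bounded p : `|sinT K p| <= C.
Proof.
rewrite /sinT normrM normfV (ger0_norm (ler0n R 2)) ler_pdivrMr//.
rewrite (le_trans (ler_normB _ _))//.
have := hart_bounded lK p; have := hart_bounded lK (- p); rewrite -/C; lra.
Qed.

Lemma measurable_cosT : measurable_fun [set: R] (cosT K).
Proof.
have mh := measurable_hart lK; apply: measurable_funM => //.
by apply: measurable_funD => //; exact: measurable_comp_opp.
Qed.

Lemma measurable_sinT : measurable_fun [set: R] (sinT K).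
Proof.
have mh := measurable_hart lK; apply: measurable_funM => //.
by apply: measurable_funB => //; exact: measurable_comp_opp.
Qed.

Lemma L2_cosT w : L2 w -> L2 (fun p => cosT K p * w p).
Proof.
move=> lw; have := L2M_bounded lw measurable_cosT cosT_bounded.
by apply: L2_eq => p; rewrite mulrC.
Qed.

Lemma L2_sinT w : L2 w -> L2 (fun p => sinT K p * w p).
Proof.
move=> lw; have := L2M_bounded lw measurable_sinT sinT_bounded.
by apply: L2_eq => p; rewrite mulrC.
Qed.

Lemma L2_convT w : L2 w -> L2 (convT K w).
Proof.
by move=> lw; apply: L2Z; apply: L2D; [exact: L2_cosT|exact/L2_sinT/L2_opp].
Qed.

Lemma L1_cos p : L1 (fun x => K x * cos (p * x)).
Proof.
apply: (L1M_bounded (M := 1) lK); last by move=> x; exact: cos_max.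
exact: continuous_measurable_fun (continuous_cos_mul (p := p)).
Qed.

Lemma L1_sin p : L1 (fun x => K x * sin (p * x)).
Proof.
apply: (L1M_bounded (M := 1) lK); last by move=> x; exact: sin_max.
exact: continuous_measurable_fun (continuous_sin_mul (p := p)).
Qed.

Lemma cosTE p : hc * \int[mu]_x (K x * cos (p * x)) = cosT K p.
Proof.
have c1 := L1_cas p lK; have c2 := L1_cas (- p) lK.
rewrite /cosT /hart -mulrDr -mulrA; congr (_ * _).
rewrite -(RintD c1 c2) [RHS]mulrC -(RintZ _ (L1D c1 c2)); apply: eq_Rintegral => x _.
by rewrite mulNr casN /cas; field.
Qed.

Lemma sinTE p : hc * \int[mu]_x (K x * sin (p * x)) = sinT K p.
Proof.
have c1 := L1_cas p lK; have c2 := L1_cas (- p) lK.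
rewrite /sinT /hart -mulrBr -mulrA; congr (_ * _).
rewrite -(RintB c1 c2) [RHS]mulrC -(RintZ _ (L1B c1 c2)); apply: eq_Rintegral => x _.
by rewrite mulNr casN /cas; field.
Qed.

(** The adjoint of convolution by [K]. *)
Definition coconv theta y := \int[mu]_x (K (x - y) * theta x).

Lemma L1_coconv theta : L1 theta -> L1 (coconv theta).
Proof. by move=> lt; exact: (L1_fubini2 (L1_conv_prod1 lK lt)). Qed.

Lemma L2_coconv theta : test_function theta -> L2 (coconv theta).
Proof.
move=> tt; have [M tM] := test_bounded tt; have lt := test_L1 tt.
apply: (@L1_bounded_L2 _ (M * \int[mu]_x `|K x|)); first exact: L1_coconv.
move=> y; have lKy := L1_shift (- y) lK.
have l1 : L1 (fun x => K (x - y) * theta x).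
  exact: L1M_bounded lKy (L1_measurable lt) tM.
apply: le_trans (le_norm_Rint l1) _.
rewrite -(Rintegral_shift (- y) (f := fun x => `|K x|)); last first.
  by apply: measurableT_comp => //; exact: L1_measurable.
rewrite -RintZ; last exact: (L1_norm lKy).
apply: le_Rint => [||x]; [exact: L1_norm|exact/L1Z/L1_norm|].
by rewrite normrM mulrC ler_wpM2r.
Qed.

(** Convolution theorem for the adjoint: Fubini, then the addition formulas for
    the kernel after a reflection in the inner integral. *)
Lemma hart_coconv theta p : L1 theta -> hart (coconv theta) p =
  kappa * (cosT K p * hart theta p - sinT K p * hart theta (- p)).
Proof.
move=> lt.
have I : (mu \x mu)%E.-integrable [set: R * R]
    (EFin \o (fun z => K (z.1 - z.2) * theta z.1 * cas (p * z.2))).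
  have lK2 := L1_conv_prod1 (L1Z 2 (L1_norm lK)) (L1_norm lt).
  apply: le_integrable lK2 => //.
    apply/measurable_EFinP/measurable_funM.
      apply: measurable_funM.
        apply: (measurableT_comp (L1_measurable lK)); exact: measurable_funB.
      exact: (measurableT_comp (L1_measurable lt) measurable_fst).
    exact: (measurableT_comp (measurable_cas_mul p) measurable_snd).
  move=> z _; rewrite /= lee_fin [leRHS]ger0_norm; last by rewrite !mulr_ge0.
  rewrite !normrM [leRHS](_ : _ = `|K (z.1 - z.2)| * `|theta z.1| * 2); last by ring.
  by rewrite ler_wpM2l ?cas_le2// mulr_ge0.
have E := Rfubini I; rewrite /= in E.
transitivity (hc * \int[mu]_y \int[mu]_x (K (x - y) * theta x * cas (p * y))).
  congr (_ * _).
  have := ae_integrable2 (L1_conv_prod1 lK lt) => H.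
  apply: Rintegral_ae; apply: (filterS _ H) => y ly.
  rewrite mulrC -RintZ//; apply: eq_Rintegral => x _.
  by rewrite mulrC.
have lc := L1_cas p lt; have lc' := L1_cas (- p) lt.
rewrite -E /hart.
transitivity (hc * \int[mu]_x (kappa * cosT K p * (theta x * cas (p * x)) -
   kappa * sinT K p * (theta x * cas (- p * x)))).
  congr (_ * _); apply: eq_Rintegral => x _.
  transitivity (theta x * \int[mu]_z (K z * cas (p * x - p * z))).
    have mz : measurable_fun [set: R] (fun z => K z * cas (p * x - p * z)).
      apply: measurable_funM; first exact: L1_measurable.
      apply: (measurableT_comp measurable_cas); apply: measurable_funB => //.
    rewrite -(Rintegral_reflect x mz) -RintZ; last first.
      have := L1M_bounded (L1_reflect x lK) (measurable_cas_mul p) (fun y => cas_le2 (p * y)).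
      by apply: L1_eq => y; congr (_ * cas _); ring.
    apply: eq_Rintegral => y _; rewrite (_ : p * x - p * (x - y) = p * y); first by ring.
    by ring.
  have -> : \int[mu]_z (K z * cas (p * x - p * z)) =
      kappa * (cosT K p * cas (p * x) - sinT K p * cas (- p * x)).
    have k0 : kappa != 0 :> R by rewrite gt_eqF// kappa_gt0.
    rewrite -cosTE -sinTE hcE; set Ic := \int[mu]_x (K x * cos (p * x)).
    set Is := \int[mu]_x (K x * sin (p * x)).
    rewrite (_ : kappa * _ = cas (p * x) * Ic - cas (- p * x) * Is); last by field.
    rewrite /Ic /Is.
    rewrite -(RintZ _ (L1_cos p)) -(RintZ _ (L1_sin p)) -RintB;
      [|exact/L1Z/L1_cos|exact/L1Z/L1_sin].
    apply: eq_Rintegral => z _.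
    by rewrite mulNr casN /cas cosB sinB; ring.
  by ring.
rewrite RintB; [|exact: L1Z..].
by rewrite !RintZ//; ring.
Qed.

(** By [2 |f(y) g(x)| <= f(y)^2 + g(x)^2] the kernel [K (x - y)] needs to be
    integrated against one variable at a time. *)
Lemma conv_prod_integrable f g : L2 f -> L2 g ->
  (mu \x mu)%E.-integrable [set: R * R]
    (EFin \o (fun z => K (z.1 - z.2) * f z.2 * g z.1)).
Proof.
move=> [mf lf] [mg lg]; have lK' := L1_norm lK.
have I1 := L1_conv_prod2 lK' lf; have I2 := L1_conv_prod1 lK' lg.
have I := integrableD measurableT I1 I2.
apply: le_integrable I => //.
  apply/measurable_EFinP/measurable_funM.
    apply: measurable_funM.
      by apply: (measurableT_comp (L1_measurable lK)); exact: measurable_funB.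
    exact: (measurableT_comp mf measurable_snd).
  exact: (measurableT_comp mg measurable_fst).
move=> z _; rewrite /= lee_fin -mulrDr [leRHS]ger0_norm; last first.
  by rewrite mulr_ge0// addr_ge0// sqr_ge0.
rewrite -mulrA normrM ler_wpM2l// normrM.
rewrite -[f z.2 ^+ 2]real_normK ?num_real// -[g z.1 ^+ 2]real_normK ?num_real//.
have := sqr_ge0 (`|f z.2| - `|g z.1|); have := normr_ge0 (f z.2).
have := normr_ge0 (g z.1); nra.
Qed.

(** The convolution integral converges at almost every [x] with [g x != 0], and
    both sides are zero elsewhere. *)
Lemma conv_mulE f g : L2 f -> L2 g ->
  {ae mu, forall x, conv K f x * g x = \int[mu]_y (K (x - y) * f y * g x)}.
Proof.
move=> lf lg; have H := ae_integrable1 (conv_prod_integrable lf lg).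
apply: (filterS _ H) => x /= lx.
have [gx0|gx0] := eqVneq (g x) 0.
  rewrite gx0 mulr0; transitivity (\int[mu]_y (cst 0 y : R)).
    by rewrite Rintegral_cst// mul0r.
  by apply: eq_Rintegral => y _; rewrite mulr0.
have l1 : L1 (fun y => K (x - y) * f y).
  have := L1Z (g x)^-1 (lx : L1 (fun y => K (x - y) * f y * g x)).
  by apply: L1_eq => y; rewrite mulrC mulfK.
rewrite mulrC -RintZ//; apply: eq_Rintegral => y _.
by rewrite mulrC.
Qed.

Lemma dot_conv f g : L2 f -> L2 g ->
  \int[mu]_x (conv K f x * g x) = dot f (coconv g).
Proof.
move=> lf lg; rewrite (Rintegral_ae (conv_mulE lf lg)).
have E := Rfubini (conv_prod_integrable lf lg); rewrite /= in E.
rewrite E dotE; apply: Rintegral_ae.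
have H := ae_integrable2 (conv_prod_integrable lf lg).
apply: (filterS _ H) => y /= ly.
have [fy0|fy0] := eqVneq (f y) 0.
  rewrite fy0 mul0r; transitivity (\int[mu]_x (cst 0 x : R)).
    by apply: eq_Rintegral => x _; rewrite mulr0 mul0r.
  by rewrite Rintegral_cst// mul0r.
have l1 : L1 (fun x => K (x - y) * g x).
  have := L1Z (f y)^-1 (ly : L1 (fun x => K (x - y) * f y * g x)).
  by apply: L1_eq => x; field.
by rewrite -RintZ//; apply: eq_Rintegral => x _; ring.
Qed.

Lemma measurable_conv f : measurable_fun [set: R] f ->
  measurable_fun [set: R] (conv K f).
Proof.
move=> mf; pose F (z : R * R) := (K (z.1 - z.2) * f z.2)%:E.
have mF : measurable_fun [set: R * R] F.
  apply/measurable_EFinP/measurable_funM.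
    by apply: (measurableT_comp (L1_measurable lK)); exact: measurable_funB.
  exact: (measurableT_comp mf measurable_snd).
have mp := measurable_funepos mF; have mn := measurable_funeneg mF.
have m1 := measurable_fun_fubini_tonelli_F (m2 := mu) _ mp (fun z => funepos_ge0 F z).
have m2 := measurable_fun_fubini_tonelli_F (m2 := mu) _ mn (fun z => funeneg_ge0 F z).
have -> : conv K f = (fun x => fine (fubini_F mu F^\+%E x - fubini_F mu F^\-%E x)%E).
  apply/funext => x; rewrite /conv /Rintegral integralE; congr (fine (_ - _)%E).
    by apply: eq_integral => y _; rewrite !funeposE.
  by apply: eq_integral => y _; rewrite !funenegE.
by apply: measurableT_comp => //; exact: emeasurable_funB.
Qed.

(** Fubini against the indicator of a large interval. *)
Lemma conv_loc_integrable f : L2 f -> locally_integrable [set: R] (conv K f).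
Proof.
move=> lf; have mc := measurable_conv (L2_measurable lf).
split => //; first exact: openT.
move=> A _ cA; have [M [_ HM]] := compact_bounded cA.
have AM : A `<=` `[- (M + 1), M + 1]%classic.
  move=> x Ax; rewrite /= in_itv/= -ler_norml.
  by apply: (HM (M + 1)) => //; rewrite ltrDl.
set J := `[- (M + 1), M + 1]%classic in AM.
have lJ : L2 (\1_J : R -> R) by exact: L2_indic.
have l1 : L1 (fun x => conv K f x * \1_J x).
  have := L1_fubini1 (conv_prod_integrable lf lJ).
  rewrite /= => l; apply/integrableP; split.
    by apply/measurable_EFinP/measurable_funM => //; exact: measurable_indic_itv.
  rewrite (integral_ae (g := fun x => `|(\int[mu]_y (K (x - y) * f y * \1_J x))%:E|%E)).
    exact: L1_lty.
  by have := conv_mulE lf lJ; apply: filterS => x /= ->.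
have mA : measurable (A : set (measurableTypeR R)) by exact: compact_measurable.
apply: le_lt_trans (L1_lty l1).
rewrite integral_mkcond; apply: ge0_le_integral => //.
- by move=> x _; rewrite patchE; case: ifP.
- apply/(measurable_restrictT _ _).1 => //; apply: measurable_funTS.
  by apply/measurable_EFinP; exact: measurableT_comp.
- apply/measurable_EFinP; apply: measurableT_comp => //.
  by apply: measurable_funM => //; exact: measurable_indic_itv.
- move=> x _; rewrite patchE; case: ifPn => [|_]; last by rewrite lee_fin.
  by rewrite inE => /AM xJ; rewrite lee_fin indicE mem_set// mulr1.
Qed.

(** Tested against [theta], the convolution moves to [theta] by Fubini, and
    [hart_coconv] gives its transform; the change of variable [p -> - p] in the
    sine term turns this into [convT]. *)
Theorem conv_hartley f : L2 f ->
  {ae mu, forall x, conv K f x = T (convT K (T f)) x}.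
Proof.
move=> lf; have lTf := L2_T lf; have lS := L2_convT lTf; have lTS := L2_T lS.
suff : {ae mu, forall x, conv K f x - T (convT K (T f)) x = 0}.
  by apply: filterS => x /eqP; rewrite subr_eq0 => /eqP.
have lc := conv_loc_integrable lf; have lcT := L2_loc_integrable lTS.
apply: fundamental_lemma => [|theta tt]; first exact: locally_integrableB.
have lt := test_L2 tt; have lg := L2_coconv tt.
transitivity (\int[mu]_x (conv K f x * theta x - T (convT K (T f)) x * theta x)).
  by apply: eq_Rintegral => x _; rewrite mulrBl.
rewrite RintB; [|exact: loc_integrable_test|exact: loc_integrable_test].
rewrite dot_conv// -dotE -(T_parseval lf lg); apply/eqP; rewrite subr_eq0; apply/eqP.
have lh := L2_hart_test tt; have l1g := L1_coconv (test_L1 tt).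
have -> : dot (T (convT K (T f))) theta = dot (convT K (T f)) (hart theta).
  rewrite -(dot_T_test lTS tt); apply: dot_eq_l.
  by have := TK lS; apply: filterS => p ->.
rewrite (dot_eq_r _ (T_hart l1g lg)).
have -> : hart (coconv theta) = (fun p => kappa *
    (cosT K p * hart theta p - sinT K p * hart theta (- p))).
  by apply/funext => p; exact: hart_coconv (test_L1 tt).
set w := T f in lTf *; have lho := L2_opp lh; have lwo := L2_opp lTf.
have a1 : L1 (fun p => w p * (cosT K p * hart theta p)).
  by apply: L1_dot => //; exact: L2_cosT.
have a2 : L1 (fun p => w p * (sinT K p * hart theta (- p))).
  by apply: L1_dot => //; exact: L2_sinT.
have a3 : L1 (fun p => sinT K p * w (- p) * hart theta p).
  by apply: L1_dot => //; exact: L2_sinT.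
have a4 : L1 (fun p => cosT K p * w p * hart theta p).
  by apply: L1_dot => //; exact: L2_cosT.
rewrite !dotE.
transitivity (kappa * (\int[mu]_p (w p * (cosT K p * hart theta p)) -
    \int[mu]_p (w p * (sinT K p * hart theta (- p))))).
  rewrite -RintB// -RintZ; last exact: L1B.
  by apply: eq_Rintegral => p _; ring.
transitivity (kappa * (\int[mu]_p (cosT K p * w p * hart theta p) +
    \int[mu]_p (sinT K p * w (- p) * hart theta p))); last first.
  rewrite -RintD// -RintZ; last exact: L1D.
  by apply: eq_Rintegral => p _; rewrite /convT; ring.
congr (_ * (_ + _)); first by apply: eq_Rintegral => p _; ring.
rewrite -(Rintegral_opp (L1_measurable a3)) -RintN//.
by apply: eq_Rintegral => p _; rewrite sinTN opprK; ring.
Qed.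
End kernel.
End convolution.

(** * The linear problem: bounds and dependence on the kernel *)

Section multipliers.
Context {R : realType}.
Local Notation mu := (@lebesgue_measure R).
Implicit Types f g u v w S W Phi Psi K : R -> R.

(** The hypothesis mixes [p] and [-p], which does not matter after integration:
    both halves of each sum have the same integral. *)
Lemma L2_even_part_le c f g : 0 <= c -> measurable_fun [set: R] f -> L2 g ->
  {ae mu, forall p, f p ^+ 2 + f (- p) ^+ 2 <= c ^+ 2 * (g p ^+ 2 + g (- p) ^+ 2)} ->
  L2 f /\ nrm f <= c * nrm g.
Proof.
move=> c0 mf lg fg; have [mg l2g] := lg; have [_ l2g'] := L2_opp lg.
have lf : L2 f.
  split => //.
  apply: (@L1_le_ae _ _ (fun p => c ^+ 2 * (g p ^+ 2 + g (- p) ^+ 2))).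
  - exact: measurable_funX.
  - exact/L1Z/L1D.
  - apply: filterS fg => p; rewrite ger0_norm ?sqr_ge0//.
    by apply: le_trans; rewrite lerDl sqr_ge0.
split=> //; have [_ l2f] := lf; have [_ l2f'] := L2_opp lf.
rewrite nrm_le; last by rewrite mulr_ge0// nrm_ge0.
rewrite exprMn sqr_nrm.
have E h : L2 h -> \int[mu]_p (h p ^+ 2 + h (- p) ^+ 2) = 2 * dot h h.
  move=> lh; have [mh l2h] := lh; have [_ l2h'] := L2_opp lh.
  rewrite RintD// (Rintegral_opp (f := fun p => h p ^+ 2)); last exact: measurable_funX.
  by rewrite dotE mulr2n mulrDl mul1r.
have := le_Rint_ae (L1D l2f l2f') (L1Z (c ^+ 2) (L1D l2g l2g')) fg.
rewrite (RintZ _ (L1D l2g l2g')) !E//; lra.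
Qed.

(** Banach's fixed point theorem in [L^2]. The distance between two iterates is
    controlled by how far each of them is from being fixed. *)
Lemma contraction_fixed_point (A : (R -> R) -> R -> R) (q : R) :
  0 <= q < 1 -> (forall v, L2 v -> L2 (A v)) ->
  (forall v w, L2 v -> L2 w ->
     nrm (fun x => A v x - A w x) <= q * nrm (fun x => v x - w x)) ->
  exists2 v, L2 v & {ae mu, forall x, v x = A v x}.
Proof.
move=> /andP[q0 q1] LA cA; pose v n := iter n A (cst 0).
have lv n : L2 (v n) by elim: n => [|n IH]; [exact: L2_0|exact: LA].
pose d := nrm (fun x => v 0%N x - v 1%N x).
have d0 : 0 <= d by exact: nrm_ge0.
have vS n : nrm (fun x => v n x - v n.+1 x) <= q ^+ n * d.
  elim: n => [|n IH]; first by rewrite expr0 mul1r.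
  by rewrite exprS -mulrA (le_trans (cA _ _ (lv n) (lv n.+1)))// ler_wpM2l.
have vnm n m : (1 - q) * nrm (fun x => v n x - v m x) <= (q ^+ n + q ^+ m) * d.
  have t1 := nrm_triangle (lv n) (lv n.+1) (lv m).
  have t2 := nrm_triangle (lv n.+1) (lv m.+1) (lv m).
  have t3 : nrm (fun x => v m.+1 x - v m x) <= q ^+ m * d by rewrite nrmC.
  have t4 : nrm (fun x => v n.+1 x - v m.+1 x) <= q * nrm (fun x => v n x - v m x).
    exact: cA.
  by have t5 := vS n; lra.
have q1' : 0 < 1 - q by rewrite subr_gt0.
have cq : (q ^+ n * d) @[n --> \oo] --> (0 : R).
  rewrite -(mul0r d); apply: cvgM; last exact: cvg_cst.
  by apply: cvg_expr; rewrite ger0_norm.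
have [e e0|f lf vf] := L2_complete lv.
  have e1 : 0 < (1 - q) * e / 2 by rewrite divr_gt0// mulr_gt0.
  have /cvgr_le /(_ _ e1) [N _ HN] := cq; exists N => n m Nn Nm.
  rewrite -(ler_pM2l q1') (le_trans (vnm n m))// mulrDl.
  by have := HN n Nn; have := HN m Nm; rewrite /=; lra.
exists f => //; have lAf := LA _ lf.
apply: nrm_sub_eq0 => //.
apply/eqP; rewrite eq_le nrm_ge0 andbT.
have vf' : nrm (fun x => v n.+1 x - f x) @[n --> \oo] --> 0.
  by have := vf; rewrite -(cvg_shiftS (fun n => nrm (fun x => v n x - f x))).
have cB : nrm (fun x => v n.+1 x - f x) + q * nrm (fun x => v n x - f x)
    @[n --> \oo] --> 0 + q * 0.
  by apply: cvgD => //; apply: cvgM => //; exact: cvg_cst.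
rewrite mulr0 addr0 in cB.
apply: (cvgr_to_ge cB); apply: nearW => n.
have t := nrm_triangle lf (lv n.+1) lAf.
by rewrite (le_trans t)// (nrmC f) lerD2l cA.
Qed.

Lemma hart_cvg_cosT_sinT (K_ : nat -> R -> R) K p :
  (forall q, hart (K_ m) q @[m --> \oo] --> hart K q) ->
  cosT (K_ m) p @[m --> \oo] --> cosT K p /\ sinT (K_ m) p @[m --> \oo] --> sinT K p.
Proof.
move=> c; have cN : hart (K_ m) (- p) @[m --> \oo] --> hart K (- p) by exact: c.
by split; apply: cvgM; try exact: cvg_cst; [apply: cvgD|apply: cvgB].
Qed.

Section symbol.
Variables (a b : R).

(** [den p] is the squared modulus of [p^4 - a - i b p]. *)
Definition den (p : R) : R := (p ^+ 4 - a) ^+ 2 + (b * p) ^+ 2.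

(** On the transform side [u'''' - b u' - a u = s] couples the frequencies [p]
    and [-p]; this is the solution of that two by two system. *)
Definition Q S (p : R) : R := ((p ^+ 4 - a) * S p - b * p * S (- p)) / den p.

Lemma denN p : den (- p) = den p.
Proof. by rewrite /den expr4N mulrN sqrrN. Qed.

Lemma den_ge0 p : 0 <= den p.
Proof. by rewrite addr_ge0// sqr_ge0. Qed.

Hypothesis hb : b != 0.

Lemma den_gt0 p : p != 0 -> 0 < den p.
Proof.
move=> p0; rewrite ltr_wpDl// ?sqr_ge0// lt_neqAle sqr_ge0 andbT eq_sym.
by rewrite sqrf_eq0 mulf_neq0.
Qed.

Lemma QP U S p : p != 0 ->
  (p ^+ 4 - a) * U p + b * p * U (- p) = S p ->
  (p ^+ 4 - a) * U (- p) - b * p * U p = S (- p) -> U p = Q S p.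
Proof.
move=> p0 E1 E2; have d0 := lt0r_neq0 (den_gt0 p0).
by apply: (mulIf d0); rewrite /Q -E1 -E2 divfK// /den; ring.
Qed.

Lemma Q_system S p : p != 0 ->
  (p ^+ 4 - a) * Q S p + b * p * Q S (- p) = S p.
Proof.
move=> p0; have d0 := lt0r_neq0 (den_gt0 p0).
rewrite /Q denN opprK expr4N.
apply: (mulIf d0); rewrite !mulrA mulrDl !divfK//.
by rewrite /den; ring.
Qed.

(** The coefficient matrix of the system is a rotation scaled by the square root
    of [den p]. *)
Lemma Q_sqr S p : p != 0 ->
  Q S p ^+ 2 + Q S (- p) ^+ 2 = (S p ^+ 2 + S (- p) ^+ 2) / den p.
Proof.
move=> p0; have d0 := lt0r_neq0 (den_gt0 p0).
rewrite /Q denN opprK expr4N !expr_div_n -mulrDl.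
rewrite [X in X / _](_ : _ = (S p ^+ 2 + S (- p) ^+ 2) * den p); last first.
  by rewrite /den; ring.
by rewrite -mulrA expr2 invfM (mulrA (den p)) divff// mul1r.
Qed.

Lemma measurable_Q S : measurable_fun [set: R] S ->
  measurable_fun [set: R] (Q S).
Proof.
move=> mS; have mS' := measurable_comp_opp mS.
have mp4 : measurable_fun [set: R] (fun p : R => p ^+ 4 - a).
  by apply: measurable_funB => //; exact: measurable_funX.
have mbp : measurable_fun [set: R] (fun p : R => b * p) by exact: measurable_funM.
apply: measurable_funM.
  by apply: measurable_funB; exact: measurable_funM.
rewrite (_ : (fun x => _) = (fun x => den x `^ (-1))); last first.
  by apply/funext => x; rewrite powR_inv1// den_ge0.
apply: (measurableT_comp (measurable_powR _)).
by apply: measurable_funD; exact: measurable_funX.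
Qed.

(** [weighted_sol] is the transform of the solution [u] of the linear problem
    [u'''' - b u' - a u = K * f], where [Phi] is the transform of [f], times a
    weight [r]. The weights [1] and [p^4] are the two cases of interest. *)
Definition weighted_sol (r : R -> R) K Phi p := r p * Q (convT K Phi) p.

(** The bound [|r(p) K^(p) / (p^4 - a - i b p)| <= C] almost everywhere, written
    without division. *)
Definition symbol_bounded (r : R -> R) K C :=
  {ae mu, forall p, r p ^+ 2 * (cosT K p ^+ 2 + sinT K p ^+ 2) <= C ^+ 2 * den p}.

Lemma ae_neq0 : {ae mu, forall p : R, p != 0}.
Proof.
exists [set 0]; split => //; first exact: lebesgue_measure_set1.
by move=> p /= /negP; rewrite negbK => /eqP.
Qed.

(** Likewise [convT] is a scaled rotation of the pair [(Phi p, Phi (-p))], so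
    the norm of the composite is computed exactly. *)
Lemma convT_sqr K Phi p : convT K Phi p ^+ 2 + convT K Phi (- p) ^+ 2 =
  kappa ^+ 2 * (cosT K p ^+ 2 + sinT K p ^+ 2) * (Phi p ^+ 2 + Phi (- p) ^+ 2).
Proof. by rewrite /convT cosTN sinTN opprK; ring. Qed.

Section weight.
Variables (r : R -> R) (C : R).
Hypotheses (mr : measurable_fun [set: R] r) (rN : forall p, r (- p) = r p).
Hypothesis (C0 : 0 <= C).

Lemma weighted_sol_sqr K Phi : symbol_bounded r K C -> {ae mu, forall p,
  weighted_sol r K Phi p ^+ 2 + weighted_sol r K Phi (- p) ^+ 2 <=
  (kappa * C) ^+ 2 * (Phi p ^+ 2 + Phi (- p) ^+ 2)}.
Proof.
move=> bK; apply: filterS2 ae_neq0 bK => p p0 bK.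
rewrite /weighted_sol rN !(exprMn _ (r p)) -mulrDr Q_sqr// convT_sqr mulrA.
rewrite ler_pdivrMr ?den_gt0//.
set s := cosT K p ^+ 2 + _ in bK *; set t := Phi p ^+ 2 + _.
rewrite (_ : _ * (_ * s * t) = kappa ^+ 2 * t * (r p ^+ 2 * s)); last by ring.
rewrite (_ : _ * den p = kappa ^+ 2 * t * (C ^+ 2 * den p)); last by ring.
by rewrite ler_wpM2l// mulr_ge0 ?sqr_ge0// addr_ge0 ?sqr_ge0.
Qed.

Lemma measurable_weighted_sol K Phi : L1 K -> L2 Phi ->
  measurable_fun [set: R] (weighted_sol r K Phi).
Proof.
move=> lK lP; apply: (measurable_funM mr).
exact: measurable_Q (L2_measurable (L2_convT lK lP)).
Qed.

Lemma weighted_sol_L2 K Phi : L1 K -> symbol_bounded r K C -> L2 Phi ->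
  L2 (weighted_sol r K Phi) /\ nrm (weighted_sol r K Phi) <= kappa * C * nrm Phi.
Proof.
move=> lK bK lP; apply: (L2_even_part_le _ _ lP); last exact: weighted_sol_sqr.
  by rewrite mulr_ge0// (ltW kappa_gt0).
exact: measurable_weighted_sol.
Qed.

Lemma weighted_solB K Phi Psi p : weighted_sol r K (fun x => Phi x - Psi x) p =
  weighted_sol r K Phi p - weighted_sol r K Psi p.
Proof. by rewrite /weighted_sol /Q /convT opprK; ring. Qed.

(** The symbols converge pointwise, and the bound by [C], being uniform in [m],
    provides the dominating function. *)
Lemma weighted_sol_cvg (K_ : nat -> R -> R) K Phi : (forall m, L1 (K_ m)) -> L1 K ->
  (forall p, hart (K_ m) p @[m --> \oo] --> hart K p) ->
  (forall m, symbol_bounded r (K_ m) C) -> symbol_bounded r K C -> L2 Phi ->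
  nrm (fun p => weighted_sol r (K_ m) Phi p - weighted_sol r K Phi p) @[m --> \oo] --> 0.
Proof.
move=> lK_ lK hK bK_ bK lP; rewrite -(sqrtr0 R).
apply: continuous_cvg; first exact: sqrt_continuous.
under eq_fun do rewrite dotE.
rewrite (_ : 0 = \int[mu]_x (cst 0 x)); last by rewrite Rintegral_cst// mul0r.
pose g p := 4 * (kappa * C) ^+ 2 * (Phi p ^+ 2 + Phi (- p) ^+ 2).
have mK_ m := measurable_weighted_sol (lK_ m) lP.
have mK' := measurable_weighted_sol lK lP.
have bA : {ae mu, forall p, forall m, weighted_sol r (K_ m) Phi p ^+ 2 +
    weighted_sol r (K_ m) Phi (- p) ^+ 2 <=
  (kappa * C) ^+ 2 * (Phi p ^+ 2 + Phi (- p) ^+ 2)}.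
  by apply/ae_foralln => m; exact: weighted_sol_sqr.
apply: (@Rint_dominated_cvg _ _ _ g) => //.
- by move=> m; apply: measurable_funM; exact: measurable_funB.
- have [_ l2] := lP; have [_ l2'] := L2_opp lP; exact/L1Z/L1D.
- apply: aeW => p.
  have [cc cs] := hart_cvg_cosT_sinT p hK.
  have cS : convT (K_ m) Phi p @[m --> \oo] --> convT K Phi p.
    apply: cvgM; first exact: cvg_cst.
    by apply: cvgD; apply: cvgM => //; exact: cvg_cst.
  have cSN : convT (K_ m) Phi (- p) @[m --> \oo] --> convT K Phi (- p).
    apply: cvgM; first exact: cvg_cst.
    apply: cvgD; (apply: cvgM; last exact: cvg_cst).
      by rewrite cosTN; under eq_fun do rewrite cosTN.
    by rewrite sinTN; under eq_fun do rewrite sinTN; exact: cvgN.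
  have cw : weighted_sol r (K_ m) Phi p - weighted_sol r K Phi p @[m --> \oo] --> 0.
    rewrite -(subrr (weighted_sol r K Phi p)); apply: cvgB; last exact: cvg_cst.
    apply: cvgM; first exact: cvg_cst.
    apply: cvgM; last exact: cvg_cst.
    by apply: cvgB; apply: cvgM => //; exact: cvg_cst.
  by rewrite /= -(mulr0 0); exact: cvgM.
- apply: filterS2 bA (weighted_sol_sqr Phi bK) => p bA bp m.
  have := bA m; rewrite ger0_norm -?expr2 ?sqr_ge0// /g; move: bp.
  set A := weighted_sol r K Phi p; set B := weighted_sol r K Phi (- p).
  set A' := weighted_sol r (K_ m) Phi p; set B' := weighted_sol r (K_ m) Phi (- p).
  set D := (kappa * C) ^+ 2 * _; rewrite -mulrA -/D.
  have := sqr_ge0 B; have := sqr_ge0 B'; have := sqr_ge0 (A + A'); nra.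
Qed.
End weight.

End symbol.
End multipliers.

(** * Lebesgue classes and the superposition operator *)

Section lebesgue_classes.
Context {R : realType}.
Local Notation mu := (@lebesgue_measure R).
Implicit Types f g u v w : R -> R.

Lemma Lfun2P f : (f \in Lfun mu 2%:E) <-> L2 f.
Proof.
split => [lf|[mf lf]].
  split; last exact: Lfun2_integrable_sqr lf.
  by move: lf; rewrite inE => /andP[+ _]; rewrite inE.
rewrite inE; apply/andP; split; rewrite inE//= /finite_norm unlock.
apply: poweR_lty; rewrite [ltLHS](_ : _ = (\int[mu]_x `|(f x ^+ 2)%:E|)%E); first exact: L1_lty.
by apply: eq_integral => x _; rewrite /= powR_mulrn// normrX.
Qed.

Lemma Lp2P f : Lp 2%:E f <-> exists2 g, L2 g & {ae mu, forall x, f x = g x}.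
Proof. by split=> -[g lg fg]; exists g => //=; apply/Lfun2P. Qed.

Lemma Lp1P f : Lp 1%:E f <-> exists2 g, L1 g & {ae mu, forall x, f x = g x}.
Proof. by split=> -[g lg fg]; exists g => //; apply/Lfun1_integrable. Qed.

Lemma L2_Lp f : L2 f -> Lp 2%:E f.
Proof. by move=> lf; apply/Lp2P; exists f => //; exact: aeW. Qed.

Lemma normLp1E f g : L1 g -> {ae mu, forall x, f x = g x} ->
  normLp 1%:E f = (\int[mu]_x `|g x|)%:E.
Proof.
move=> lg fg; rewrite /normLp Lnorm1 (EFin_Rint (L1_norm lg)).
by apply: integral_ae; apply: filterS fg => x /= ->.
Qed.

Lemma normLp2E f g : L2 g -> {ae mu, forall x, f x = g x} ->
  normLp 2%:E f = (nrm g)%:E.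
Proof.
move=> lg fg; rewrite /normLp unlock.
have -> : (\int[mu]_x `|(EFin \o f) x| `^ 2 = (dot g g)%:E)%E.
  rewrite dotE (EFin_Rint (L2_sqr lg)); apply: integral_ae.
  apply: filterS fg => x /= ->.
  by rewrite powR_mulrn// real_normK ?num_real.
by rewrite poweR_EFin powR12_sqrt// dot_ge0.
Qed.

Lemma cvg_normLp2 (f_ g_ : nat -> R -> R) : (forall n, L2 (g_ n)) ->
  (forall n, {ae mu, forall x, f_ n x = g_ n x}) ->
  (normLp 2%:E (f_ n) @[n --> \oo] --> 0%E) <-> (nrm (g_ n) @[n --> \oo] --> 0).
Proof.
move=> lg fg; under eq_fun do rewrite (normLp2E (lg _) (fg _)).
split => [/fine_cvgP[_]//|c].
by apply: cvg_EFin => //; exact: nearW.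
Qed.

(** A Borel version of [y |-> F (v y) y]: along the discretizations
    [floor ((n+1) v) / (n+1)] of [v] only countably many sections [F u] occur,
    and the Lipschitz bound lets [n] tend to infinity. *)
Lemma nemytskii_L2 (F : R -> R -> R) (k l : R) (h : R -> R) v :
  assumptionA F k l h -> L2 v ->
  exists2 phi, L2 phi & {ae mu, forall y, phi y = F (v y) y}.
Proof.
move=> [[mF _] [k0 l0] [/Lp2P[h' lh' hh'] h0] Fk Fl] lv.
have mv := L2_measurable lv.
have [g gP] : exists g : nat -> int -> R -> R, forall n j,
    measurable_fun [set: R] (g n j) /\
    {ae mu, forall x, F (j%:~R / n.+1%:R) x = g n j x}.
  have /choice[G GP] (u : R) : exists g, measurable_fun [set: R] g /\
      {ae mu, forall x, F u x = g x}.
    by have [g mg Fg] := mF u; exists g.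
  by exists (fun n j => G (j%:~R / n.+1%:R)) => n j; exact: GP.
pose fl n y := Num.floor (v y * n.+1%:R).
pose phi_ n y := g n (fl n y) y.
have mphi n : measurable_fun [set: R] (phi_ n).
  move=> _ A mA; rewrite setTI.
  rewrite (_ : _ @^-1` _ = \bigcup_j ([set y | fl n y = j] `&` (g n j @^-1` A))); last first.
    apply/seteqP; split => y; first by move=> ?; exists (fl n y).
    by move=> [j _ [<-]].
  apply: countable_bigcupT_measurable => // j; apply: measurableI.
    have m1 : measurable_fun [set: R] (fun y => v y * n.+1%:R) by exact: measurable_funM.
    have -> : [set y | fl n y = j] =
        [set: R] `&` (fun y => v y * n.+1%:R) @^-1` `[j%:~R, (j + 1)%:~R[%classic.
      rewrite setTI; apply/seteqP; split => y /=; rewrite in_itv/=.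
        by move=> <-; rewrite floor_le floorD1_gt.
      by move=> /floor_def.
    by apply: m1 => //; exact: measurable_itv.
  by rewrite -[X in measurable X]setTI; apply: (gP n j).1.
have phiF : {ae mu, forall y, forall n j, F (j%:~R / n.+1%:R) y = g n j y}.
  apply/ae_foralln => n.
  have H : forall i : nat, {ae mu, forall y, forall j, unpickle i = Some j ->
      F (j%:~R / n.+1%:R) y = g n j y}.
    move=> i; case: (unpickle i) => [j|]; last exact: aeW.
    by apply: filterS (gP n j).2 => y H _ [<-].
  by move/ae_foralln : H; apply: filterS => y H j; exact: (H (pickle j)) (pickleK j).
have cphi : {ae mu, forall y, phi_ ^~ y @ \oo --> F (v y) y}.
  apply: filterS phiF => y H.
  have E n : `|phi_ n y - F (v y) y| <= l * n.+1%:R^-1.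
    rewrite /phi_ -H (le_trans (Fl _ _ _))// ler_pM2l//.
    have n0 : (0 : R) < n.+1%:R by rewrite ltr0n.
    rewrite -[X in _ - X](mulfK (lt0r_neq0 n0)) -mulrBl normrM normfV (gtr0_norm n0).
    rewrite ler_piMl ?invr_ge0 ?(ltW n0)//.
    rewrite distrC ger0_norm ?subr_ge0 ?floor_le// lerBlDl.
    by rewrite -[X in _ + X]/(1%:~R) -intrD; apply/ltW; exact: floorD1_gt.
  have c0 : l * n.+1%:R^-1 @[n --> \oo] --> (0 : R).
    by rewrite -(mulr0 l); apply: cvgM; [exact: cvg_cst|exact: cvg_harmonic].
  have cN0 : - (l * n.+1%:R^-1) @[n --> \oo] --> (0 : R).
    by rewrite -[X in _ --> X]oppr0; exact: cvgN.
  have c : phi_ n y - F (v y) y @[n --> \oo] --> (0 : R).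
    by apply: (squeeze_cvgr _ cN0 c0); apply: nearW => n; rewrite -ler_norml.
  by apply/subr_cvg0.
pose phi y := fine (limn_esup (fun n => (phi_ n y)%:E)).
have mphi' : measurable_fun [set: R] phi.
  apply: measurableT_comp => //; apply: measurable_fun_limn_esup => n.
  exact/measurable_EFinP.
have phiE : {ae mu, forall y, phi y = F (v y) y}.
  apply: filterS cphi => y c; rewrite /phi.
  have /cvg_limn_einf_sup[_ ->] // : (fun n => (phi_ n y)%:E) @ \oo --> (F (v y) y)%:E.
  by apply: cvg_EFin => //; exact: nearW.
exists phi => //.
have lb : L2 (fun y => k * `|v y| + `|h' y|).
  by apply: L2D; [exact/L2Z/L2_norm|exact: L2_norm].
split => //; apply: (L1_le_ae _ lb.2); first exact: measurable_funX.
apply: filterS2 phiE hh' => y -> hy.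
rewrite normrX ler_pXn2r// ?nnegrE// ?addr_ge0 ?mulr_ge0 ?(ltW k0)//.
by rewrite (le_trans (Fk _ _))// lerD2l -hy ler_norm.
Qed.

(** A chosen square integrable Borel representative of [y |-> F (v y) y]. *)
Definition nemytskii (F : R -> R -> R) v : R -> R :=
  xget (cst 0) [set phi | L2 phi /\ {ae mu, forall y, phi y = F (v y) y}].

Lemma nemytskiiP F k l h v : assumptionA F k l h -> L2 v ->
  L2 (nemytskii F v) /\ {ae mu, forall y, nemytskii F v y = F (v y) y}.
Proof.
move=> hF lv; have [phi lphi phiF] := nemytskii_L2 hF lv.
exact: (@xgetI _ (cst 0) [set phi | L2 phi /\
  {ae mu, forall y, phi y = F (v y) y}] phi).
Qed.

Lemma nemytskii_lipschitz F k l h u v : assumptionA F k l h -> L2 u -> L2 v ->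
  nrm (fun y => nemytskii F u y - nemytskii F v y) <= l * nrm (fun y => u y - v y).
Proof.
move=> hF lu lv; have [l1 e1] := nemytskiiP hF lu; have [l2 e2] := nemytskiiP hF lv.
have [_ [_ l0] _ _ Fl] := hF; have ld := L2B lu lv.
rewrite nrm_le; last by rewrite mulr_ge0 ?nrm_ge0 ?(ltW l0).
rewrite exprMn sqr_nrm !dotE -(RintZ _ (L2_sqr ld)).
apply: le_Rint_ae; [exact: L2_sqr (L2B l1 l2)|exact: L1Z (L2_sqr ld)|].
apply: filterS2 e1 e2 => y -> ->; rewrite -!expr2 -exprMn.
rewrite -[leLHS]real_normK ?num_real// -[leRHS]real_normK ?num_real//.
by rewrite ler_pXn2r// ?nnegrE// normrM (gtr0_norm l0).
Qed.
End lebesgue_classes.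

(** * The equation on the transform side *)

Section weak_solutions.
Context {R : realType}.
Local Notation mu := (@lebesgue_measure R).
Implicit Types u v w S Phi phi : R -> R.

Lemma weak_derivative_unique n u w w' :
  weak_derivative n u w -> weak_derivative n u w' -> {ae mu, forall x, w x = w' x}.
Proof.
move=> [_ [g lg wg] uw] [_ [g' lg' wg'] uw'].
suff : {ae mu, forall x, g x - g' x = 0}.
  move=> H; apply: filterS3 H wg wg' => x /eqP; rewrite subr_eq0 => /eqP gg' wx w'x.
  by rewrite wx gg' -w'x.
apply: fundamental_lemma => [|phi tt]; first exact: locally_integrableB.
transitivity (\int[mu]_x (g x * phi x - g' x * phi x)).
  by apply: eq_Rintegral => x _; rewrite mulrBl.
rewrite RintB; [|exact: loc_integrable_test|exact: loc_integrable_test].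
have s0 : (-1 : R) ^+ n != 0 by rewrite signr_eq0.
have := uw _ tt; rewrite uw'// => /(mulfI s0) E.
apply/eqP; rewrite subr_eq0; apply/eqP.
transitivity (\int[mu]_x (w x * phi x)).
  by apply: Rintegral_ae; apply: filterS wg => x ->.
by rewrite -E; apply: Rintegral_ae; apply: filterS wg' => x ->.
Qed.

Lemma wderiv_ae n u w : weak_derivative n u w ->
  {ae mu, forall x, wderiv n u x = w x}.
Proof.
move=> uw; apply: (weak_derivative_unique (n := n) (u := u)) => //.
exact: (@xgetI _ (cst 0) [set v | weak_derivative n u v] w).
Qed.

Lemma L1loc_ae u v : {ae mu, forall x, u x = v x} -> L1loc v -> L1loc u.
Proof.
by move=> uv [g lg vg]; exists g => //; apply: filterS2 uv vg => x -> ->.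
Qed.

Lemma weak_derivative_ae n u v w w' : {ae mu, forall x, u x = v x} ->
  {ae mu, forall x, w x = w' x} -> weak_derivative n v w' -> weak_derivative n u w.
Proof.
move=> uv ww' [lu lw H]; split; [exact: L1loc_ae lu|exact: L1loc_ae lw|].
move=> phi tt; transitivity (\int[mu]_x (v x * derive1n n phi x)).
  by apply: Rintegral_ae; apply: filterS uv => x ->.
by rewrite H//; congr (_ * _); apply: Rintegral_ae; apply: filterS ww' => x ->.
Qed.

Lemma H4_wderiv u v n : (n <= 4)%N -> H4 u -> L2 v -> {ae mu, forall x, u x = v x} ->
  exists2 w, L2 w & {ae mu, forall x, wderiv n u x = w x} /\
    {ae mu, forall p, T w p = iter n Dp (T v) p}.
Proof.
move=> n4 [_ /(_ n n4)[w0 /Lp2P[w lw w0w] uw0]] lv uv; exists w => //; split.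
  by apply: filterS2 (wderiv_ae uw0) w0w => x -> ->.
have vu : {ae mu, forall x, v x = u x} by apply: filterS uv => x ->.
have ww0 : {ae mu, forall x, w x = w0 x} by apply: filterS w0w => x ->.
have [_ _ H] := weak_derivative_ae vu ww0 uw0.
by apply: weak_derivative_hartley.
Qed.

Lemma H4_multiplier v n : (n <= 4)%N -> L2 v -> L2 (fun p => p ^+ 4 * T v p) ->
  [/\ L2 (T (iter n Dp (T v))), weak_derivative n v (T (iter n Dp (T v))) &
    {ae mu, forall p, T (T (iter n Dp (T v))) p = iter n Dp (T v) p}].
Proof.
move=> n4 lv l4; have lD := L2_iterDp n4 (L2_T lv) l4.
split; [exact: L2_T|exact: weak_derivative_multiplier|exact: TK].
Qed.

Lemma H4_of_multiplier v : L2 v -> L2 (fun p => p ^+ 4 * T v p) -> H4 v.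
Proof.
move=> lv l4; split; first exact: L2_Lp.
move=> n n4; have [lw vw _] := H4_multiplier n4 lv l4.
by exists (T (iter n Dp (T v))) => //; exact: L2_Lp.
Qed.

Section equation.
Variables (a b : R) (hb : b != 0).

(** Transforming the equation turns it into a two by two system for the values
    of the transform at [p] and [-p], solved by [Q]. The transform is injective,
    so the two forms are equivalent. *)
Lemma equation_hartley v w1 w4 S : L2 v -> L2 w1 -> L2 w4 -> L2 S ->
  {ae mu, forall p, T w1 p = Dp (T v) p} ->
  {ae mu, forall p, T w4 p = p ^+ 4 * T v p} ->
  {ae mu, forall x, T S x = w4 x - (b * w1 x + a * v x)} <->
  {ae mu, forall p, T v p = Q a b S p}.
Proof.
move=> lv lw1 lw4 lS Tw1 Tw4; set V := T v in Tw1 Tw4 *.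
pose r x := w4 x - (b * w1 x + a * v x).
have lbw := L2Z b lw1; have lav := L2Z a lv; have ls := L2D lbw lav.
have lr : L2 r by exact: L2B.
have Tr : {ae mu, forall p, T r p = (p ^+ 4 - a) * V p + b * p * V (- p)}.
  have e1 := TB lw4 ls; have e2 := TD lbw lav; have e3 := TZ b lw1; have e4 := TZ a lv.
  apply: filterS2 (filterI e1 e2) (filterI (filterI e3 e4) (filterI Tw1 Tw4)).
  move=> p [-> ->] [[-> ->] [-> ->]]; rewrite /Dp -/V; ring.
split => [E|E].
  have E' : T (T S) = T r by exact: T_eq_ae.
  have H : {ae mu, forall p, (p ^+ 4 - a) * V p + b * p * V (- p) = S p}.
    by apply: filterS2 Tr (TK lS) => p <- <-; rewrite E'.
  apply: filterS3 ae_neq0 H (ae_opp H) => p p0 Hp Hp'.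
  apply: (QP hb p0 Hp); rewrite -Hp' opprK expr4N; ring.
apply: (T_inj (L2_T lS) lr).
apply: filterS2 (filterI (TK lS) Tr) (filterI ae_neq0 (filterI E (ae_opp E))).
by move=> p [-> ->] [p0 [-> ->]]; rewrite (Q_system a hb).
Qed.

(** The equation on the transform side, for a Borel representative [v]. *)
Definition hartley_solution K F v := L2 v /\
  {ae mu, forall p, T v p = Q a b (convT K (T (nemytskii F v))) p}.

Section problem.
Variables (K K0 : R -> R) (F : R -> R -> R) (k l : R) (h : R -> R).
Hypotheses (lK : L1 K) (K0K : {ae mu, forall x, K0 x = K x}).
Hypothesis hF : assumptionA F k l h.

Lemma conv_representative u v x : {ae mu, forall y, u y = v y} -> L2 v ->
  \int[mu]_y (K0 (x - y) * F (u y) y) = conv K (nemytskii F v) x.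
Proof.
move=> uv lv; have [_ e] := nemytskiiP hF lv; apply: Rintegral_ae.
by apply: filterS3 (ae_reflect x K0K) uv e => y -> -> ->.
Qed.

Lemma is_solution_hartley u : is_solution a b K0 F u ->
  exists2 v, {ae mu, forall x, u x = v x} & hartley_solution K F v.
Proof.
move=> [Hu eqn]; have [/Lp2P[v lv uv] _] := Hu; exists v => //; split => //.
have [lN _] := nemytskiiP hF lv.
have [w1 lw1 [e1 T1]] := H4_wderiv (isT : (1 <= 4)%N) Hu lv uv.
have [w4 lw4 [e4 T4]] := H4_wderiv (isT : (4 <= 4)%N) Hu lv uv.
have lS := L2_convT lK (L2_T lN).
apply/(equation_hartley lv lw1 lw4 lS T1).
  by apply: filterS T4 => p ->; rewrite iter4Dp.
apply: filterS3 (filterI eqn uv) (filterI e1 e4) (conv_hartley lK lN).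
move=> x [+ ux] [w1x w4x] cx.
rewrite (conv_representative x uv lv) cx w1x w4x ux => E.
by apply/eqP; rewrite -subr_eq0; apply/eqP; rewrite -[RHS]E; ring.
Qed.

Lemma hartley_is_solution v : hartley_solution K F v ->
  L2 (fun p => p ^+ 4 * T v p) -> is_solution a b K0 F v.
Proof.
move=> [lv E] l4; split; first exact: H4_of_multiplier.
have [lN _] := nemytskiiP hF lv.
have [lw1 D1 T1] := H4_multiplier (isT : (1 <= 4)%N) lv l4.
have [lw4 D4 T4] := H4_multiplier (isT : (4 <= 4)%N) lv l4.
have lS := L2_convT lK (L2_T lN).
have T4' : {ae mu, forall p, T (T (iter 4 Dp (T v))) p = p ^+ 4 * T v p}.
  by apply: filterS T4 => p ->; rewrite iter4Dp.
have eqn := (equation_hartley lv lw1 lw4 lS T1 T4').2 E.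
apply: filterS3 (conv_hartley lK lN) eqn (filterI (wderiv_ae D1) (wderiv_ae D4)).
move=> x cx ex [-> ->]; rewrite (@conv_representative v v)//; last exact: aeW.
by rewrite cx ex; ring.
Qed.
End problem.
End equation.
End weak_solutions.

(** * Existence, uniqueness and stability *)

Section well_posedness.
Context {R : realType}.
Local Notation mu := (@lebesgue_measure R).
Implicit Types u v w S Phi phi : R -> R.
Variables (a b : R) (hb : b != 0).
Variables (F : R -> R -> R) (k l : R) (h : R -> R).
Hypothesis hF : assumptionA F k l h.
Variable C : R.
Hypotheses (C0 : 0 <= C) (Cl : kappa * C * l < 1).

Let one : R -> R := fun=> 1.
Let pow4 : R -> R := fun p => p ^+ 4.

(** The two weights control the solution and its fourth derivative. *)
Definition admissible_kernel K :=
  [/\ L1 K, symbol_bounded a b one K C & symbol_bounded a b pow4 K C].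

Let measurable_one : measurable_fun [set: R] one.
Proof. exact: measurable_cst. Qed.

Let measurable_pow4 : measurable_fun [set: R] pow4.
Proof. exact: measurable_funX. Qed.

Let oneN p : one (- p) = one p. Proof. by []. Qed.

Let pow4N p : pow4 (- p) = pow4 p. Proof. exact: expr4N. Qed.

Let kC0 : 0 <= kappa * C.
Proof. by rewrite mulr_ge0// (ltW kappa_gt0). Qed.

Let l0 : 0 < l. Proof. by have [_ []] := hF. Qed.

Lemma weighted_sol_lipschitz r K v w : measurable_fun [set: R] r ->
  (forall p, r (- p) = r p) -> L1 K -> symbol_bounded a b r K C -> L2 v -> L2 w ->
  nrm (fun p => weighted_sol a b r K (T (nemytskii F v)) p -
                weighted_sol a b r K (T (nemytskii F w)) p) <=
  kappa * C * l * nrm (fun x => v x - w x).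
Proof.
move=> mr rN lK bK lv lw.
have [lNv _] := nemytskiiP hF lv; have [lNw _] := nemytskiiP hF lw.
have lTv := L2_T lNv; have lTw := L2_T lNw; have lB := L2B lTv lTw.
have [_ le] := weighted_sol_L2 hb mr rN C0 lK bK lB.
have -> : (fun p => weighted_sol a b r K (T (nemytskii F v)) p -
    weighted_sol a b r K (T (nemytskii F w)) p) =
    weighted_sol a b r K (fun p => T (nemytskii F v) p - T (nemytskii F w) p).
  by apply/funext => p; rewrite weighted_solB.
rewrite (le_trans le)// -(mulrA _ l) ler_wpM2l// (nrm_TB lNv lNw).
exact: (nemytskii_lipschitz hF lv lw).
Qed.

(** A solution is a fixed point of the map that solves the linear problem with
    the nonlinearity frozen; its Lipschitz constant is [kappa * C * l]. *)
Lemma hartley_solution_exists K : admissible_kernel K ->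
  exists v, hartley_solution a b K F v.
Proof.
move=> [lK bK _].
pose A v := T (weighted_sol a b one K (T (nemytskii F v))).
have lW v : L2 v -> L2 (weighted_sol a b one K (T (nemytskii F v))).
  move=> lv; have [lN _] := nemytskiiP hF lv.
  by have [] := weighted_sol_L2 hb measurable_one oneN C0 lK bK (L2_T lN).
have [|v lv|v w lv lw|v lv vA] := @contraction_fixed_point R A (kappa * C * l).
- by rewrite Cl andbT mulr_ge0// ltW.
- exact/L2_T/lW.
- rewrite (nrm_TB (lW v lv) (lW w lw)).
  exact: weighted_sol_lipschitz.
exists v; split => //; rewrite (T_eq_ae vA).
by apply: filterS (TK (lW v lv)) => p ->; rewrite /weighted_sol mul1r.
Qed.

Lemma hartley_solution_pow4 K v : admissible_kernel K ->
  hartley_solution a b K F v -> L2 (fun p => p ^+ 4 * T v p).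
Proof.
move=> [lK _ bK] [lv E]; have [lN _] := nemytskiiP hF lv.
have [lW _] := weighted_sol_L2 hb measurable_pow4 pow4N C0 lK bK (L2_T lN).
apply: (L2_eq_ae _ lW).
  by apply: measurable_funM => //; exact: L2_measurable (L2_T lv).
by apply: filterS E => p ->.
Qed.

(** Insert the linear solution for the kernel [K'] and the source of [v]: the
    first difference is contracted, the second depends on [v] only. *)
Lemma hartley_solution_stable r K K' v v' : measurable_fun [set: R] r ->
  (forall p, r (- p) = r p) -> L1 K -> symbol_bounded a b r K C ->
  L1 K' -> symbol_bounded a b r K' C ->
  hartley_solution a b K F v -> hartley_solution a b K' F v' ->
  nrm (fun p => r p * (T v' p - T v p)) <=
    kappa * C * l * nrm (fun x => v' x - v x) +
    nrm (fun p => weighted_sol a b r K' (T (nemytskii F v)) p -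
                  weighted_sol a b r K (T (nemytskii F v)) p).
Proof.
move=> mr rN lK bK lK' bK' [lv E] [lv' E'].
have [lN _] := nemytskiiP hF lv; have [lN' _] := nemytskiiP hF lv'.
have [l1 _] := weighted_sol_L2 hb mr rN C0 lK' bK' (L2_T lN').
have [l2 _] := weighted_sol_L2 hb mr rN C0 lK' bK' (L2_T lN).
have [l3 _] := weighted_sol_L2 hb mr rN C0 lK bK (L2_T lN).
have le := weighted_sol_lipschitz mr rN lK' bK' lv' lv.
rewrite (nrm_ae (g := fun p => weighted_sol a b r K' (T (nemytskii F v')) p -
    weighted_sol a b r K (T (nemytskii F v)) p)); last first.
  by apply: filterS2 E E' => p -> ->; rewrite mulrBr.
by rewrite (le_trans (nrm_triangle l1 l2 l3))// lerD2r.
Qed.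

(** The stability estimate with weight one, where the contracted term is
    absorbed into the left-hand side. *)
Lemma hartley_solution_le K K' v v' : admissible_kernel K -> admissible_kernel K' ->
  hartley_solution a b K F v -> hartley_solution a b K' F v' ->
  (1 - kappa * C * l) * nrm (fun x => v' x - v x) <=
    nrm (fun p => weighted_sol a b one K' (T (nemytskii F v)) p -
                  weighted_sol a b one K (T (nemytskii F v)) p).
Proof.
move=> [lK bK _] [lK' bK' _] hv hv'; have [lv _] := hv; have [lv' _] := hv'.
have := hartley_solution_stable measurable_one oneN lK bK lK' bK' hv hv'.
rewrite (_ : (fun p => one p * _) = (fun p => T v' p - T v p)); last first.
  by apply/funext => p; rewrite mul1r.
by rewrite (nrm_TB lv' lv) mulrBl mul1r lerBlDl.
Qed.

Let Cl0 : 0 < 1 - kappa * C * l. Proof. by rewrite subr_gt0. Qed.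

Lemma hartley_solution_unique K v w : admissible_kernel K ->
  hartley_solution a b K F v -> hartley_solution a b K F w ->
  {ae mu, forall x, v x = w x}.
Proof.
move=> aK hv hw; have [lv _] := hv; have [lw _] := hw.
apply: nrm_sub_eq0 => //; apply/eqP; rewrite eq_le nrm_ge0 andbT.
rewrite -(ler_pM2l Cl0) mulr0 (le_trans (hartley_solution_le aK aK hw hv))//.
rewrite (_ : (fun p => _) = fun=> 0); first by rewrite /nrm dot0r sqrtr0.
by apply/funext => p; rewrite subrr.
Qed.

Lemma admissible_has_unique_solution K K0 : admissible_kernel K ->
  {ae mu, forall x, K0 x = K x} -> has_unique_solution a b K0 F.
Proof.
move=> aK K0K; have [lK _ _] := aK.
have [v hv] := hartley_solution_exists aK; exists v.
  exact: (hartley_is_solution hb lK K0K hF hv (hartley_solution_pow4 aK hv)).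
move=> u /(is_solution_hartley hb lK K0K hF)[w uw hw].
by apply: filterS2 uw (hartley_solution_unique aK hw hv) => x -> ->.
Qed.

Lemma solutions_cvg (K_ : nat -> R -> R) K (v_ : nat -> R -> R) v :
  (forall m, admissible_kernel (K_ m)) -> admissible_kernel K ->
  (forall p, hart (K_ m) p @[m --> \oo] --> hart K p) ->
  (forall m, hartley_solution a b (K_ m) F (v_ m)) -> hartley_solution a b K F v ->
  nrm (fun x => v_ m x - v x) @[m --> \oo] --> 0 /\
  nrm (fun p => p ^+ 4 * (T (v_ m) p - T v p)) @[m --> \oo] --> 0.
Proof.
move=> aK_ aK KK hv_ hv; have [lK b1 b4] := aK.
have lK_ m : L1 (K_ m) by have [] := aK_ m.
have b1_ m : symbol_bounded a b one (K_ m) C by have [] := aK_ m.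
have b4_ m : symbol_bounded a b pow4 (K_ m) C by have [] := aK_ m.
have [lv _] := hv; have [lN _] := nemytskiiP hF lv; have lT := L2_T lN.
have c1 := weighted_sol_cvg hb measurable_one oneN lK_ lK KK b1_ b1 lT.
have c4 := weighted_sol_cvg hb measurable_pow4 pow4N lK_ lK KK b4_ b4 lT.
have cv : nrm (fun x => v_ m x - v x) @[m --> \oo] --> 0.
  have c1' : (1 - kappa * C * l)^-1 *
      nrm (fun p => weighted_sol a b one (K_ m) (T (nemytskii F v)) p -
        weighted_sol a b one K (T (nemytskii F v)) p) @[m --> \oo] --> 0.
    by rewrite -(mulr0 (1 - kappa * C * l)^-1); apply: cvgM => //; exact: cvg_cst.
  apply: (squeeze_cvgr _ (cvg_cst 0) c1'); apply: nearW => m.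
  rewrite nrm_ge0/= ler_pdivlMl//.
  exact: hartley_solution_le.
split => //.
have c4' : kappa * C * l * nrm (fun x => v_ m x - v x) +
    nrm (fun p => weighted_sol a b pow4 (K_ m) (T (nemytskii F v)) p -
      weighted_sol a b pow4 K (T (nemytskii F v)) p) @[m --> \oo] --> 0.
  have E : kappa * C * l * nrm (fun x => v_ m x - v x) +
    nrm (fun p => weighted_sol a b pow4 (K_ m) (T (nemytskii F v)) p -
      weighted_sol a b pow4 K (T (nemytskii F v)) p) @[m --> \oo] -->
      kappa * C * l * 0 + 0.
    by apply: cvgD => //; apply: cvgM => //; exact: cvg_cst.
  by rewrite mulr0 addr0 in E.
apply: (squeeze_cvgr _ (cvg_cst 0) c4'); apply: nearW => m.
rewrite nrm_ge0/=; exact: (hartley_solution_stable (r := pow4)).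
Qed.

Lemma H4norm_hartley u v : {ae mu, forall x, u x = v x} -> L2 v ->
  L2 (fun p => p ^+ 4 * T v p) ->
  H4norm u = (Num.sqrt (nrm v ^+ 2 + nrm (fun p => (p ^+ 4 * T v p)%R) ^+ 2))%:E.
Proof.
move=> uv lv l4; have [lw D4 T4] := H4_multiplier (isT : (4 <= 4)%N) lv l4.
have uw := wderiv_ae (weak_derivative_ae uv (aeW _ (fun=> erefl)) D4).
rewrite /H4norm (normLp2E lv uv) (normLp2E lw uw).
rewrite (nrm_T (L2_iterDp (isT : (4 <= 4)%N) (L2_T lv) l4)).
rewrite (_ : iter 4 Dp (T v) = fun p => p ^+ 4 * T v p); last first.
  by apply/funext => p; exact: iter4Dp.
by rewrite -!EFin_expe -EFinD poweR_EFin powR12_sqrt// addr_ge0// sqr_ge0.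
Qed.

Lemma admissible_solutions_cvg (G_ K_ : nat -> R -> R) G K (u_ : nat -> R -> R) u :
  (forall m, admissible_kernel (K_ m)) -> admissible_kernel K ->
  (forall m, {ae mu, forall x, G_ m x = K_ m x}) -> {ae mu, forall x, G x = K x} ->
  (forall p, hart (K_ m) p @[m --> \oo] --> hart K p) ->
  (forall m, is_solution a b (G_ m) F (u_ m)) -> is_solution a b G F u ->
  H4norm (fun x => u_ m x - u x) @[m --> \oo] --> 0%E.
Proof.
move=> aK_ aK GK_ GK KK su_ su; have [lK _ _] := aK.
have [v uv hv] := is_solution_hartley hb lK GK hF su.
have /choice[v_ hv_] m : exists v, {ae mu, forall x, u_ m x = v x} /\
    hartley_solution a b (K_ m) F v.
  have [lKm _ _] := aK_ m.
  by have [w] := is_solution_hartley hb lKm (GK_ m) hF (su_ m); exists w.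
have [c1 c4] := solutions_cvg aK_ aK KK (fun m => (hv_ m).2) hv.
have [lv _] := hv; have l4 := hartley_solution_pow4 aK hv.
have E m : H4norm (fun x => u_ m x - u x) =
    (Num.sqrt (nrm (fun x => (v_ m x - v x)%R) ^+ 2 +
      nrm (fun p => (p ^+ 4 * (T (v_ m) p - T v p))%R) ^+ 2))%:E.
  have [uvm hvm] := hv_ m; have [lvm _] := hvm.
  have l4m := hartley_solution_pow4 (aK_ m) hvm.
  have lB := L2B lvm lv; have TBm := TB lvm lv.
  have e4 : {ae mu, forall p, p ^+ 4 * T (fun x => v_ m x - v x) p =
      p ^+ 4 * (T (v_ m) p - T v p)} by apply: filterS TBm => p ->.
  rewrite (@H4norm_hartley _ (fun x => v_ m x - v x)) ?(nrm_ae e4)//.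
    by apply: filterS2 uvm uv => x -> ->.
  apply: (L2_eq_ae _ (L2B l4m l4)).
    by apply: measurable_funM => //; exact: L2_measurable (L2_T lB).
  by apply: filterS e4 => p ->; rewrite mulrBr.
under eq_fun do rewrite E.
apply: cvg_EFin; first exact: nearW.
rewrite -(sqrtr0 R); apply: continuous_cvg; first exact: sqrt_continuous.
rewrite -(addr0 0) -(mulr0 0).
by apply: cvgD; exact: cvgM.
Qed.

(** If [u] is zero then so is the right-hand side of the two by two system,
    whose squared length factors by [convT_sqr]. *)
Lemma zero_solution_hartley K G phi : admissible_kernel K ->
  {ae mu, forall x, G x = K x} -> L2 phi -> {ae mu, forall x, phi x = F 0 x} ->
  forall u, is_solution a b G F u -> {ae mu, forall x, u x = 0} ->
  {ae mu, forall p, (cosT K p ^+ 2 + sinT K p ^+ 2) *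
                    (T phi p ^+ 2 + T phi (- p) ^+ 2) = 0}.
Proof.
move=> aK GK lphi phiF u su u0; have [lK _ _] := aK.
have [v uv [lv E]] := is_solution_hartley hb lK GK hF su.
have v0 : {ae mu, forall x, v x = 0} by apply: filterS2 u0 uv => x <- ->.
have [lN N0] := nemytskiiP hF lv.
rewrite (T_eq_ae (g := nemytskii F v)); last first.
  by apply: filterS3 phiF N0 v0 => x -> -> ->.
set Phi := T (nemytskii F v) in E *.
have TV0 : {ae mu, forall p, T v p = 0}.
  apply: nrm_eq0; first exact: L2_T.
  by rewrite (nrm_T lv) (nrm_ae v0) /nrm dot0r sqrtr0.
apply: filterS2 (filterI ae_neq0 (filterI E (ae_opp E))) (filterI TV0 (ae_opp TV0)).
move=> p [p0 [Ep Ep']] [V0 V0'].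
have := Q_sqr a hb (convT K Phi) p0; rewrite -Ep -Ep' V0 V0' expr0n addr0 convT_sqr.
move/esym/eqP; rewrite mulf_eq0 invr_eq0 (gt_eqF (den_gt0 a hb p0)) orbF.
rewrite -mulrA mulf_eq0 sqrf_eq0 (gt_eqF kappa_gt0) /= => /eqP.
by [].
Qed.
End well_posedness.

(** * Comparison with the Fourier transform *)

Section fourier_bridge.
Context {R : realType}.
Local Notation mu := (@lebesgue_measure R).
Implicit Types f g phi K G : R -> R.
Local Open Scope complex_scope.

Lemma fourier_hartley G K p : L1 K -> {ae mu, forall x, G x = K x} ->
  fourier G p = cosT K p +i* (- sinT K p).
Proof.
move=> lK GK; rewrite /fourier /Cintegral.
have -> : \int[mu]_x complex.Re ((G x)%:C * expi (- (p * x))) =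
    \int[mu]_x (K x * cos (p * x)).
  apply: Rintegral_ae; apply: filterS GK => x ->.
  by rewrite /expi /= cosN mul0r subr0.
have -> : \int[mu]_x complex.Im ((G x)%:C * expi (- (p * x))) =
    - \int[mu]_x (K x * sin (p * x)).
  rewrite -(RintN (L1_sin lK p)); apply: Rintegral_ae; apply: filterS GK => x ->.
  by rewrite /expi /= sinN mul0r addr0 mulrN.
rewrite -(cosTE lK) -(sinTE lK) /hc.
by apply/eqP; rewrite eq_complex /= !mul0r subr0 addr0 mulrN !eqxx.
Qed.

Lemma cmod_fourier G K p : L1 K -> {ae mu, forall x, G x = K x} ->
  cmod (fourier G p) = Num.sqrt (cosT K p ^+ 2 + sinT K p ^+ 2).
Proof. by move=> lK GK; rewrite (fourier_hartley p lK GK) /cmod /= sqrrN. Qed.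

Lemma cmod_symb a b (p : R) : cmod (symb a b p) = Num.sqrt (den a b p).
Proof. by rewrite /cmod /symb /= sqrrN. Qed.

Lemma normLp_infty_le (f : R -> R) (C : R) : (normLp +oo%E f <= C%:E)%E ->
  {ae mu, forall p, `|f p| <= C}.
Proof.
rewrite /normLp unlock.
have -> : (0 < mu [set: R])%E.
  apply: (@lt_le_trans _ _ (mu `[0, 1]%classic)); last by apply: le_measure; rewrite ?inE.
  by rewrite lebesgue_measure_itv/= lte01 sube0.
by move=> /ess_supP; apply: filterS.
Qed.

Lemma symbol_bounded_fourier (a b : R) (r G K : R -> R) (C : R) : b != 0 -> 0 <= C -> L1 K ->
  {ae mu, forall x, G x = K x} ->
  (normLp +oo%E (fun p => cmod ((r p)%:C * fourier G p / symb a b p)%R) <= C%:E)%E ->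
  symbol_bounded a b r K C.
Proof.
move=> hb C0 lK GK /normLp_infty_le H; apply: filterS2 ae_neq0 H => p p0.
have d0 := den_gt0 a hb p0.
have -> : cmod ((r p)%:C * fourier G p / symb a b p) =
    `|r p| * cmod (fourier G p) / cmod (symb a b p).
  by rewrite /cmod !Normc.normcM Normc.normcV /= expr0n addr0 sqrtr_sqr.
rewrite (cmod_fourier p lK GK) cmod_symb ger0_norm; last first.
  by rewrite !mulr_ge0 ?invr_ge0 ?sqrtr_ge0.
rewrite ler_pdivrMr ?sqrtr_gt0// => le.
have s0 : 0 <= cosT K p ^+ 2 + sinT K p ^+ 2 by rewrite addr_ge0// sqr_ge0.
rewrite -(sqr_sqrtr s0) -(sqr_sqrtr (ltW d0)) -[r p ^+ 2]real_normK ?num_real//.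
by rewrite -!exprMn ler_pXn2r// ?nnegrE// mulr_ge0 ?sqrtr_ge0.
Qed.

Lemma Nab_symbol_bounded (a b : R) (G K : R -> R) (C : R) : b != 0 -> 0 <= C -> L1 K ->
  {ae mu, forall x, G x = K x} -> (Nab a b G <= C%:E)%E ->
  symbol_bounded a b (fun=> 1) K C /\ symbol_bounded a b (fun p => p ^+ 4) K C.
Proof.
move=> hb C0 lK GK; rewrite /Nab ge_max => /andP[N0 N4]; split.
  apply: (symbol_bounded_fourier hb C0 lK GK).
  by under eq_fun do rewrite mul1r.
exact: (symbol_bounded_fourier hb C0 lK GK).
Qed.

Lemma smallness_const (l eps : R) (N : \bar R) : 0 < l -> 0 < eps < 1 ->
  ((2 * Num.sqrt pi)%:E * N * l%:E <= (1 - eps)%:E)%E ->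
  (N <= ((1 - eps) / (2 * Num.sqrt pi * l))%:E)%E.
Proof.
move=> l0 /andP[e0 e1]; have s0 : 0 < 2 * Num.sqrt pi :> R.
  by rewrite mulr_gt0// sqrtr_gt0 pi_gt0.
case: N => [r| |]; last by rewrite leNye.
- rewrite -!EFinM !lee_fin => H; rewrite ler_pdivlMr; last exact: mulr_gt0.
  by rewrite mulrCA mulrA.
- by rewrite gt0_muley ?lte_fin// gt0_mulye ?lte_fin// leye_eq.
Qed.

Lemma hart_cvg (K_ : nat -> R -> R) K p : (forall m, L1 (K_ m)) -> L1 K ->
  \int[mu]_x `|K_ m x - K x| @[m --> \oo] --> 0 ->
  hart (K_ m) p @[m --> \oo] --> hart K p.
Proof.
move=> lK_ lK c; apply/subr_cvg0.
have c0 : hc * (2 * \int[mu]_x `|K_ m x - K x|) @[m --> \oo] --> 0.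
  have E : hc * (2 * \int[mu]_x `|K_ m x - K x|) @[m --> \oo] --> (hc * (2 * 0) : R).
    by apply: cvgM; [exact: cvg_cst|apply: cvgM => //; exact: cvg_cst].
  by rewrite !mulr0 in E.
apply: norm_cvg0; apply: (squeeze_cvgr _ (cvg_cst 0) c0); apply: nearW => m.
rewrite normr_ge0/= -hartB//.
exact: (hart_bounded (L1B (lK_ m) lK)).
Qed.

(** The bound is a closed condition on the values of the transforms. *)
Lemma symbol_bounded_cvg (a b : R) r (K_ : nat -> R -> R) K (C : R) :
  (forall p, hart (K_ m) p @[m --> \oo] --> hart K p) ->
  (forall m, symbol_bounded a b r (K_ m) C) -> symbol_bounded a b r K C.
Proof.
move=> hK /ae_foralln; apply: filterS => p H.
have [cc cs] := hart_cvg_cosT_sinT p hK.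
have c : r p ^+ 2 * (cosT (K_ m) p ^+ 2 + sinT (K_ m) p ^+ 2) @[m --> \oo] -->
    r p ^+ 2 * (cosT K p ^+ 2 + sinT K p ^+ 2).
  by apply: cvgM; [exact: cvg_cst|apply: cvgD; exact: cvgM].
by apply: (cvgr_to_le c); apply: nearW.
Qed.

(** For truncations the real and imaginary parts of the Fourier transform are
    the even and minus the odd part of the Hartley transform; both are continuous
    in [L^2], so [fhat] is given by the parts of [T phi]. *)
Lemma fourierL2_hartley f phi (fhat : R -> R[i]) : L2 phi ->
  {ae mu, forall x, f x = phi x} -> is_fourierL2 f fhat ->
  {ae mu, forall p, T phi p ^+ 2 + T phi (- p) ^+ 2 = 0 -> fhat p = 0}.
Proof.
move=> lphi fphi [/Lp2P[A lA reA] /Lp2P[B lB imB] c].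
have lT := L2_T lphi; have lTo := L2_opp lT.
pose h n := hart (trunc n phi).
have lh n : L2 (h n) by exact: L2_hart_trunc.
have lho n := L2_opp (lh n).
pose ct n := cosT (trunc n phi); pose st n := sinT (trunc n phi).
have half g : L2 g -> L2 (fun x => g x / 2).
  by move=> /(L2Z 2^-1); apply: L2_eq => x; rewrite mulrC.
have lct n : L2 (ct n) by exact: half (L2D (lh n) (lho n)).
have lst n : L2 (st n) by exact: half (L2B (lh n) (lho n)).
pose D n p := Num.sqrt ((ct n p - A p) ^+ 2 + (- st n p - B p) ^+ 2).
have l1 n := L2B (lct n) lA; have l2 n := L2B (L2N (lst n)) lB.
have s0 n p : 0 <= (ct n p - A p) ^+ 2 + (- st n p - B p) ^+ 2.
  by rewrite addr_ge0// sqr_ge0.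
have lD n : L2 (D n).
  split; last first.
    apply: (L1_eq _ (L1D (l1 n).2 (l2 n).2)) => p.
    by rewrite /D sqr_sqrtr.
  have ms : measurable_fun [set: R] (@Num.sqrt R).
    exact: (continuous_measurable_fun (@sqrt_continuous R)).
  apply: (measurableT_comp ms).
  by apply: measurable_funD; apply: measurable_funX; [exact: (l1 n).1|exact: (l2 n).1].
have cD : nrm (D n) @[n --> \oo] --> 0.
  apply: (cvg_normLp2 lD _).1 c => n.
  apply: filterS2 reA imB => p reAp imBp.
  have e : {ae mu, forall x, f x * \1_(`[- n%:R, n%:R]) x = trunc n phi x}.
    by apply: filterS fphi => x ->.
  rewrite (fourier_hartley p (L1_trunc n lphi) e) /D /cmod -reAp -imBp.
  by case: (fhat p) => x y.
have cT := (T_spec lphi).2.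
have cTo : nrm (fun p => h n (- p) - T phi (- p)) @[n --> \oo] --> 0.
  apply: cvg_trans cT; apply: near_eq_cvg; apply: nearW => n.
  rewrite -(nrm_opp (L2_measurable (L2B (lh n) lT))).
  by [].
have cS : nrm (fun p => h n p - T phi p) + nrm (fun p => h n (- p) - T phi (- p))
    @[n --> \oo] --> 0.
  by rewrite -(addr0 0); exact: cvgD.
have ub (s : R) n : `|s| <= 1 ->
  nrm (fun p => (h n p + s * h n (- p)) / 2 - (T phi p + s * T phi (- p)) / 2) <=
  nrm (fun p => h n p - T phi p) + nrm (fun p => h n (- p) - T phi (- p)).
  move=> s1; have a1 := L2B (lh n) lT; have a2 := L2B (lho n) lTo.
  rewrite (_ : (fun p => _) = (fun p => 2^-1 * (h n p - T phi p) +
    s / 2 * (h n (- p) - T phi (- p)))); last by apply/funext => p; field.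
  rewrite (le_trans (nrmD (L2Z _ a1) (L2Z _ a2)))// !nrmZ// lerD//.
    by rewrite ler_piMl ?nrm_ge0// gtr0_norm ?invr_gt0// invf_le1// ler1n.
  rewrite ler_piMl ?nrm_ge0// normrM normfV (ger0_norm (ler0n _ 2)).
  by rewrite ler_pdivrMr// mul1r (le_trans s1)// ler1n.
have cA : {ae mu, forall p, (T phi p + 1 * T phi (- p)) / 2 = A p}.
  apply: (L2_unique_limit lct) => //.
  - by apply: half; exact: L2D lT (L2Z 1 lTo).
  - apply: (squeeze_cvgr _ (cvg_cst 0) cS); apply: nearW => n.
    rewrite nrm_ge0/= (le_trans _ (ub 1 n _)) ?normr1//.
    by rewrite /ct /cosT -/(h n); under [in X in _ <= X]eq_fun do rewrite mul1r.
  - apply: (squeeze_cvgr _ (cvg_cst 0) cD); apply: nearW => n; rewrite nrm_ge0/=.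
    apply: le_nrm => // p; rewrite [leRHS]ger0_norm ?sqrtr_ge0//.
    by rewrite -sqrtr_sqr ler_sqrt// lerDl sqr_ge0.
have cB : {ae mu, forall p, (T phi p + -1 * T phi (- p)) / 2 = - B p}.
  apply: (L2_unique_limit lst) => //.
  - by apply: half; exact: L2D lT (L2Z (-1) lTo).
  - exact: L2N.
  - apply: (squeeze_cvgr _ (cvg_cst 0) cS); apply: nearW => n.
    rewrite nrm_ge0/= (le_trans _ (ub (-1) n _)) ?normrN1//.
    by rewrite /st /sinT -/(h n); under [in X in _ <= X]eq_fun do rewrite mulN1r.
  - apply: (squeeze_cvgr _ (cvg_cst 0) cD); apply: nearW => n; rewrite nrm_ge0/=.
    apply: le_nrm => //; first by apply: L2B => //; exact: L2N.
    move=> p; rewrite [leRHS]ger0_norm ?sqrtr_ge0//.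
    rewrite -normrN opprB -sqrtr_sqr ler_sqrt// (addrC (- B p)).
    by rewrite lerDr sqr_ge0.
apply: filterS2 (filterI cA cB) (filterI reA imB) => p [Ap Bp] [rep imp] /eqP.
rewrite paddr_eq0 ?sqr_ge0// !sqrf_eq0 => /andP[/eqP T0 /eqP T0'].
move: Ap Bp; rewrite T0 T0' !mulr0 addr0 mul0r => A0 /esym/eqP; rewrite oppr_eq0 => /eqP B0.
by move: rep imp; rewrite -A0 B0; case: (fhat p) => x y /= -> ->.
Qed.
End fourier_bridge.

(** * The smallness condition and nontriviality *)

Section smallness.
Context {R : realType}.
Local Notation mu := (@lebesgue_measure R).

(** The contraction constant is [sqrt (2 pi) * C * l], and
    [sqrt (2 pi) <= 2 sqrt pi]. *)
Lemma kappa_smallness (l eps : R) : 0 < l -> 0 < eps < 1 ->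
  kappa * ((1 - eps) / (2 * Num.sqrt pi * l)) * l < 1.
Proof.
move=> l0 /andP[e0 e1].
have s0 : 0 < 2 * Num.sqrt pi :> R by rewrite mulr_gt0// sqrtr_gt0 pi_gt0.
have ks : kappa <= 2 * Num.sqrt pi :> R.
  have -> : 2 = Num.sqrt (2 ^+ 2) :> R by rewrite sqrtr_sqr ger0_norm.
  rewrite -sqrtrM ?sqr_ge0// ler_sqrt ?mulr_ge0 ?sqr_ge0 ?pi_ge0//.
  by rewrite ler_wpM2r ?pi_ge0//; lra.
have -> : kappa * ((1 - eps) / (2 * Num.sqrt pi * l)) * l =
    kappa / (2 * Num.sqrt pi) * (1 - eps).
  move: (2 * Num.sqrt pi) s0 => s s0; field.
  by rewrite !lt0r_neq0.
apply: (@le_lt_trans _ _ (1 * (1 - eps))); last by rewrite mul1r; lra.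
rewrite ler_wpM2r ?subr_ge0 ?(ltW e1)//.
by rewrite ler_pdivrMr// mul1r.
Qed.

(** A zero solution makes the product of the two transforms vanish almost
    everywhere. *)
Lemma solution_not_identically_zero (a b : R) (F : R -> R -> R) k l h C
    (K G u : R -> R) (F0hat : R -> R[i]) : b != 0 -> assumptionA F k l h ->
  admissible_kernel a b C K -> {ae mu, forall x, G x = K x} ->
  is_fourierL2 (F 0) F0hat -> is_solution a b G F u ->
  supports_meet F0hat (fourier G) -> not_identically_zero u.
Proof.
move=> hb hF aK GK hF0 su meet u0; apply: meet; have [lK _ _] := aK.
have [lphi phiF] := nemytskiiP hF L2_0.
have Fphi : {ae mu, forall x, F 0 x = nemytskii F (cst 0) x}.
  by apply: filterS phiF => x ->.
have Z := zero_solution_hartley hb hF aK GK lphi phiF su u0.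
have F0 := fourierL2_hartley lphi Fphi hF0.
suff : {ae mu, forall p, ~ (F0hat p != 0 /\ fourier G p != 0)}.
  by apply: negligibleS => p [? ?] /=; exact.
apply: filterS2 Z F0 => p /eqP + F0p [f0 g0]; rewrite mulf_eq0 => /orP[|].
  rewrite paddr_eq0 ?sqr_ge0// !sqrf_eq0 => /andP[/eqP c0 /eqP s0].
  by move: g0; rewrite (fourier_hartley p lK GK) c0 s0 oppr0 eqxx.
by move=> /eqP /F0p f0'; rewrite f0' eqxx in f0.
Qed.
End smallness.
Theorem theorem2 (R : realType) (a b : R) (hb : b != 0) (ha : 0 <= a)
    (G_ : nat -> R -> R) (G : R -> R)
    (hG_ : forall m, Lp 1%:E (G_ m)) (hG : cvg_Lp 1%:E G_ G)
    (F : R -> R -> R) (k l : R) (h : R -> R) (hF : assumptionA F k l h)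
    (eps : R) (heps : 0 < eps < 1)
    (hN : forall m,
      ((2 * Num.sqrt pi)%:E * Nab a b (G_ m) * l%:E <= (1 - eps)%:E)%E)
    (hcase : 0 < a \/
      [/\ a = 0,
          forall m, Lp 1%:E (fun x => x * G_ m x),
          cvg_Lp 1%:E (fun m x => x * G_ m x) (fun x => x * G x) &
          forall m, \int[@lebesgue_measure R]_x G_ m x = 0]) :
  [/\ (forall m, has_unique_solution a b (G_ m) F),
      has_unique_solution a b G F,
      (forall (u_ : nat -> R -> R) (u : R -> R),
         (forall m, is_solution a b (G_ m) F (u_ m)) ->
         is_solution a b G F u ->
         H4norm (fun x => u_ m x - u x) @[m --> \oo] --> 0%E),
      (forall (F0hat : R -> R[i]) (m : nat) (u : R -> R),
         is_fourierL2 (F 0) F0hat ->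
         is_solution a b (G_ m) F u ->
         supports_meet F0hat (fourier (G_ m)) ->
         not_identically_zero u) &
      (forall (F0hat : R -> R[i]) (u : R -> R),
         is_fourierL2 (F 0) F0hat ->
         is_solution a b G F u ->
         supports_meet F0hat (fourier G) ->
         not_identically_zero u)].
Proof.
have [_ [_ l0] _ _ _] := hF.
have [cG] := hG; rewrite Lp1P in cG; case: cG => K lK GK cvgG.
have /choice[K_ HK_] m : exists K', L1 K' /\
    {ae @lebesgue_measure R, forall x, G_ m x = K' x}.
  by have [g lg Gg] := (Lp1P (G_ m)).1 (hG_ m); exists g.
have lK_ m : L1 (K_ m) := (HK_ m).1.
have GK_ m := (HK_ m).2.
have KK p : hart (K_ m) p @[m --> \oo] --> hart K p.
  apply: hart_cvg => //.
  have E m : normLp 1%:E (fun x => G_ m x - G x) =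
      (\int[@lebesgue_measure R]_x `|K_ m x - K x|)%:E.
    apply: normLp1E; first exact: L1B.
    by apply: filterS2 (GK_ m) GK => x -> ->.
  by move: cvgG; under eq_fun do rewrite E; move/fine_cvgP => [].
pose C := (1 - eps) / (2 * Num.sqrt pi * l).
have C0 : 0 <= C.
  have /andP[e0 e1] := heps; rewrite divr_ge0 ?subr_ge0 ?(ltW e1)//.
  by rewrite !mulr_ge0 ?sqrtr_ge0 ?(ltW l0).
have Cl := kappa_smallness l0 heps.
have B_ m := Nab_symbol_bounded hb C0 (lK_ m) (GK_ m)
  (smallness_const l0 heps (hN m)).
have aK_ m : admissible_kernel a b C (K_ m).
  by split; [exact: lK_|exact: (B_ m).1|exact: (B_ m).2].
have aK : admissible_kernel a b C K.
  by split => //; apply: (symbol_bounded_cvg KK) => m; have [] := aK_ m.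
split.
- by move=> m; exact: (admissible_has_unique_solution hb hF C0 Cl (aK_ m)).
- exact: (admissible_has_unique_solution hb hF C0 Cl aK).
- move=> u_ u su_ su.
  exact: (admissible_solutions_cvg hb hF C0 Cl aK_ aK GK_ GK KK su_ su).
- move=> F0hat m u; exact: (solution_not_identically_zero hb hF (aK_ m) (GK_ m)).
- move=> F0hat u; exact: (solution_not_identically_zero hb hF aK GK).
Qed.
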